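(* Let $\mathcal{C}$ be the plane curve over $K$ with equation $A(Y)=B(X)$, where $A(Y)=a_nY^{p^n}+a_{n-1}Y^{p^{n-1}}+\cdots+a_0Y$ with $a_j\in K$, $a_0,a_n\neq0$; $B(X)=b_mX^m+b_{m-1}X^{m-1}+\cdots+b_0$ with $b_j\in K$, $b_m\neq 0$; $p\nmid m$; $n\ge1$, $m\ge2$; and $\deg(\mathcal{C})\ge4$. Suppose that $m\not\equiv1\pmod{p^n}$ and that $B(X)$ has just one root in $K$, so that the equation of $\mathcal{C}$ reads $$b_m\left(X+\frac{b_{m-1}}{mb_m}\right)^m=A(Y).$$ Then one of the following two cases occurs. (i) $m$ divides $p^n+1$ and $A(Y)$ is $p^n$-linearized, that is, $A(Y)=a_nY^{p^n}+a_0Y$. In this case, $\mathcal{C}$ is projectively equivalent to the curve $\mathcal{Q}_m$ with equation $X^m=Y^{p^n}+Y$. (ii) $m$ does not divide $p^n+1$ or $A(Y)$ is not $p^n$-linearized. Let $d=\gcd(j\ge1 : a_j\neq0)$ be the largest integer such that $A(Y)$ is $p^d$-linearized. Then $\mathrm{Aut}_K(\mathcal{C})$ has order $p^nm(p^d-1)$ and $\mathrm{Aut}_K(\mathcal{C})=G\rtimes C$, where $G=\{(x,y)\mapsto(x,y+a)\mid A(a)=0\}$ and $$C=\left\{(x,y)\mapsto\left(bx+\frac{(b-1)b_{m-1}}{mb_m},\,b^my\right)\mid b^{m(p^d-1)}=1\right\}.$$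
   Context: $p$ is a prime and $K$ is the algebraic closure of $\mathbb{F}_p$. The function field of $\mathcal{C}$ is $K(x,y)$ with $A(y)=B(x)$. $\mathrm{Aut}_K(\mathcal{C})$ is the group of $K$-automorphisms of $K(x,y)$ (equivalently, of the nonsingular model of $\mathcal{C}$); $(x,y)\mapsto(x',y')$ denotes the automorphism sending $x$ to $x'$ and $y$ to $y'$. A polynomial $A(Y)$ is $p^d$-linearized if it is a $K$-linear combination of the monomials $Y^{p^{di}}$, $i\ge0$. The parameters $b$ and $a$ range over $K$. The curve $\mathcal{Q}_m$ in case (i), with $m<p^n$ and $p^n\equiv-1\pmod m$, is the known one whose automorphism group contains a cyclic normal subgroup $C_m$ of order $m$ with $\mathrm{Aut}_K(\mathcal{Q}_m)/C_m\cong \mathrm{PGL}(2,p^n)$. *)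

(* Defs.v *)
From HB Require Import structures.
From mathcomp Require Import all_boot all_order all_algebra.
From mathcomp Require Import boolp classical_sets functions cardinality.
From mathcomp Require Import mpoly.

Set Implicit Arguments.
Unset Strict Implicit.
Unset Printing Implicit Defensive.

Import GRing.Theory.
Local Open Scope ring_scope.

(* [A] is a [K]-linear combination of the monomials [Y^(q^i)], [i >= 0].
   A [p^d]-linearized polynomial is the case [q = p ^ d]. *)
Definition linearized (K : nzRingType) (q : nat) (A : {poly K}) : Prop :=
  exists (N : nat) (c : nat -> K), A = \sum_(i < N) c i *: 'X^(q ^ i).

Section PlaneCurves.
Variable K : fieldType.

(* Plane curves are given by a polynomial of [{mpoly K[2]}], where ['X_0] is
   the affine coordinate X and ['X_1] is the affine coordinate Y. *)

Definition poly_in n (i : 'I_n) (P : {poly K}) : {mpoly K[n]} :=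
  (map_poly (@mpolyC n K) P).['X_i].

Definition separated_curve (A B : {poly K}) : {mpoly K[2]} :=
  poly_in 1 A - poly_in 0 B.

Definition curve_degree (f : {mpoly K[2]}) : nat := (msize f).-1.

Definition homogenize (f : {mpoly K[2]}) : {mpoly K[3]} :=
  \sum_(u <- msupp f) f@_u *:
    ('X_0 ^+ u 0 * 'X_1 ^+ u 1 * 'X_2 ^+ (curve_degree f - mdeg u)).

Definition linear_subst (M : 'M[K]_3) (P : {mpoly K[3]}) : {mpoly K[3]} :=
  P \mPo [tuple \sum_(j < 3) M i j *: 'X_j | i < 3].

Definition projectively_equivalent (f g : {mpoly K[2]}) : Prop :=
  exists (M : 'M[K]_3) (c : K),
    [/\ M \in unitmx, c != 0 &
        linear_subst M (homogenize f) = c *: homogenize g].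

Section FunctionField.
Variables (F : fieldType) (iota : {rmorphism K -> F}).

Definition eval_at (x y : F) : {mpoly K[2]} -> F :=
  mmap iota (fun i : 'I_2 => if i == 0 then x else y).

(* The field [F], viewed over [K] through [iota], is the fraction field of
   [K[X, Y] / (f)], with [x] and [y] the classes of X and Y. *)
Definition is_function_field (f : {mpoly K[2]}) (x y : F) : Prop :=
  (forall P, eval_at x y P = 0 <-> exists Q, P = Q * f) /\
  (forall z, exists P Q, eval_at x y Q != 0 /\ z = eval_at x y P / eval_at x y Q).

Definition is_kaut (s : F -> F) : Prop :=
  [/\ zmod_morphism s, monoid_morphism s, bijective s &
      forall c, s (iota c) = iota c].

Record kaut := KAut { kaut_fun :> F -> F; _ : `[< is_kaut kaut_fun >] }.

HB.instance Definition _ := [isSub for kaut_fun].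
HB.instance Definition _ := [Choice of kaut by <:].

Lemma kautP (s : kaut) : is_kaut s.
Proof. by case: s => s /= /asboolP. Qed.

Lemma kaut_surj (s : kaut) (z : F) : exists w, s w = z.
Proof. by have [_ _ [g _ gK] _] := kautP s; exists (g z). Qed.

Definition kaut_invfun (s : kaut) (z : F) : F := projT1 (cid (kaut_surj s z)).

Lemma kaut_invfunK (s : kaut) : cancel (kaut_invfun s) s.
Proof. by move=> z; rewrite /kaut_invfun; case: cid. Qed.

Lemma kaut_inj (s : kaut) : injective s.
Proof. by have [_ _ /bij_inj] := kautP s. Qed.

Lemma kaut_funK (s : kaut) : cancel s (kaut_invfun s).
Proof. by move=> z; apply: (@kaut_inj s); rewrite kaut_invfunK. Qed.

Lemma kaut_one_subproof : `[< is_kaut id >].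
Proof. by apply/asboolP; split=> //; exists id. Qed.

Lemma kaut_mul_subproof (s t : kaut) : `[< is_kaut (s \o t) >].
Proof.
apply/asboolP; have [sB [s1 sM] s_bij sK] := kautP s.
have [tB [t1 tM] t_bij tK] := kautP t; split.
- by move=> u v /=; rewrite tB sB.
- by split=> [|u v] /=; rewrite ?t1 ?s1 ?tM ?sM.
- exact: bij_comp.
- by move=> c /=; rewrite tK sK.
Qed.

Lemma kaut_inv_subproof (s : kaut) : `[< is_kaut (kaut_invfun s) >].
Proof.
apply/asboolP; have [sB [s1 sM] s_bij sK] := kautP s; split.
- by move=> u v; apply: (@kaut_inj s); rewrite sB !kaut_invfunK.
- split=> [|u v]; first by rewrite -[in LHS]s1 kaut_funK.
  by apply: (@kaut_inj s); rewrite sM !kaut_invfunK.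
- by exists s; [exact: kaut_invfunK | exact: kaut_funK].
- by move=> c; rewrite -[in LHS]sK kaut_funK.
Qed.

Definition kaut_one : kaut := KAut kaut_one_subproof.
Definition kaut_mul (s t : kaut) : kaut := KAut (kaut_mul_subproof s t).
Definition kaut_inv (s : kaut) : kaut := KAut (kaut_inv_subproof s).

Lemma kaut_mulA : associative kaut_mul.
Proof. by move=> s t u; apply: val_inj. Qed.

Lemma kaut_mul1 : left_id kaut_one kaut_mul.
Proof. by move=> s; apply: val_inj. Qed.

Lemma kaut_mulr1 : right_id kaut_one kaut_mul.
Proof. by move=> s; apply: val_inj. Qed.

Lemma kaut_mulV : left_inverse kaut_one kaut_inv kaut_mul.
Proof. by move=> s; apply/val_inj/funext => z; exact: kaut_funK. Qed.

Lemma kaut_mulrV : right_inverse kaut_one kaut_inv kaut_mul.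
Proof. by move=> s; apply/val_inj/funext => z; exact: kaut_invfunK. Qed.

HB.instance Definition _ :=
  isGroup.Build kaut kaut_mulA kaut_mul1 kaut_mulr1 kaut_mulV kaut_mulrV.

(* [s] is the automorphism (x, y) |-> (x', y'). *)
Definition sends (x y x' y' : F) (s : kaut) : Prop := s x = x' /\ s y = y'.

End FunctionField.
End PlaneCurves.

Section SemidirectProduct.
Local Open Scope group_scope.
Local Open Scope classical_set_scope.
Variable gT : groupType.

Definition is_subgroup (H : set gT) : Prop := group_closed (mem H).

Definition normalised_by (G A : set gT) : Prop :=
  forall g s, G g -> A s -> G (g ^ s).

(* [A] is the internal semidirect product of its normal subgroup [G] by [H];
   [A] itself is a subgroup, being [setT] in the applications. *)
Definition is_sdprod (A G H : set gT) : Prop :=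
  [/\ is_subgroup G, is_subgroup H, normalised_by G A,
      G `&` H = [set 1] & [set g * h | g in G & h in H] = A].

End SemidirectProduct.

(* Main.v *)
Require Import Defs.
From HB Require Import structures.
From mathcomp Require Import all_boot all_order all_algebra.
From mathcomp Require Import boolp classical_sets functions cardinality.
From mathcomp Require Import mpoly separable cyclotomic.
From mathcomp Require Import zify ring.

Set Implicit Arguments.
Unset Strict Implicit.
Unset Printing Implicit Defensive.

Import Order.TTheory GRing.Theory Num.Theory.
Local Open Scope ring_scope.


(** Put q = p^n. Translating x and dividing by b_m turns the equation into A(y) = x^m, where A is
    additive with constant derivative a_0 and gcd(q, m) = 1. The function field then has a single
    place [vinf] at infinity, where x and y have poles of order q and m. The monomials x^i y^j with
    j < q have distinct pole orders iq + jm, so pole orders at infinity are weighted degrees. All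
    affine points are smooth, there are q of them over every x_0, and a function without affine
    poles is a polynomial in x and y ([regular_reduced]).

    The heart of the matter is that outside case (i) every automorphism s fixes infinity
    ([kaut_fixes_infinity]). Otherwise s x and s y have their only pole at an affine point (x_0,
    y_0), of orders q and m. Multiplied by (x - x_0)^k, with k the pole order, each becomes a
    polynomial of weight at most kq whose expansion modulo (x - x_0)^k is dictated by the q branches
    over x_0 ([pole_expansion]). Weights and expansions are compatible only if m < q, x_0 = 0 and s
    y = c_0/(y - y_0) + c_1 ([affine_pole_form]). Since A(s y) is an m-th power, r -> c_0/(r - c_1)
    maps roots of A to roots of A; hence A/Y is proportional to its own reversal, and only the terms
    in Y^q and Y remain ([inverse_pole_two_terms]). Then (x / s x)^m is a constant times (y -
    y_0)^(q+1), so q + 1 is a pole order iq + jm, and m divides q + 1 ([inverse_pole_dvd]). In that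
    case a diagonal rescaling gives the normal form ([projectively_equivalent_fermat]).

    If infinity is fixed, s x and s y are polynomials of weights q and m, and the equation leaves
    only x -> alpha x, y -> alpha^m y + beta with A(beta) = 0 and alpha^m fixed by the p^j-th powers
    with a_j nonzero ([kaut_form]), that is, alpha^(m(p^d - 1)) = 1 ([exponent_gcd_fixed]). All
    these maps are automorphisms ([kaut_exists]). Counting the pairs (alpha, beta) gives the order;
    beta parametrises the normal subgroup and alpha its complement. *)

(** * Evaluation of polynomials in X (inner variable) and Y (outer variable) *)

Definition ev2 (R S : comNzRingType) (f : {rmorphism R -> S}) (u v : S)
    (P : {poly {poly R}}) : S :=
  (map_poly (fun c => (map_poly f c).[u]) P).[v].

Section BivariateMorphism.
Variables (R S : comNzRingType) (f : {rmorphism R -> S}) (u v : S).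

Let ev2_comp_morph := horner_eval v \o map_poly (horner_eval u \o map_poly f).

Fact ev2_is_zmod_morphism : zmod_morphism (ev2 f u v).
Proof. by move=> P Q; apply: (raddfB ev2_comp_morph). Qed.

Fact ev2_is_monoid_morphism : monoid_morphism (ev2 f u v).
Proof.
by split=> [|P Q]; [apply: (rmorph1 ev2_comp_morph) | apply: (rmorphM ev2_comp_morph)].
Qed.

HB.instance Definition _ := GRing.isZmodMorphism.Build
  _ _ (ev2 f u v) ev2_is_zmod_morphism.
HB.instance Definition _ := GRing.isMonoidMorphism.Build
  _ _ (ev2 f u v) ev2_is_monoid_morphism.

Lemma ev20 : ev2 f u v 0 = 0. Proof. exact: rmorph0. Qed.

Lemma ev21 : ev2 f u v 1 = 1. Proof. exact: rmorph1. Qed.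

Lemma ev2D P Q : ev2 f u v (P + Q) = ev2 f u v P + ev2 f u v Q.
Proof. exact: rmorphD. Qed.

Lemma ev2B P Q : ev2 f u v (P - Q) = ev2 f u v P - ev2 f u v Q.
Proof. exact: rmorphB. Qed.

Lemma ev2M P Q : ev2 f u v (P * Q) = ev2 f u v P * ev2 f u v Q.
Proof. exact: rmorphM. Qed.

Lemma ev2Xn P k : ev2 f u v (P ^+ k) = ev2 f u v P ^+ k.
Proof. exact: rmorphXn. Qed.

Lemma ev2_sum (I : Type) (r : seq I) (B : pred I) (P : I -> {poly {poly R}}) :
  ev2 f u v (\sum_(i <- r | B i) P i) = \sum_(i <- r | B i) ev2 f u v (P i).
Proof. exact: rmorph_sum. Qed.

End BivariateMorphism.

Section BivariateEvaluation.
Variables (R S : comNzRingType) (f : {rmorphism R -> S}) (u v : S).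
Implicit Type P : {poly {poly R}}.

Lemma ev2C c : ev2 f u v c%:P = (map_poly f c).[u].
Proof.
rewrite -[LHS]/((map_poly (horner_eval u \o map_poly f) c%:P).[v]).
by rewrite map_polyC hornerC.
Qed.

Lemma ev2CC c : ev2 f u v c%:P%:P = f c.
Proof. by rewrite ev2C map_polyC hornerC. Qed.

Lemma ev2X : ev2 f u v 'X%:P = u.
Proof. by rewrite ev2C map_polyX hornerX. Qed.

Lemma ev2Y : ev2 f u v 'X = v.
Proof.
rewrite -[LHS]/((map_poly (horner_eval u \o map_poly f) 'X).[v]).
by rewrite map_polyX hornerX.
Qed.

Lemma ev2_lift (p : {poly R}) : ev2 f u v p^:P = (map_poly f p).[v].
Proof.
rewrite -[LHS]/((map_poly (horner_eval u \o map_poly f) p^:P).[v]).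
rewrite -map_poly_comp; congr (_.[_]); apply: eq_map_poly => c /=.
by rewrite map_polyC /= /horner_eval hornerC.
Qed.

Lemma poly2E P : P = \sum_(j < size P) \sum_(i < size P`_j)
  (P`_j`_i)%:P%:P * 'X%:P ^+ i * 'X ^+ j.
Proof.
rewrite -[LHS]coefK poly_def; apply: eq_bigr => j _.
rewrite -mulr_suml -mul_polyC; congr (_ * _).
rewrite -[in LHS](coefK P`_j) poly_def rmorph_sum; apply: eq_bigr => i _ /=.
by rewrite -mul_polyC !rmorphM /= rmorphXn.
Qed.

Lemma ev2E P : ev2 f u v P = \sum_(j < size P) \sum_(i < size P`_j)
  f (P`_j`_i) * u ^+ i * v ^+ j.
Proof.
rewrite [in LHS](poly2E P) ev2_sum; apply: eq_bigr => j _.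
rewrite ev2_sum; apply: eq_bigr => i _.
by rewrite !ev2M !ev2Xn ev2CC ev2X ev2Y.
Qed.

End BivariateEvaluation.

Lemma ev2_comp (R S T : comNzRingType) (f : {rmorphism R -> S})
    (g : {rmorphism S -> T}) (u v : S) P :
  g (ev2 f u v P) = ev2 (g \o f) (g u) (g v) P.
Proof.
rewrite !ev2E rmorph_sum; apply: eq_bigr => j _ /=.
rewrite rmorph_sum; apply: eq_bigr => i _ /=.
by rewrite !rmorphM /= !rmorphXn.
Qed.

Lemma eq_ev2 (R S : comNzRingType) (f g : {rmorphism R -> S}) (u v : S) P :
  f =1 g -> ev2 f u v P = ev2 g u v P.
Proof.
move=> fg; rewrite !ev2E; apply: eq_bigr => j _.
by apply: eq_bigr => i _; rewrite fg.
Qed.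

(** Along this morphism [ev2] is the substitution of two bivariate polynomials for X and Y. *)
Definition polyCC (R : comNzRingType) : {rmorphism R -> {poly {poly R}}} := polyC \o polyC.

Lemma ev2_id (R : comNzRingType) (P : {poly {poly R}}) : ev2 (polyCC R) 'X%:P 'X P = P.
Proof. by rewrite ev2E [RHS]poly2E. Qed.

Lemma ev2_subst (R S : comNzRingType) (f : {rmorphism R -> S}) (u v : S)
    (U V P : {poly {poly R}}) :
  ev2 f u v (ev2 (polyCC R) U V P) = ev2 f (ev2 f u v U) (ev2 f u v V) P.
Proof. by rewrite ev2_comp; apply: eq_ev2 => c; rewrite -[RHS](ev2CC f u v). Qed.

(** * Normalised discrete valuations of F over K *)

Section Valuations.
Variables (K F : fieldType) (iota : {rmorphism K -> F}).
Implicit Types (v : F -> int) (z w : F) (k l : int).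

(** The last clause normalises the value group to all integers, so two valuations that differ by a
    positive factor agree away from 0. No clause speaks of [v 0], whose value is arbitrary. *)
Definition valuation v : Prop :=
  [/\ forall z w, z != 0 -> w != 0 -> v (z * w) = v z + v w,
      forall z w, z != 0 -> w != 0 -> z + w != 0 ->
        Num.min (v z) (v w) <= v (z + w),
      forall c, c != 0 -> v (iota c) = 0 &
      exists2 z, z != 0 & v z = 1].

(** Zero counts as having infinite valuation, so that lower bounds pass through sums without case
    distinctions. *)
Definition vge v k z := (z == 0) || (k <= v z).

Variable v : F -> int.
Hypothesis val_v : valuation v.

Lemma valM z w : z != 0 -> w != 0 -> v (z * w) = v z + v w.
Proof. by have [vM _ _ _] := val_v; exact: vM. Qed.

Lemma val_iota c : c != 0 -> v (iota c) = 0.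
Proof. by have [_ _ vK _] := val_v; exact: vK. Qed.

Lemma val1 : v 1 = 0.
Proof. by rewrite -(rmorph1 iota) val_iota ?oner_eq0. Qed.

Lemma valX z (k : nat) : z != 0 -> v (z ^+ k) = v z *+ k.
Proof.
move=> z0; elim: k => [|k IH]; first by rewrite val1.
by rewrite exprS valM ?expf_neq0 // IH mulrS.
Qed.

Lemma valV z : z != 0 -> v z^-1 = - v z.
Proof.
move=> z0; apply/eqP; rewrite -subr_eq0 opprK.
by rewrite -valM ?invr_neq0 // mulVf // val1.
Qed.

Lemma val_div z w : z != 0 -> w != 0 -> v (z / w) = v z - v w.
Proof. by move=> z0 w0; rewrite valM ?invr_neq0 // valV. Qed.

Lemma vgeE k z : z != 0 -> vge v k z = (k <= v z).
Proof. by rewrite /vge => /negPf->. Qed.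

Lemma vge0 k : vge v k 0.
Proof. by rewrite /vge eqxx. Qed.

Lemma vge_val z : vge v (v z) z.
Proof. by rewrite /vge lexx orbT. Qed.

Lemma vgeW k l z : l <= k -> vge v k z -> vge v l z.
Proof.
by rewrite /vge => lk /orP[-> //|kz]; rewrite (le_trans lk kz) orbT.
Qed.

Lemma vgeD k z w : vge v k z -> vge v k w -> vge v k (z + w).
Proof.
have [->|z0] := eqVneq z 0; first by rewrite add0r.
have [->|w0] := eqVneq w 0; first by rewrite addr0.
have [->|zw0] := eqVneq (z + w) 0; first by rewrite vge0.
rewrite !vgeE // => kz kw; have [_ vD _ _] := val_v.
by apply: le_trans (vD _ _ z0 w0 zw0); rewrite le_min kz.
Qed.

Lemma vgeM k l z w : vge v k z -> vge v l w -> vge v (k + l) (z * w).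
Proof.
have [->|z0] := eqVneq z 0; first by rewrite mul0r => *; apply: vge0.
have [->|w0] := eqVneq w 0; first by rewrite mulr0 => *; apply: vge0.
by rewrite !vgeE ?mulf_neq0 // valM // => ? ?; rewrite lerD.
Qed.

Lemma vge_iota c : vge v 0 (iota c).
Proof.
have [->|c0] := eqVneq c 0; first by rewrite rmorph0 vge0.
by rewrite vgeE ?fmorph_eq0 // val_iota.
Qed.

Lemma vgeN k z : vge v k z -> vge v k (- z).
Proof.
by move=> kz; rewrite -mulN1r -(rmorphN1 iota) -[k]add0r vgeM ?vge_iota.
Qed.

Lemma vgeB k z w : vge v k z -> vge v k w -> vge v k (z - w).
Proof. by move=> kz kw; rewrite vgeD ?vgeN. Qed.

Lemma vgeX k z (l : nat) : vge v k z -> vge v (k *+ l) (z ^+ l).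
Proof.
move=> kz; elim: l => [|l IH]; first by rewrite expr0 mulr0n -(rmorph1 iota) vge_iota.
by rewrite exprS mulrS vgeM.
Qed.

Lemma vge_sum k (I : Type) (r : seq I) (P : pred I) (E : I -> F) :
  (forall i, P i -> vge v k (E i)) -> vge v k (\sum_(i <- r | P i) E i).
Proof. by move=> kE; apply: (big_ind (vge v k)) => // [|z w]; [exact: vge0 | exact: vgeD]. Qed.

Lemma vge_iota_gt0 c : vge v 1 (iota c) -> c = 0.
Proof.
by apply: contraTeq => c0; rewrite vgeE ?fmorph_eq0 // val_iota.
Qed.

(** Were the valuation of z + w larger than [v z], so would be that of z = (z + w) - w. *)
Lemma val_dom z w : z != 0 -> vge v (v z + 1) w ->
  z + w != 0 /\ v (z + w) = v z.
Proof.
move=> z0 zw; have zw0 : z + w != 0.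
  apply: contraL zw; rewrite addr_eq0 => /eqP zw; apply/negP => {}/vgeN.
  by rewrite -zw vgeE // leNgt ltrDl.
split=> //; apply/eqP; rewrite eq_le; apply/andP; split; last first.
  by rewrite -vgeE // vgeD ?vge_val //; apply: vgeW zw; lia.
rewrite leNgt; apply/negP => lt_zw.
have : vge v (v z + 1) (z + w - w).
  by apply: vgeB => //; rewrite vgeE //; lia.
by rewrite addrK vgeE //; lia.
Qed.

Lemma vge0_horner z (P : {poly K}) : vge v 0 z -> vge v 0 (map_poly iota P).[z].
Proof.
move=> z0; rewrite horner_coef vge_sum // => i _.
by rewrite coef_map -[0]addr0 vgeM ?vge_iota // -(mul0rn _ i) vgeX.
Qed.

(** At a pole of z the term of highest degree dominates. *)
Lemma val_horner_neg z (P : {poly K}) : z != 0 -> v z < 0 -> P != 0 ->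
  (map_poly iota P).[z] != 0 /\ v (map_poly iota P).[z] = v z *+ (size P).-1.
Proof.
move=> z0 vz0 P0; have sP : size P = (size P).-1.+1 by rewrite prednK ?size_poly_gt0.
have lc0 : P`_(size P).-1 != 0 by rewrite -lead_coefE lead_coef_eq0.
move: (size P).-1 sP lc0 => d sP lc0.
rewrite horner_coef size_map_poly sP big_ord_recr /= addrC coef_map /=.
have t0 : iota P`_d * z ^+ d != 0.
  by rewrite mulf_neq0 ?expf_neq0 ?fmorph_eq0.
have vt : v (iota P`_d * z ^+ d) = v z *+ d.
  by rewrite valM ?expf_neq0 ?fmorph_eq0 // val_iota // add0r valX.
rewrite -vt; apply: val_dom t0 _.
rewrite vge_sum // => i _; rewrite coef_map /= vt.
apply: (@vgeW (0 + v z *+ i)); last by rewrite vgeM ?vge_iota ?vgeX ?vge_val.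
have := ltn_ord i; nia.
Qed.

(** At a zero of z the lowest nonzero term dominates. *)
Lemma val_horner_pos z (P : {poly K}) (k : nat) : z != 0 -> 0 < v z ->
  (forall i, (i < k)%N -> P`_i = 0) -> P`_k != 0 ->
  (map_poly iota P).[z] != 0 /\ v (map_poly iota P).[z] = v z *+ k.
Proof.
move=> z0 vz0 Plow Pk.
have ltk : (k < size P)%N by rewrite ltnNge; apply: contra Pk => /leq_sizeP->.
rewrite horner_coef size_map_poly (bigD1 (Ordinal ltk)) //= coef_map /=.
have t0 : iota P`_k * z ^+ k != 0.
  by rewrite mulf_neq0 ?expf_neq0 ?fmorph_eq0.
have vt : v (iota P`_k * z ^+ k) = v z *+ k.
  by rewrite valM ?expf_neq0 ?fmorph_eq0 // val_iota // add0r valX.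
rewrite -vt; apply: val_dom t0 _.
rewrite vge_sum // => i ik; rewrite coef_map /= vt.
have [/Plow->|ki] := ltnP i k; first by rewrite rmorph0 mul0r vge0.
have {ik}ki : (k < i)%N by rewrite ltn_neqAle ki eq_sym andbT.
apply: (@vgeW (0 + v z *+ i)); last by rewrite vgeM ?vge_iota ?vgeX ?vge_val.
nia.
Qed.

(** At a uniformiser z the valuation of P(z) is the order of P at 0; this turns valuation bounds
    into divisibility by powers of X. *)
Lemma vge_horner_dvd z (P : {poly K}) (k : nat) : z != 0 -> v z = 1 ->
  vge v k%:Z (map_poly iota P).[z] -> 'X^k %| P.
Proof.
move=> z0 vz; have [->|P0] := eqVneq P 0; first by rewrite dvdp0.
have [i Pi iP] : exists2 i, P`_i != 0 & forall j, (j < i)%N -> P`_j = 0.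
  have exP : exists i, P`_i != 0.
    by exists (size P).-1; rewrite -lead_coefE lead_coef_eq0.
  exists (ex_minn exP); case: ex_minnP => // i Pi imin j ji.
  by apply: contraTeq ji => /imin; rewrite -leqNgt.
have [|nz vP] := val_horner_pos z0 _ iP Pi; first by rewrite vz.
rewrite vgeE // vP vz => ki.
have {}ki : (k <= i)%N by lia.
apply/dvdpP; exists (drop_poly k P).
rewrite -[LHS](poly_take_drop k) [take_poly k P](_ : _ = 0) ?add0r //.
apply/polyP => j; rewrite coef_take_poly coef0; case: ifP => // jk.
by apply: iP; exact: leq_trans ki.
Qed.

(** The difference z - z' divides each z^i - z'^i with an integral cofactor. *)
Lemma vge_horner_diff k z z' (P : {poly F}) : (forall i, vge v 0 P`_i) ->
  vge v 0 z -> vge v 0 z' -> vge v k (z - z') -> vge v k (P.[z] - P.[z']).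
Proof.
move=> P0 z0 z'0 kz; rewrite !horner_coef -sumrB vge_sum // => i _.
rewrite -mulrBr -[k]add0r vgeM // subrXX -[k]addr0 vgeM // vge_sum // => j _.
by rewrite -[0]addr0 vgeM //; [rewrite -(mul0rn _ (i.-1 - j)) | rewrite -(mul0rn _ j)];
  rewrite vgeX.
Qed.

End Valuations.

(** * Additive polynomials and their separability *)

Section Linearized.
Variables (K : fieldType) (p n : nat) (a : nat -> K).
Hypothesis pcharK : p \in [pchar K].

Definition linpoly : {poly K} := \sum_(j < n.+1) a j *: 'X^(p ^ j).

Let p_gt1 : (1 < p)%N. Proof. by rewrite prime_gt1 ?(pcharf_prime pcharK). Qed.

Lemma coef_linpoly i :
  linpoly`_i = \sum_(j < n.+1) a j * (i == p ^ j)%N%:R.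
Proof. by rewrite coef_sum; apply: eq_bigr => j _; rewrite coefZ coefXn. Qed.

Lemma coef_linpoly_pow j : (j <= n)%N -> linpoly`_(p ^ j) = a j.
Proof.
move=> jn; have jn1 : (j < n.+1)%N by [].
rewrite coef_linpoly (bigD1 (Ordinal jn1)) //= eqxx mulr1 big1 ?addr0 // => i.
by rewrite -val_eqE /= eq_sym eqn_exp2l // => /negPf->; rewrite mulr0.
Qed.

Lemma coef_linpoly_npow i : (forall j, (j <= n)%N -> i != p ^ j)%N ->
  linpoly`_i = 0.
Proof.
move=> ij; rewrite coef_linpoly big1 // => j _.
by rewrite (negPf (ij j _)) ?mulr0 // -ltnS.
Qed.

Lemma coef_linpoly1 : linpoly`_1 = a 0.
Proof. by rewrite -(coef_linpoly_pow (leq0n n)) expn0. Qed.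

Lemma coef_linpoly0 : linpoly`_0 = 0.
Proof. by apply: coef_linpoly_npow => j _; rewrite eq_sym -lt0n expn_gt0; lia. Qed.

(** For q > 2 the exponent q - 1 lies strictly between p^(n-1) and p^n. *)
Lemma coef_linpoly_pred : (2 < p ^ n)%N -> linpoly`_(p ^ n).-1 = 0.
Proof.
move=> q2; apply: coef_linpoly_npow => j; rewrite leq_eqVlt => /orP[/eqP->|jn].
  by lia.
have : (p ^ j * 2 <= p ^ n)%N.
  by rewrite (leq_trans _ (leq_pexp2l _ jn)) ?expnS //; [rewrite mulnC leq_mul2r; lia | lia].
by lia.
Qed.

Lemma horner_linpoly (L : comNzRingType) (f : {rmorphism K -> L}) u :
  (map_poly f linpoly).[u] = \sum_(j < n.+1) f (a j) * u ^+ (p ^ j).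
Proof.
rewrite rmorph_sum horner_sum; apply: eq_bigr => j _ /=.
by rewrite linearZ /= map_polyXn hornerZ hornerXn.
Qed.

Lemma linpolyD (L : comNzRingType) (f : {rmorphism K -> L}) u v :
  (map_poly f linpoly).[u + v] = (map_poly f linpoly).[u] + (map_poly f linpoly).[v].
Proof.
rewrite !horner_linpoly -big_split; apply: eq_bigr => j _ /=.
have pL : p \in [pchar L] by rewrite (rmorph_pchar f).
rewrite -mulrDr exprDn_pchar // pnatX; apply/orP; left.
by rewrite pnatE ?(pcharf_prime pcharK).
Qed.

Lemma linpoly0 (L : comNzRingType) (f : {rmorphism K -> L}) :
  (map_poly f linpoly).[0] = 0.
Proof. by rewrite horner_coef0 coef_map coef_linpoly0 /= rmorph0. Qed.

Lemma linpolyN (L : comNzRingType) (f : {rmorphism K -> L}) u :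
  (map_poly f linpoly).[- u] = - (map_poly f linpoly).[u].
Proof.
by apply/eqP; rewrite -addr_eq0 -linpolyD addNr linpoly0.
Qed.

Lemma linpolyB (L : comNzRingType) (f : {rmorphism K -> L}) u v :
  (map_poly f linpoly).[u - v] = (map_poly f linpoly).[u] - (map_poly f linpoly).[v].
Proof. by rewrite linpolyD linpolyN. Qed.

Hypothesis an_neq0 : a n != 0.

Lemma size_linpoly : size linpoly = (p ^ n).+1.
Proof.
apply/eqP; rewrite eqn_leq; apply/andP; split.
  apply/leq_sizeP => i ni; apply: coef_linpoly_npow => j jn.
  by rewrite gtn_eqF // (leq_trans _ ni) // ltnS leq_pexp2l //; lia.
by rewrite ltnNge; apply: contra an_neq0 => /leq_sizeP/(_ _ (leqnn _)); rewrite coef_linpoly_pow // => ->.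
Qed.

Lemma lead_linpoly : lead_coef linpoly = a n.
Proof. by rewrite lead_coefE size_linpoly coef_linpoly_pow. Qed.

Hypothesis a0_neq0 : a 0 != 0.

Lemma deriv_linpoly : linpoly^`() = (a 0)%:P.
Proof.
rewrite raddf_sum big_ord_recl big1 => [|j _]; last first.
  rewrite /= derivZ derivXn /= /bump add1n expnS -mulr_natl natrM.
  rewrite -polyC_natr (pcharf0 pcharK) polyC0 !mul0r scaler0 //.
by rewrite /= expn0 addr0 derivZ derivX alg_polyC.
Qed.

Lemma separable_linpoly : separable_poly linpoly.
Proof.
by rewrite unlock deriv_linpoly coprimep_sym -[(a 0)%:P]mulr1 mul_polyC coprimepZl // coprime1p.
Qed.

End Linearized.

Lemma closed_separable_roots (K : closedFieldType) (P : {poly K}) :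
  separable_poly P ->
  exists rs : seq K, [/\ uniq rs, size rs = (size P).-1 & forall z, (z \in rs) = root P z].
Proof.
move=> sepP; have P0 := separable_poly_neq0 sepP.
have [rs Prs] := closed_field_poly_normal P; exists rs.
have lP0 : lead_coef P != 0 by rewrite lead_coef_eq0.
split=> [||z].
- rewrite -separable_prod_XsubC; move: sepP.
  by rewrite Prs -mul_polyC separable_mul => /and3P[].
- by rewrite Prs size_scale // size_prod_XsubC.
- by rewrite Prs rootZ // root_prod_XsubC.
Qed.

(** * Weighted degrees: X has weight q and Y has weight m *)

Lemma coef_neq0_ltn (R : nzSemiRingType) (P : {poly R}) i : P`_i != 0 -> (i < size P)%N.
Proof. by rewrite ltnNge; apply: contra => /leq_sizeP->. Qed.

Section Weights.
Variables (R : idomainType) (q m : nat).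
Implicit Types (P Q : {poly {poly R}}) (D : nat).

(** The weight of X^i Y^j is the pole order of x^i y^j at infinity. *)
Definition wt_le D P := forall i j, P`_j`_i != 0 -> (i * q + j * m <= D)%N.

Lemma wt_le0 D : wt_le D 0.
Proof. by move=> i j; rewrite !coef0 eqxx. Qed.

Lemma wt_leW D D' P : (D <= D')%N -> wt_le D P -> wt_le D' P.
Proof. by move=> DD' wP i j /wP/leq_trans; apply. Qed.

Lemma wt_leD D P Q : wt_le D P -> wt_le D Q -> wt_le D (P + Q).
Proof.
move=> wP wQ i j; rewrite !coefD; have [Pij|/wP//] := eqVneq P`_j`_i 0.
by rewrite Pij add0r => /wQ.
Qed.

Lemma wt_leN D P : wt_le D P -> wt_le D (- P).
Proof. by move=> wP i j; rewrite !coefN oppr_eq0 => /wP. Qed.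

Lemma wt_leB D P Q : wt_le D P -> wt_le D Q -> wt_le D (P - Q).
Proof. by move=> wP wQ; apply: wt_leD wP (wt_leN wQ). Qed.

Lemma wt_leM D D' P Q : wt_le D P -> wt_le D' Q -> wt_le (D + D') (P * Q).
Proof.
move=> wP wQ i j; apply: contraR => Dij.
rewrite coefM coef_sum big1 // => k _; rewrite coefM big1 // => l _.
apply/eqP; rewrite mulf_eq0; apply: contraR Dij; rewrite negb_or => /andP[/wP + /wQ].
have [/= kj li] := (ltn_ord k, ltn_ord l); move: (nat_of_ord k) (nat_of_ord l) kj li => k' l'.
rewrite !ltnS !mulnBl => kj li.
have := leq_mul kj (leqnn m); have := leq_mul li (leqnn q); lia.
Qed.

Lemma wt_le_sum D (I : Type) (r : seq I) (B : pred I) (P : I -> {poly {poly R}}) :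
  (forall i, B i -> wt_le D (P i)) -> wt_le D (\sum_(i <- r | B i) P i).
Proof. by move=> wP; apply: big_ind => //; [exact: wt_le0 | exact: wt_leD]. Qed.

Lemma wt_leX D P k : wt_le D P -> wt_le (D * k) (P ^+ k).
Proof.
move=> wP; elim: k => [|k IH]; last by rewrite exprS mulnS; exact: wt_leM.
move=> i j; rewrite expr0 coef1; case: j => [|j]; rewrite ?coef0 ?eqxx //.
by rewrite coef1; case: i => [|i]; rewrite ?eqxx.
Qed.

Lemma wt_leC c : wt_le 0 c%:P%:P.
Proof.
move=> i j; rewrite coefC; case: j => [|j]; rewrite ?coef0 ?eqxx //.
by rewrite coefC; case: i => [|i]; rewrite ?eqxx.
Qed.

Lemma wt_le_polyC D (p : {poly R}) : ((size p).-1 * q <= D)%N -> wt_le D p%:P.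
Proof.
move=> sp i j; rewrite coefC; case: j => [|j]; rewrite ?coef0 ?eqxx //= => pi.
apply: leq_trans sp; rewrite addn0 leq_mul2r.
by have := coef_neq0_ltn pi; lia.
Qed.

Lemma wt_leXX : wt_le q 'X%:P.
Proof.
move=> i j; rewrite coefC; case: j => [|j]; rewrite ?coef0 ?eqxx //=.
by rewrite coefX; case: (i =P 1%N) => [->|]; rewrite ?eqxx // mul1n addn0.
Qed.

Lemma wt_leXY : wt_le m 'X.
Proof.
move=> i j; rewrite coefX; case: (j =P 1%N) => [->|]; last by rewrite coef0 eqxx.
by rewrite coef1; case: i => [|i]; rewrite ?eqxx // mul1n.
Qed.

Lemma wt_le_exists P : exists D, wt_le D P.
Proof.
exists (\max_(j < size P) (\max_(i < size (nth 0%R P j)) (i * q + j * m)))%N => i j Pij.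
have ji := coef_neq0_ltn Pij.
have jP : (j < size P)%N.
  by apply: coef_neq0_ltn; apply: contraNneq Pij => ->; rewrite coef0.
rewrite (bigD1 (Ordinal jP)) //= (bigD1 (Ordinal ji)) //=.
by rewrite -maxnA leq_maxl.
Qed.

(* The substitution X -> X + x0, Y -> Y + y0 does not raise weights. *)
Lemma wt_le_shift D P (x0 y0 : R) : wt_le D P ->
  wt_le D (ev2 (polyCC R) ('X + x0%:P)%:P ('X + y0%:P%:P) P).
Proof.
move=> wP; rewrite ev2E; apply: wt_le_sum => j _; apply: wt_le_sum => i _ /=.
have [->|/wP] := eqVneq P`_j`_i 0; first by rewrite !polyC0 !mul0r; exact: wt_le0.
move=> wij; apply: (@wt_leW (0 + q * i + m * j)); first by rewrite add0n mulnC [(m * j)%N]mulnC.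
apply: wt_leM; last first.
  apply: wt_leX; apply: wt_leD; first exact: wt_leXY.
  by apply: wt_leW (@wt_leC y0).
apply: wt_leM; first exact: wt_leC.
apply: wt_leX; rewrite polyCD; apply: wt_leD; first exact: wt_leXX.
by apply: wt_leW (@wt_leC x0).
Qed.

End Weights.

(** Modulo q the weight is jm, and m is invertible there, so j is determined by the weight. *)
Lemma weight_inj (q m i j i' j' : nat) : (0 < q)%N -> coprime q m -> (j < q)%N -> (j' < q)%N ->
  (i * q + j * m = i' * q + j' * m)%N -> i = i' /\ j = j'.
Proof.
move=> q_gt0 qm jq j'q e; have jj' : j = j'.
  have : (j * m = j' * m %[mod q])%N by rewrite -(modnMDl i) e modnMDl.
  wlog le_jj : i i' j j' jq j'q e / (j <= j')%N => [hw|].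
    have [l|/ltnW l] := leqP j j'; first exact: hw e l.
    by move/esym => h; apply/esym; exact: hw (esym e) l h.
  move/esym/eqP; rewrite eqn_mod_dvd ?leq_mul // -mulnBl Gauss_dvdl //.
  move/dvdn_leq; lia.
split=> //; move: e; rewrite jj' => /addIn/eqP.
by rewrite eqn_mul2r => /orP[|/eqP//]; rewrite eqn0Ngt q_gt0.
Qed.

(* Weighted degrees of polynomials of Y-degree < q are read off on the curve
   (Z^q, u Z^m): the monomials X^i Y^j, j < q, have pairwise distinct weights. *)
Section WeightCurve.
Variables (K : fieldType) (q m : nat) (u : K).
Hypotheses (q_gt0 : (0 < q)%N) (qm : coprime q m) (u_neq0 : u != 0).
Implicit Types (P Q : {poly {poly K}}) (D : nat).

Local Notation wt_curve := (ev2 polyC 'X^q (u *: 'X^m)).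

Lemma wt_curveE P : wt_curve P =
  \sum_(j < size P) \sum_(i < size P`_j) (P`_j`_i * u ^+ j) *: 'X^(i * q + j * m).
Proof.
rewrite ev2E; apply: eq_bigr => j _; apply: eq_bigr => i _.
by rewrite mul_polyC exprZn -scalerAl -scalerAr scalerA -!exprM -exprD mulnC [(m * j)%N]mulnC.
Qed.

Lemma size_wt_curve D P : wt_le q m D P -> (size (wt_curve P) <= D.+1)%N.
Proof.
move=> wP; rewrite wt_curveE (leq_trans (size_sum _ _ _)) //.
apply/bigmax_leqP => j _; rewrite (leq_trans (size_sum _ _ _)) //.
apply/bigmax_leqP => i _; have [->|/wP wij] := eqVneq P`_j`_i 0.
  by rewrite mul0r scale0r size_poly0.
by rewrite (leq_trans (size_scale_leq _ _)) // size_polyXn.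
Qed.

(** By [weight_inj] no two monomials of Y-degree below q land on the same power of Z, so nothing
    cancels. *)
Lemma coef_wt_curve P i j : (size P <= q)%N -> (j < q)%N ->
  (wt_curve P)`_(i * q + j * m) = P`_j`_i * u ^+ j.
Proof.
move=> sP jq; rewrite wt_curveE coef_sum.
have [sPj|jP] := leqP (size P) j.
  rewrite (nth_default _ sPj) coef0 mul0r big1 // => j' _; rewrite coef_sum big1 // => i' _.
  rewrite coefZ coefXn; case: eqP => [e|]; last by rewrite mulr0.
  have j'q := leq_trans (ltn_ord j') sP.
  by have [_ e'] := weight_inj q_gt0 qm jq j'q e; move: sPj; rewrite e' leqNgt ltn_ord.
rewrite (bigD1 (Ordinal jP)) //= coef_sum [X in _ + X]big1 => [|j' j'j]; last first.
  rewrite coef_sum big1 // => i' _.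
  rewrite coefZ coefXn; case: eqP => [e|]; last by rewrite mulr0.
  have j'q := leq_trans (ltn_ord j') sP.
  have [_ e'] := weight_inj q_gt0 qm jq j'q e.
  by move: j'j; rewrite -val_eqE /= e' eqxx.
rewrite addr0; have [sPi|iP] := leqP (size P`_j) i.
  rewrite (nth_default _ sPi) mul0r big1 // => i' _.
  rewrite coefZ coefXn; case: eqP => [e|]; last by rewrite mulr0.
  have [e' _] := weight_inj q_gt0 qm jq jq e.
  by move: sPi; rewrite e' leqNgt ltn_ord.
rewrite (bigD1 (Ordinal iP)) //= big1 => [|i' i'i].
  by rewrite coefZ coefXn eqxx mulr1 addr0.
rewrite coefZ coefXn; case: eqP => [e|]; last by rewrite mulr0.
have [e' _] := weight_inj q_gt0 qm jq jq e.
by move: i'i; rewrite -val_eqE /= e' eqxx.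
Qed.

Lemma wt_le_size_curve P : (size P <= q)%N ->
  wt_le q m (size (wt_curve P)).-1 P.
Proof.
move=> sP i j Pij; have jq : (j < q)%N.
  apply: leq_trans sP; apply: coef_neq0_ltn.
  by apply: contraNneq Pij => ->; rewrite coef0.
have : (wt_curve P)`_(i * q + j * m) != 0.
  by rewrite coef_wt_curve // mulf_neq0 ?expf_neq0.
by move/coef_neq0_ltn; lia.
Qed.

Lemma wt_curve_eq0 P : (size P <= q)%N -> (wt_curve P == 0) = (P == 0).
Proof.
move=> sP; apply/eqP/eqP => [E0|->]; last exact: ev20.
apply/polyP => j; apply/polyP => i; rewrite !coef0.
have [jq|qj] := ltnP j q; last by rewrite (nth_default _ (leq_trans sP qj)) coef0.
have := coef_wt_curve i sP jq; rewrite E0 coef0 => /esym/eqP.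
by rewrite mulf_eq0 expf_eq0 (negPf u_neq0) andbF orbF => /eqP.
Qed.

End WeightCurve.

Lemma weight_le0 (q m i : nat) : (m < q -> i * q + q.-1 * m <= m * q -> i = 0)%N.
Proof. nia. Qed.

Lemma weight_le1 (q m i : nat) : (m < q -> i * q + q.-1.-1 * m <= m * q -> i <= 1)%N.
Proof. nia. Qed.

(** The inequality says (q - m)m <= q, which leaves q = m + 1 or (q, m) = (4, 2); the latter pair is
    not coprime. *)
Lemma weight_coprime (q m : nat) : (1 < m < q)%N -> coprime q m ->
  (m.-1 * q + (q.-1 - m.-1) * m <= m * q)%N -> q = m.+1.
Proof.
move=> /andP[m1 mq] cop wm; have [//|qm] := eqVneq q m.+1.
have {}qm : (m + 2 <= q)%N by lia.
have m2 : m = 2%N by nia.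
have q4 : q = 4%N by move: wm; rewrite m2; lia.
by move: cop; rewrite m2 q4.
Qed.

(** * The equation A(Y) - X^m, construction of valuations, automorphisms as morphisms *)

Section SeparatedPolynomial.
Variables (R : comNzRingType) (A : {poly R}) (m : nat).

Definition sep_poly : {poly {poly R}} := A^:P - ('X^m)%:P.

Lemma ev2_sep_poly (S : comNzRingType) (f : {rmorphism R -> S}) u v :
  ev2 f u v sep_poly = (map_poly f A).[v] - u ^+ m.
Proof. by rewrite ev2B ev2_lift ev2C map_polyXn hornerXn. Qed.

Lemma coef_sep_polyS j : (0 < j)%N -> sep_poly`_j = (A`_j)%:P.
Proof. by case: j => // j _; rewrite coefB coef_map coefC subr0. Qed.

Lemma coef_sep_poly0 : sep_poly`_0 = (A`_0)%:P - 'X^m.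
Proof. by rewrite coefB coef_map coefC. Qed.

Lemma size_sep_poly : (1 < size A)%N -> size sep_poly = size A.
Proof.
move=> sA; have sA' : size A^:P = size A by rewrite size_map_polyC.
by rewrite /sep_poly size_polyDl sA' // size_polyN (leq_ltn_trans (size_polyC_leq1 _)).
Qed.

End SeparatedPolynomial.

(* A valuation is determined by its values on a subring with fraction field F;
   [rel P k] reads: the image of P has valuation k. *)
Lemma valuation_extension (K F : fieldType) (iota : {rmorphism K -> F})
    (R : comNzRingType) (phi : {rmorphism R -> F}) (rel : R -> int -> Prop) :
  (forall z, exists P Q, phi Q != 0 /\ z = phi P / phi Q) ->
  (forall P, phi P != 0 -> exists k, rel P k) ->
  (forall P Q k l, phi P != 0 -> phi Q != 0 -> rel P k -> rel Q l -> rel (P * Q) (k + l)) ->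
  (forall P Q k l, phi P != 0 -> phi P = phi Q -> rel P k -> rel Q l -> k = l) ->
  (forall P Q k l r, phi P != 0 -> phi Q != 0 -> phi (P + Q) != 0 ->
     rel P k -> rel Q l -> rel (P + Q) r -> Num.min k l <= r) ->
  (forall c, c != 0 -> exists2 P, phi P = iota c & rel P 0) ->
  (exists P Q k, [/\ phi P != 0, phi Q != 0, rel P k & rel Q (k + 1)]) ->
  exists v : F -> int, valuation iota v /\
    forall P k, phi P != 0 -> rel P k -> v (phi P) = k.
Proof.
move=> frac rel_ex relM rel_inj relD relC [P1 [Q1 [k1 [P10 Q10 rP1 rQ1]]]].
have {}frac z : exists P Q k l, z != 0 ->
    [/\ phi P != 0, phi Q != 0, z * phi Q = phi P, rel P k & rel Q l].
  have [->|z0] := eqVneq z 0; first by exists 0, 0, 0, 0 => /eqP.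
  have [P [Q [Q0 zPQ]]] := frac z.
  have P0 : phi P != 0 by apply: contraNneq z0 => P0; rewrite zPQ P0 mul0r.
  have [k rP] := rel_ex _ P0; have [l rQ] := rel_ex _ Q0.
  by exists P, Q, k, l => _; split=> //; rewrite zPQ divfK.
pose num z := sval (cid (frac z)).
pose den z := sval (cid (svalP (cid (frac z)))).
pose vn z := sval (cid (svalP (cid (svalP (cid (frac z)))))).
pose vd z := sval (cid (svalP (cid (svalP (cid (svalP (cid (frac z)))))))).
have fracP z : z != 0 -> [/\ phi (num z) != 0, phi (den z) != 0,
    z * phi (den z) = phi (num z), rel (num z) (vn z) & rel (den z) (vd z)].
  exact: svalP (cid (svalP (cid (svalP (cid (svalP (cid (frac z)))))))).
(* Two fractions for the same z are compared by cross-multiplication, so vn z - vd z can be computed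
   from any of them. *)
have vE z P Q k l : z != 0 -> phi P != 0 -> phi Q != 0 -> z * phi Q = phi P ->
    rel P k -> rel Q l -> vn z - vd z = k - l.
  move=> z0 P0 Q0 zQ rP rQ; have [N0 D0 zD rN rD] := fracP z z0.
  have e : phi (num z * Q) = phi (P * den z).
    by rewrite !rmorphM -zD -zQ mulrAC.
  have NQ0 : phi (num z * Q) != 0 by rewrite rmorphM mulf_neq0.
  by have := rel_inj _ _ _ _ NQ0 e (relM _ _ _ _ N0 Q0 rN rQ) (relM _ _ _ _ P0 D0 rP rD); lia.
have rel1 : rel 1 0.
  have [P Pe rP] := relC 1 (oner_neq0 _); rewrite rmorph1 in Pe.
  have [k r1] : exists k, rel 1 k by apply: rel_ex; rewrite rmorph1 oner_neq0.
  have P0 : phi P != 0 by rewrite Pe oner_neq0.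
  have e : phi P = phi 1 by rewrite Pe rmorph1.
  by rewrite (rel_inj _ _ _ _ P0 e rP r1).
have phi1 : phi 1 != 0 by rewrite rmorph1 oner_neq0.
exists (fun z => vn z - vd z); split; last first.
  by move=> P k P0 rP; rewrite (vE _ P 1 k 0) ?subr0 // rmorph1 mulr1.
split.
- move=> z w z0 w0; have [N0 D0 zD rN rD] := fracP z z0.
  have [N0' D0' zD' rN' rD'] := fracP w w0.
  rewrite (vE (z * w) (num z * num w) (den z * den w) (vn z + vn w) (vd z + vd w));
    rewrite ?rmorphM ?mulf_neq0 //; [lia | by rewrite -zD -zD' mulrACA | exact: relM..].
- move=> z w z0 w0 zw0; have [N0 D0 zD rN rD] := fracP z z0.
  have [N0' D0' zD' rN' rD'] := fracP w w0.
  pose P := num z * den w; pose Q := num w * den z.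
  have rP : rel P (vn z + vd w) by exact: relM.
  have rQ : rel Q (vn w + vd z) by exact: relM.
  have ePQ : (z + w) * phi (den z * den w) = phi (P + Q).
    by rewrite rmorphD !rmorphM mulrDl -zD -zD' mulrA [phi _ * phi _ in X in _ + X]mulrC mulrA.
  have PQ0 : phi (P + Q) != 0 by rewrite -ePQ rmorphM !mulf_neq0.
  have [r rPQ] := rel_ex _ PQ0.
  have : Num.min (vn z + vd w) (vn w + vd z) <= r.
    by apply: relD rP rQ rPQ => //; rewrite rmorphM mulf_neq0.
  rewrite (vE (z + w) (P + Q) (den z * den w) r (vd z + vd w)) ?rmorphM ?mulf_neq0 //.
  + by clear; move: (vn z) (vn w) (vd z) (vd w) => ? ? ? ?; lia.
  + by rewrite -rmorphM.
  + exact: relM.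
- move=> c c0; have [P Pc rP] := relC c c0.
  have P0 : phi P != 0 by rewrite Pc fmorph_eq0.
  by rewrite (vE _ P 1 0 0) ?fmorph_eq0 // rmorph1 mulr1.
- have z0 : phi Q1 / phi P1 != 0 by rewrite mulf_neq0 ?invr_neq0.
  exists (phi Q1 / phi P1); rewrite // (vE _ Q1 P1 (k1 + 1) k1) ?divfK //; lia.
Qed.

Section KautMorphism.
Variables (K F : fieldType) (iota : {rmorphism K -> F}) (s : kaut iota).

Fact kaut_is_zmod_morphism : zmod_morphism s.
Proof. by case: (kautP s). Qed.

Fact kaut_is_monoid_morphism : monoid_morphism s.
Proof. by case: (kautP s). Qed.

HB.instance Definition _ :=
  GRing.isZmodMorphism.Build F F (kaut_fun s) kaut_is_zmod_morphism.
HB.instance Definition _ :=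
  GRing.isMonoidMorphism.Build F F (kaut_fun s) kaut_is_monoid_morphism.

Lemma kaut_iota c : s (iota c) = iota c.
Proof. by case: (kautP s). Qed.

Lemma kaut_neq0 z : z != 0 -> s z != 0.
Proof. by rewrite fmorph_eq0. Qed.

Lemma kautB z w : s (z - w) = s z - s w.
Proof. exact: rmorphB. Qed.

Lemma kautD z w : s (z + w) = s z + s w.
Proof. exact: rmorphD. Qed.

Lemma kautM z w : s (z * w) = s z * s w.
Proof. exact: rmorphM. Qed.

Lemma kaut_horner (P : {poly K}) z : s (map_poly iota P).[z] = (map_poly iota P).[s z].
Proof.
rewrite -horner_map -map_poly_comp; congr (_.[_]).
by apply: eq_map_poly => c /=; rewrite kaut_iota.
Qed.

Lemma kaut_ev2 z w P : s (ev2 iota z w P) = ev2 iota (s z) (s w) P.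
Proof.
rewrite ev2_comp; apply: eq_ev2 => c; exact: kaut_iota.
Qed.

Lemma valuation_kaut v : valuation iota v -> valuation iota (v \o s).
Proof.
move=> [vM vD vK [z z0 vz]]; split=> /=.
- by move=> z1 z2 z10 z20; rewrite rmorphM vM ?kaut_neq0.
- by move=> z1 z2 z10 z20 z120; rewrite rmorphD vD ?kaut_neq0 // -rmorphD kaut_neq0.
- by move=> c c0; rewrite kaut_iota vK.
- have [z' sz] := kaut_surj s z; exists z'; rewrite ?sz //.
  by apply: contraNneq z0 => z'0; rewrite -sz z'0 rmorph0.
Qed.

Lemma vge_kaut v k z : vge (v \o s) k z = vge v k (s z).
Proof. by rewrite /vge fmorph_eq0. Qed.

End KautMorphism.

(** * The gcd d of the exponents j >= 1 with a_j nonzero *)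

Definition exponent_gcd (K : fieldType) (n : nat) (a : nat -> K) : nat :=
  (\big[gcdn/0]_(1 <= j < n.+1 | a j != 0%R) j)%N.

Section ExponentGcd.
Variables (K : fieldType) (p n : nat) (a : nat -> K).
Notation d := (exponent_gcd n a).

Lemma dvdn_exponent_gcd e :
  (e %| d)%N <-> forall j, (0 < j <= n)%N -> a j != 0 -> (e %| j)%N.
Proof.
rewrite /exponent_gcd; split=> [ed j jn aj|ej].
  apply: dvdn_trans ed _; rewrite (big_rem j) /= ?aj ?dvdn_gcdl //.
  by rewrite mem_index_iota ltnS.
rewrite big_seq_cond; apply: (big_ind (fun k => (e %| k)%N)) => [|k l ek el|j].
- exact: dvdn0.
- by rewrite dvdn_gcd ek.
- by rewrite mem_index_iota ltnS => /andP[]; exact: ej.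
Qed.

Lemma exponent_gcd_gt0 : (0 < n)%N -> a n != 0 -> (0 < d)%N.
Proof.
move=> n0 an; have /dvdn_exponent_gcd/(_ n) : (d %| d)%N by [].
by rewrite n0 leqnn an => /(_ isT isT)/dvdn_gt0; apply.
Qed.

(* The k with c^(p^k) = c are closed under addition and subtraction. *)
Lemma exponent_gcd_fixed (c : K) : (0 < p)%N -> c != 0 ->
  (forall j, (j <= n)%N -> a j != 0 -> c ^+ (p ^ j) = c) <-> c ^+ (p ^ d - 1) = 1.
Proof.
move=> p0 c0; pose P k := c ^+ (p ^ k) = c.
have PD k l : P k -> P l <-> P (k + l)%N by rewrite /P expnD exprM => ->.
have PM k l : P k -> P (l * k)%N.
  move=> Pk; elim: l => [|l IH]; first by rewrite mul0n /P expn0.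
  by rewrite mulSn; exact: (PD _ _ Pk).1.
have Pgcd k l : P k -> P l -> P (gcdn k l).
  have [->|k0] := posnP k; first by rewrite gcd0n.
  move=> Pk Pl; have [u v e _] := egcdnP l k0.
  by apply: (PD _ _ (PM l v Pl)).2; rewrite -e; exact: PM.
have Pd1 : P d <-> c ^+ (p ^ d - 1) = 1.
  rewrite /P -[in X in X = c <-> _](subnK (_ : 0 < p ^ d)%N) ?expn_gt0 ?p0 // addn1 exprS.
  split=> [e|->]; last by rewrite mulr1.
  by apply: (mulfI c0); rewrite e mulr1.
rewrite -Pd1; split=> [cj|Pd j jn aj].
  rewrite /exponent_gcd big_seq_cond; apply: (big_ind P) => [||j].
  - by rewrite /P expn0.
  - exact: Pgcd.
  - by rewrite mem_index_iota ltnS => /andP[/andP[_ jn] aj]; exact: cj.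
have [->|j0] := posnP j; first by rewrite expn0.
have /dvdnP[k ->] : (d %| j)%N by apply: (dvdn_exponent_gcd d).1 aj; rewrite ?dvdnn ?j0.
exact: PM.
Qed.

Hypothesis pcharK : p \in [pchar K].
Hypotheses (n_gt0 : (0 < n)%N) (an_neq0 : a n != 0).

(** Comparison of coefficients shows that every p^j occurring in A is a power of p^e, so e divides
    j. For e = 0 only the monomial Y would be available, which the term of degree p^n excludes. *)
Lemma linearizedP e : linearized (p ^ e) (linpoly p n a) <-> (0 < e)%N /\ (e %| d)%N.
Proof.
have p_gt1 : (1 < p)%N by rewrite prime_gt1 ?(pcharf_prime pcharK).
split=> [[N [c eA]]|[e0 ed]].
  have je j : (j <= n)%N -> a j != 0 -> exists i, j = (e * i)%N.
    move=> jn; rewrite -(coef_linpoly_pow a pcharK jn) eA coef_sum => aj.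
    apply: contrapT => ne; case/eqP: aj; rewrite big1 // => i _.
    rewrite coefZ coefXn -expnM; case: eqP => [/eqP|_]; last by rewrite mulr0.
    by rewrite eqn_exp2l // => /eqP ji; case: ne; exists i.
  split; last by apply/dvdn_exponent_gcd => j /andP[_ jn] /(je _ jn)[i ->]; rewrite dvdn_mulr.
  by have [i ni] := je n (leqnn n) an_neq0; move: n_gt0; rewrite ni muln_gt0 => /andP[].
exists n.+1, (fun i => if (e * i <= n)%N then a (e * i)%N else 0).
apply/polyP => k; rewrite [in RHS]coef_sum.
have [[j [jn ->]]|nk] := EM (exists j, (j <= n)%N /\ k = (p ^ j)%N); last first.
  rewrite coef_linpoly_npow => [|j jn]; last by apply/eqP => kj; apply: nk; exists j.
  rewrite big1 // => i _; case: ifP => ein; last by rewrite scale0r coef0.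
  rewrite coefZ coefXn -expnM; case: eqP => [ki|_]; last by rewrite mulr0.
  by case: nk; exists (e * i)%N.
rewrite (coef_linpoly_pow a pcharK jn).
have [/dvdnP[i ji]|ej] := boolP (e %| j)%N.
  have ilt : (i < n.+1)%N by rewrite ltnS (leq_trans _ jn) // ji leq_pmulr.
  rewrite (bigD1 (Ordinal ilt)) //= [X in _ + X]big1 => [|l li].
    by rewrite addr0 mulnC -ji jn coefZ coefXn -expnM mulnC -ji eqxx mulr1.
  case: ifP => eln; last by rewrite scale0r coef0.
  rewrite coefZ coefXn -expnM eqn_exp2l // ji [(i * e)%N]mulnC eqn_pmul2l // eq_sym.
  by move: li; rewrite -val_eqE /= => /negPf->; rewrite mulr0.
have -> : a j = 0.
  apply/eqP; apply: contraNT ej => aj.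
  have [->|j0] := posnP j; first by rewrite dvdn0.
  by apply: (dvdn_exponent_gcd e).1 aj; rewrite ?j0.
rewrite big1 // => i _; case: ifP => ein; last by rewrite scale0r coef0.
rewrite coefZ coefXn -expnM eqn_exp2l //.
by case: eqP ej => [->|_]; rewrite ?dvdn_mulr ?mulr0.
Qed.

End ExponentGcd.

(** * The function field of A(y) = x^m and reduction to Y-degree below q *)

Section SeparatedCurveField.
Variables (K : closedFieldType) (F : fieldType) (iota : {rmorphism K -> F}).
Variables (p n m : nat) (a : nat -> K) (x y : F).
Hypothesis pcharK : p \in [pchar K].
Hypotheses (n_gt0 : (0 < n)%N) (m_gt1 : (1 < m)%N) (p_ndvd_m : ~~ (p %| m)%N).
Hypotheses (a0_neq0 : a 0%N != 0) (an_neq0 : a n != 0).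
Local Notation q := (p ^ n)%N.
Local Notation A := (linpoly p n a).
Local Notation phi := (ev2 iota x y).
Hypothesis curve_eq : (map_poly iota A).[y] = x ^+ m.
Hypothesis frac : forall z, exists P Q, phi Q != 0 /\ z = phi P / phi Q.
(** Irreducibility of the curve in a usable form: x is transcendental over K, and 1, y, ..., y^(q-1)
    are independent over K(x). *)
Hypothesis reduced_inj : forall P : {poly {poly K}}, (size P <= q)%N -> phi P = 0 -> P = 0.
Implicit Types P Q T : {poly {poly K}}.

Let p_gt1 : (1 < p)%N. Proof. by rewrite prime_gt1 ?(pcharf_prime pcharK). Qed.

Lemma q_gt1 : (1 < q)%N.
Proof. by rewrite -(expn0 p) ltn_exp2l ?n_gt0 ?p_gt1. Qed.

Let q_gt0 : (0 < q)%N. Proof. exact: ltnW q_gt1. Qed.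

Lemma coprime_qm : coprime q m.
Proof. by apply: coprimeXl; rewrite prime_coprime ?p_ndvd_m ?(pcharf_prime pcharK). Qed.

Local Notation curve_poly := (sep_poly A m).

Lemma phi_curve_poly : phi curve_poly = 0.
Proof. by rewrite ev2_sep_poly curve_eq subrr. Qed.

Lemma size_curve_poly : size curve_poly = q.+1.
Proof. by rewrite size_sep_poly (size_linpoly pcharK an_neq0) ?ltnS ?q_gt0. Qed.

Lemma curve_poly_q : curve_poly`_q = (a n)%:P.
Proof. by rewrite coef_sep_polyS ?q_gt0 // (coef_linpoly_pow a pcharK). Qed.

Lemma curve_poly_neq0 : curve_poly != 0.
Proof. by rewrite -size_poly_eq0 size_curve_poly. Qed.

Lemma wt_curve_poly : wt_le q m (q * m) curve_poly.
Proof.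
move=> i [|j].
  rewrite coef_sep_poly0 (coef_linpoly0 n a pcharK) polyC0 add0r coefN coefXn.
  by case: (i =P m) => [->|]; rewrite ?oppr0 ?eqxx // mulnC addn0.
rewrite coef_sep_polyS // coefC; case: i => [|i]; rewrite ?eqxx //= => Aj.
have := coef_neq0_ltn Aj; rewrite (size_linpoly pcharK an_neq0) ltnS => jq.
by rewrite leq_mul2r jq orbT.
Qed.

(** Division in Y by the curve, whose leading coefficient [a n] is a constant. Its leading monomial
    Y^q has the maximal weight qm, so no step raises the weight. The last clause guarantees that D -
    qm is a true difference whenever the quotient is nonzero. *)
Lemma reduction D T : wt_le q m D T -> exists T' C,
  [/\ T = T' + curve_poly * C, (size T' <= q)%N, wt_le q m D T',
      wt_le q m (D - q * m) C & C != 0 -> (q * m <= D)%N].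
Proof.
have [s] := ubnP (size T); elim: s T => // s IH T /ltnSE sT wT.
have [Tq|qT] := leqP (size T) q.
  by exists T, 0; rewrite mulr0 addr0 eqxx; split=> //; exact: wt_le0.
pose d := (size T).-1; have qd : (q <= d)%N by rewrite /d; lia.
have dT : size T = d.+1 by rewrite /d; lia.
have Td0 : T`_d != 0 by rewrite -lead_coefE lead_coef_eq0 -size_poly_eq0; lia.
have [i Tdi] : exists i, T`_d`_i != 0.
  by exists (size T`_d).-1; rewrite -lead_coefE lead_coef_eq0.
have qmD : (q * m <= D)%N by have := wT _ _ Tdi; have := leq_mul qd (leqnn m); lia.
pose C0 := ((a n)^-1 *: T`_d) *: 'X^(d - q).
have wC0 : wt_le q m (D - q * m) C0.
  move=> k j; rewrite coefZ coefXn; case: (j =P (d - q)%N) => [->|_]; last by rewrite mulr0 coef0 eqxx.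
  rewrite mulr1 coefZ mulf_eq0 negb_or mulnBl => /andP[_ /wT].
  by have := leq_mul qd (leqnn m); lia.
have [||T' [C [eT' sT' wT' wC CD]]] := IH (T - curve_poly * C0).
- rewrite (leq_trans _ sT) // dT ltnS; apply/leq_sizeP => j; rewrite leq_eqVlt.
  case/orP => [/eqP<-|dj]; rewrite coefB /C0 -scalerAr coefZ coefMXn ltnNge.
    rewrite leq_subr /= subKn // curve_poly_q mulrC mul_polyC.
    by rewrite scalerA divff ?an_neq0 // scale1r subrr.
  rewrite (leq_trans (leq_subr _ _) (ltnW dj)) /=.
  have -> : T`_j = 0 by rewrite nth_default ?dT.
  have -> : curve_poly`_(j - (d - q)) = 0 by rewrite nth_default // size_curve_poly; lia.
  by rewrite mulr0 subr0.
- by apply: (wt_leB wT); rewrite -(subnKC qmD); exact: (wt_leM wt_curve_poly wC0).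
exists T', (C0 + C); split=> //; last exact: wt_leD.
by rewrite mulrDr addrCA -eT' addrC subrK.
Qed.

(** * The place at infinity *)

Lemma lead_root_exists : exists u : K, u != 0 /\ a n * u ^+ q = 1.
Proof.
have /closed_rootP[u] : size ('X^q - ((a n)^-1)%:P : {poly K}) != 1%N.
  by rewrite size_XnsubC ?q_gt0 // eqSS -lt0n q_gt0.
rewrite /root !hornerE subr_eq0 => /eqP uq; exists u.
rewrite uq divff ?an_neq0 //; split=> //.
have := invr_neq0 an_neq0; rewrite -uq; apply: contraNneq => ->.
by rewrite expr0n gtn_eqF ?q_gt0.
Qed.

(** With this u the curve (Z^q, u Z^m) satisfies a_n Y^q = X^m, the part of highest weight of the
    equation. *)
Definition lead_root : K := sval (cid lead_root_exists).

Lemma lead_root_neq0 : lead_root != 0.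
Proof. by have [] := svalP (cid lead_root_exists). Qed.

Lemma lead_rootX : a n * lead_root ^+ q = 1.
Proof. by have [] := svalP (cid lead_root_exists). Qed.

Notation psi := (ev2 polyC 'X^q (lead_root *: 'X^m)).

Definition rdeg P := (size (psi P)).-1.

Lemma psi_eq0 P : (size P <= q)%N -> (psi P == 0) = (P == 0).
Proof. exact: wt_curve_eq0 q_gt0 coprime_qm lead_root_neq0 P. Qed.

Lemma wt_rdeg P : (size P <= q)%N -> wt_le q m (rdeg P) P.
Proof. exact: wt_le_size_curve q_gt0 coprime_qm lead_root_neq0 P. Qed.

Lemma size_psi P : (size P <= q)%N -> P != 0 -> size (psi P) = (rdeg P).+1.
Proof.
by move=> sP P0; rewrite /rdeg prednK // lt0n size_poly_eq0 psi_eq0.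
Qed.

(** The two terms of weight qm cancel by the choice of [lead_root]; the others have degree p^j m
    with j < n. *)
Lemma size_psi_curve_poly : (size (psi curve_poly) <= q * m)%N.
Proof.
rewrite ev2_sep_poly horner_linpoly.
rewrite big_ord_recr /= exprZn -!exprM mul_polyC scalerA lead_rootX scale1r.
rewrite [(m * q)%N]mulnC addrK (leq_trans (size_sum _ _ _)) //.
apply/bigmax_leqP => j _; rewrite mul_polyC exprZn scalerA -exprM.
rewrite (leq_trans (size_scale_leq _ _)) // size_polyXn mulnC ltn_mul2r.
by rewrite (ltn_trans _ m_gt1) ?ltn_exp2l ?p_gt1 ?ltn_ord.
Qed.

(** The multiple of the curve that is removed from PQ has an image under [psi] of degree below rdeg
    P + rdeg Q, so the leading term of psi P psi Q survives. Thus [rdeg] is additive on products in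
    F. *)
Lemma reduced_mul P Q : (size P <= q)%N -> (size Q <= q)%N -> P != 0 -> Q != 0 ->
  exists T, [/\ (size T <= q)%N, T != 0, phi T = phi P * phi Q & rdeg T = (rdeg P + rdeg Q)%N].
Proof.
move=> sP sQ P0 Q0.
have wPQ := wt_leM (wt_rdeg sP) (wt_rdeg sQ).
have [T [C [ePQ sT wT wC CD]]] := reduction wPQ.
have psiT : psi T = psi P * psi Q - psi curve_poly * psi C.
  by rewrite -!ev2M ePQ -ev2B addrK.
have sPQ : size (psi P * psi Q) = (rdeg P + rdeg Q).+1.
  by rewrite size_mul ?psi_eq0 // !size_psi // addSn addnS.
have sT' : size (psi T) = (rdeg P + rdeg Q).+1.
  rewrite psiT size_polyDl sPQ // size_polyN ltnS.
  have [->|C0] := eqVneq C 0; first by rewrite ev20 mulr0 size_poly0.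
  rewrite (leq_trans (size_polyMleq _ _)) //.
  have := size_wt_curve lead_root wC; have := size_psi_curve_poly.
  move: (CD C0); set s1 := size (psi curve_poly); set s2 := size (psi C).
  by move: s1 s2 => s1 s2; lia.
exists T; split=> //.
- by rewrite -psi_eq0 // -size_poly_eq0 sT'.
- by rewrite -ev2M ePQ ev2D ev2M phi_curve_poly mul0r addr0.
- by rewrite /rdeg sT'.
Qed.

Lemma reduced_exists T : exists2 P : {poly {poly K}}, (size P <= q)%N & phi P = phi T.
Proof.
have [D wT] := wt_le_exists q m T; have [P [C [-> sP _ _ _]]] := reduction wT.
by exists P; rewrite // ev2D ev2M phi_curve_poly mul0r addr0.
Qed.

Lemma phi_neq0 P : (size P <= q)%N -> P != 0 -> phi P != 0.
Proof. by move=> sP; apply: contraNneq => /(reduced_inj sP)->. Qed.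

Lemma phi_inj P Q : (size P <= q)%N -> (size Q <= q)%N -> phi P = phi Q -> P = Q.
Proof.
move=> sP sQ ePQ; apply/eqP; rewrite -subr_eq0; apply/eqP/reduced_inj.
  by rewrite (leq_trans (size_polyD _ _)) // geq_max sP size_polyN.
by rewrite ev2B ePQ subrr.
Qed.

Lemma x_neq0 : x != 0.
Proof.
rewrite -(ev2X iota x y) phi_neq0 ?polyC_eq0 ?polyX_eq0 //.
exact: leq_trans (size_polyC_leq1 _) q_gt0.
Qed.

Lemma y_neq0 : y != 0.
Proof. by rewrite -(ev2Y iota x y) phi_neq0 ?polyX_eq0 // size_polyX q_gt1. Qed.

Lemma rdegX : rdeg 'X%:P = q.
Proof. by rewrite /rdeg ev2X size_polyXn. Qed.

Lemma rdegY : rdeg 'X = m.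
Proof. by rewrite /rdeg ev2Y size_scale ?lead_root_neq0 // size_polyXn. Qed.

(** Minus [rdeg] of the reduced representative is additive on products and ultrametric, hence
    extends to fractions. *)
Lemma infinity_valuation : exists v, valuation iota v /\
  forall P, (size P <= q)%N -> P != 0 -> v (phi P) = - (rdeg P)%:Z.
Proof.
pose rel T (k : int) := exists P : {poly {poly K}}, [/\ (size P <= q)%N, P != 0, phi P = phi T & k = - (rdeg P)%:Z].
have relM P Q k l : phi P != 0 -> phi Q != 0 -> rel P k -> rel Q l -> rel (P * Q) (k + l).
  move=> _ _ [P' [sP P'0 eP ->]] [Q' [sQ Q'0 eQ ->]].
  have [T [sT T0 eT rT]] := reduced_mul sP sQ P'0 Q'0.
  by exists T; split=> //; [rewrite eT eP eQ ev2M | rewrite rT; lia].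
have relX P k i : phi P != 0 -> rel P k -> rel (P ^+ i) (k *+ i).
  move=> P0 rP; elim: i => [|i IH].
    exists 1; rewrite expr0 mulr0n oner_neq0; split=> //.
      by rewrite size_poly1 q_gt0.
    by rewrite /rdeg ev21 size_poly1.
  by rewrite exprS mulrS; apply: relM => //; rewrite ev2Xn expf_neq0.
have relrd P : (size P <= q)%N -> P != 0 -> rel P (- (rdeg P)%:Z).
  by move=> sP P0; exists P.
have [|||||v [val_v vrel]] := @valuation_extension _ _ iota _ (ev2 iota x y) rel frac _ relM.
- move=> /= P P0; have [P' sP' eP'] := reduced_exists P.
  exists (- (rdeg P')%:Z); exists P'; split=> //.
  by apply: contraNneq P0 => P'0; rewrite -eP' P'0 ev20.
- move=> /= P Q k l _ ePQ [P' [sP _ eP ->]] [Q' [sQ _ eQ ->]].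
  by have -> : P' = Q' by apply: phi_inj => //; rewrite eP eQ.
- move=> /= P Q k l r _ _ PQ0 [P' [sP P'0 eP ->]] [Q' [sQ Q'0 eQ ->]] [T' [sT T'0 eT ->]].
  have eT' : T' = P' + Q'.
    apply: phi_inj => //; last by rewrite eT !ev2D eP eQ.
    by rewrite (leq_trans (size_polyD _ _)) // geq_max sP.
  have : (size (psi T') <= maxn (size (psi P')) (size (psi Q')))%N.
    by rewrite eT' ev2D size_polyD.
  by rewrite !size_psi //; lia.
- move=> /= c c0; exists c%:P%:P; first exact: ev2CC.
  exists c%:P%:P; split; rewrite ?polyC_eq0 //.
    exact: leq_trans (size_polyC_leq1 _) q_gt0.
  by rewrite /rdeg ev2CC size_polyC c0.
(* Bezout gives iq = jm + 1, so the pole order of x^i exceeds that of y^j by one and y^j / x^i is a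
   uniformiser. *)
- have [i j ij _] := egcdnP m q_gt0.
  have gcd1 : gcdn q m = 1%N by apply/eqP; exact: coprime_qm.
  have rX : rel 'X%:P (- q%:Z).
    rewrite -[X in - X%:Z]rdegX; apply: relrd; rewrite ?polyC_eq0 ?polyX_eq0 //.
    exact: leq_trans (size_polyC_leq1 _) q_gt0.
  have rY : rel 'X (- m%:Z).
    by rewrite -[X in - X%:Z]rdegY; apply: relrd; rewrite ?polyX_eq0 // size_polyX q_gt1.
  exists ('X%:P ^+ i), ('X ^+ j), (- q%:Z *+ i); split=> /=.
  + by rewrite ev2Xn ev2X expf_neq0 ?x_neq0.
  + by rewrite ev2Xn ev2Y expf_neq0 ?y_neq0.
  + by apply: relX => //; rewrite ev2X x_neq0.
  + have -> : - q%:Z *+ i + 1 = - m%:Z *+ j by move: ij; rewrite gcd1; nia.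
    by apply: relX => //; rewrite ev2Y y_neq0.
exists v; split=> // P sP P0; apply: vrel; first exact: phi_neq0.
exact: relrd.
Qed.

Definition vinf : F -> int := sval (cid infinity_valuation).

Lemma vinf_valuation : valuation iota vinf.
Proof. by have [] := svalP (cid infinity_valuation). Qed.

Lemma vinf_phi P : (size P <= q)%N -> P != 0 -> vinf (phi P) = - (rdeg P)%:Z.
Proof. by have [_ h] := svalP (cid infinity_valuation); exact: h. Qed.

Lemma vinf_x : vinf x = - q%:Z.
Proof.
rewrite -[in LHS](ev2X iota x y) vinf_phi ?rdegX ?polyC_eq0 ?polyX_eq0 //.
exact: leq_trans (size_polyC_leq1 _) q_gt0.
Qed.

Lemma vinf_y : vinf y = - m%:Z.
Proof.
by rewrite -[in LHS](ev2Y iota x y) vinf_phi ?rdegY ?polyX_eq0 // size_polyX q_gt1.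
Qed.

Lemma rdeg_attained P : (size P <= q)%N -> P != 0 ->
  exists i j, P`_j`_i != 0 /\ (i * q + j * m)%N = rdeg P.
Proof.
move=> sP P0; have wP := wt_rdeg sP.
have [i [j Pij]] : exists i j, P`_j`_i != 0.
  exists (size (lead_coef P)).-1, (size P).-1.
  by rewrite -[P`__]lead_coefE -lead_coefE !lead_coef_eq0.
apply: contrapT => nD; have wP' : wt_le q m (rdeg P).-1 P.
  move=> k l Pkl; have := wP _ _ Pkl; rewrite leq_eqVlt => /orP[/eqP e'|]; last by lia.
  by case: nD; exists k, l.
have D0 : (0 < rdeg P)%N.
  rewrite lt0n; apply/eqP => D0; case: nD; exists i, j; split=> //.
  by have := wP _ _ Pij; lia.
by have := size_wt_curve lead_root wP'; rewrite size_psi //; lia.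
Qed.

Section AnyValuation.
Variable v : F -> int.
Hypothesis val_v : valuation iota v.

Lemma val_phi_ge k l r P : vge v k x -> vge v l y ->
  (forall i j, P`_j`_i != 0 -> r <= k *+ i + l *+ j) -> vge v r (phi P).
Proof.
move=> kx ly rP; rewrite ev2E (vge_sum val_v) // => j _; rewrite (vge_sum val_v) // => i _.
have [->|/rP rij] := eqVneq P`_j`_i 0; first by rewrite rmorph0 !mul0r vge0.
apply: vgeW rij _; rewrite (vgeM val_v) ?(vgeX val_v) // -[k *+ i]add0r.
by rewrite (vgeM val_v) ?(vgeX val_v) ?(vge_iota val_v).
Qed.

Lemma vge0_y : vge v 0 x -> vge v 0 y.
Proof.
move=> x0; rewrite vgeE ?y_neq0 // leNgt; apply/negP => y0.
have A0 : A != 0 by rewrite -size_poly_eq0 (size_linpoly pcharK an_neq0).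
have [_] := val_horner_neg val_v y_neq0 y0 A0.
rewrite curve_eq (size_linpoly pcharK an_neq0) (valX val_v) ?x_neq0 //=.
by move: x0 y0; rewrite vgeE ?x_neq0 //; have := q_gt0; nia.
Qed.

(** Comparing valuations in A(y) = x^m gives q v(y) = m v(x), and q, m are coprime. *)
Lemma val_infinite : ~~ vge v 0 x ->
  exists e : nat, [/\ (0 < e)%N, v x = - (q * e)%:Z & v y = - (m * e)%:Z].
Proof.
rewrite vgeE ?x_neq0 // -ltNge => x0.
have y0 : v y < 0.
  rewrite ltNge; apply/negP => y0.
  have : vge v 0 (map_poly iota A).[y] by rewrite (vge0_horner val_v) // vgeE ?y_neq0.
  rewrite curve_eq vgeE ?expf_neq0 ?x_neq0 // (valX val_v) ?x_neq0 //.
  by have := m_gt1; nia.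
have A0 : A != 0 by rewrite -size_poly_eq0 (size_linpoly pcharK an_neq0).
have [_] := val_horner_neg val_v y_neq0 y0 A0.
rewrite curve_eq (size_linpoly pcharK an_neq0) (valX val_v) ?x_neq0 //= => e_xy.
have [X eX] : exists X : nat, v x = - X%:Z by exists `|v x|%N; lia.
have [Y eY] : exists Y : nat, v y = - Y%:Z by exists `|v y|%N; lia.
have exy : (m * X = q * Y)%N by move: e_xy; rewrite eX eY; lia.
have /dvdnP[e Xe] : (q %| X)%N.
  by rewrite -(Gauss_dvdr _ coprime_qm) exy dvdn_mulr.
have Ye : Y = (m * e)%N.
  by apply/eqP; rewrite -(eqn_pmul2l q_gt0) -exy Xe; apply/eqP; lia.
exists e; rewrite eX eY Xe Ye; split=> //; last by rewrite mulnC.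
by move: x0; rewrite eX Xe; case: (e) => //; rewrite mul0n oppr0.
Qed.

(** At such a place x and y have pole orders qe and me. The weights of a reduced polynomial being
    distinct, its top monomial dominates, so v is e times [vinf]; normalisation forces e = 1. *)
Lemma vinf_unique : ~~ vge v 0 x -> forall z, z != 0 -> v z = vinf z.
Proof.
move=> /val_infinite[e [e0 vx vy]].
have vP P : (size P <= q)%N -> P != 0 -> v (phi P) = - (e * rdeg P)%:Z.
  move=> sP P0; set D := rdeg P; have wP := wt_rdeg sP; rewrite -/D in wP.
  have [i [j [Pij eD]]] := rdeg_attained sP P0; rewrite -/D in eD.
  have jq : (j < q)%N.
    apply: leq_trans sP; apply: coef_neq0_ltn.
    by apply: contraNneq Pij => ->; rewrite coef0.
  (* M is the unique monomial of P of largest weight. *)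
  pose M : {poly {poly K}} := (P`_j`_i *: 'X^i) *: 'X^j.
  have phiM : phi M = iota P`_j`_i * x ^+ i * y ^+ j.
    rewrite /M -[X in phi X]mul_polyC ev2M ev2Xn ev2Y ev2C linearZ /= map_polyXn.
    by rewrite hornerZ hornerXn.
  have M0 : phi M != 0.
    by rewrite phiM !mulf_neq0 ?expf_neq0 ?fmorph_eq0 ?x_neq0 ?y_neq0.
  have vM : v (phi M) = - (e * D)%:Z.
    rewrite phiM !(valM val_v) ?mulf_neq0 ?expf_neq0 ?fmorph_eq0 ?x_neq0 ?y_neq0 //.
    rewrite (val_iota val_v) // !(valX val_v) ?x_neq0 ?y_neq0 // vx vy -eD; nia.
  have -> : phi P = phi M + phi (P - M) by rewrite -ev2D addrC subrK.
  rewrite (val_dom val_v M0 _).2 // vM.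
  apply: (@val_phi_ge (- (q * e)%:Z) (- (m * e)%:Z)).
  - by rewrite vgeE ?x_neq0 // vx.
  - by rewrite vgeE ?y_neq0 // vy.
  move=> k l; rewrite coefB coefZ coefXn; case: (l =P j) => [->|lj].
    rewrite mulr1 coefB coefZ coefXn; case: (k =P i) => [->|ki].
      by rewrite mulr1 subrr eqxx.
    rewrite mulr0 subr0 => Pkj; have := wP _ _ Pkj; rewrite leq_eqVlt -eD => /orP[/eqP e'|].
      by case: ki; have [] := weight_inj q_gt0 coprime_qm jq jq e'.
    by nia.
  rewrite mulr0 subr0 => Pkl; have := wP _ _ Pkl; rewrite leq_eqVlt -eD => /orP[/eqP e'|].
    have lq : (l < q)%N.
      apply: leq_trans sP; apply: coef_neq0_ltn.
      by apply: contraNneq Pkl => ->; rewrite coef0.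
    by case: lj; have [] := weight_inj q_gt0 coprime_qm lq jq e'.
  by nia.
have vE z : z != 0 -> v z = e%:Z * vinf z.
  move=> z0; have [P [Q [Q0 ez]]] := frac z.
  have P0 : phi P != 0 by apply: contraNneq z0 => P0; rewrite ez P0 mul0r.
  have [P' sP eP] := reduced_exists P; have [Q' sQ eQ] := reduced_exists Q.
  have P'0 : P' != 0 by apply: contraNneq P0 => P'0; rewrite -eP P'0 ev20.
  have Q'0 : Q' != 0 by apply: contraNneq Q0 => Q'0; rewrite -eQ Q'0 ev20.
  rewrite ez (val_div val_v) // (val_div vinf_valuation) // -eP -eQ !vP // !vinf_phi //.
  by nia.
have [_ _ _ [z z0 vz]] := val_v.
have := vE z z0; rewrite vz => e1; 
have V0 : 0 < vinf z by rewrite ltNge; apply/negP => V0; move: e1; nia.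
have e1' : e = 1%N by apply/eqP; rewrite eqn_leq e0 andbT leqNgt; apply/negP => e2; move: e1; nia.
by move=> w /vE->; rewrite e1' mul1r.
Qed.

End AnyValuation.

(** For a quotient of reduced P' and Q' the residue is the quotient of the coefficients of psi P'
    and psi Q' at degree rdeg Q'; it is 0 when P' has smaller degree. *)
Lemma vinf_residue z : vge vinf 0 z -> exists c, vge vinf 1 (z - iota c).
Proof.
have [->|z0] := eqVneq z 0; first by exists 0; rewrite rmorph0 subr0 vge0.
have [P [Q [Q0 ez]]] := frac z.
have P0 : phi P != 0 by apply: contraNneq z0 => P0; rewrite ez P0 mul0r.
have [P' sP eP] := reduced_exists P; have [Q' sQ eQ] := reduced_exists Q.
have P'0 : P' != 0 by apply: contraNneq P0 => P'0; rewrite -eP P'0 ev20.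
have Q'0 : Q' != 0 by apply: contraNneq Q0 => Q'0; rewrite -eQ Q'0 ev20.
have sPs := size_psi sP P'0; have sQs := size_psi sQ Q'0.
rewrite ez -eP -eQ vgeE ?mulf_neq0 ?invr_neq0 ?eP ?eQ // -eP -eQ.
rewrite (val_div vinf_valuation) ?phi_neq0 // !vinf_phi // => PQ.
pose c := (psi P')`_(rdeg Q') / (psi Q')`_(rdeg Q').
have lQ : (psi Q')`_(rdeg Q') != 0.
  by rewrite /rdeg -lead_coefE lead_coef_eq0 psi_eq0.
exists c; pose T := P' - c%:P *: Q'.
have sT : (size T <= q)%N.
  rewrite (leq_trans (size_polyD _ _)) // geq_max sP size_polyN.
  exact: leq_trans (size_scale_leq _ _) sQ.
have -> : phi P' / phi Q' - iota c = phi T / phi Q'.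
  rewrite ev2B -mul_polyC ev2M ev2CC mulrBl mulfK //.
  exact: phi_neq0.
have [->|T0] := eqVneq T 0; first by rewrite ev20 mul0r vge0.
rewrite vgeE ?mulf_neq0 ?invr_neq0 ?phi_neq0 // (val_div vinf_valuation) ?phi_neq0 //.
rewrite !vinf_phi //. suff : (size (psi T) <= rdeg Q')%N.
  rewrite size_psi //. Show. lia.
have psiT : psi T = psi P' - c *: psi Q'.
  by rewrite ev2B -[_ *: Q']mul_polyC ev2M ev2CC mul_polyC.
apply/leq_sizeP => i; rewrite leq_eqVlt psiT coefB coefZ => /orP[/eqP<-|lti].
  by rewrite /c divfK // subrr.
rewrite !nth_default ?mulr0 ?subr0 ?sPs ?sQs //. Show. all: lia.
Qed.

(** * Affine points and the order of vanishing at them *)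

Lemma phiC (r : {poly K}) : phi r%:P = (map_poly iota r).[x].
Proof. exact: ev2C. Qed.

Lemma horner_x_eq0 (r : {poly K}) : (map_poly iota r).[x] = 0 -> r = 0.
Proof.
rewrite -phiC => /reduced_inj/eqP; rewrite polyC_eq0 => /(_ _)/eqP; apply.
exact: leq_trans (size_polyC_leq1 _) q_gt0.
Qed.

(* F is algebraic over K(x): a nonzero element of K[x, y] divides a nonzero
   element of K[x], namely its resultant with the curve. *)
Lemma norm_exists P : phi P != 0 -> exists G (r : {poly K}),
  r != 0 /\ phi (P * G) = (map_poly iota r).[x].
Proof.
move=> P0; have [P' sP eP] := reduced_exists P.
have P'0 : P' != 0 by apply: contraNneq P0 => P'0; rewrite -eP P'0 ev20.
have [sP1|sP1] := leqP (size P') 1.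
  exists 1, P'`_0; rewrite mulr1 -phiC -(size1_polyC sP1) eP; split=> //.
  by rewrite -polyC_eq0 -(size1_polyC sP1).
have sC : (1 < size curve_poly)%N by rewrite size_curve_poly ltnS q_gt0.
have [[U V] _ /= eR] := resultant_in_ideal sP1 sC.
exists U, (resultant P' curve_poly); rewrite -phiC eR ev2D !ev2M phi_curve_poly.
rewrite mulr0 addr0 eP mulrC; split=> //.
(* If the resultant vanishes, P' and the curve share a factor g of positive Y-degree. Up to a factor
   in K[X] the curve is then h g with both factors of Y-degree below q, whose images in F are
   nonzero, although the curve maps to 0. *)
rewrite resultant_eq0; apply/negP => sg.
set g := gcdp P' curve_poly in sg.
have [[c h] /= c0 eh] := Pdiv.Idomain.dvdpP _ _ (dvdp_gcdr P' curve_poly).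
rewrite -/g in eh.
have g0 : g != 0 by rewrite -size_poly_gt0; apply: ltn_trans sg.
have ch0 : c *: curve_poly != 0 by rewrite scale_poly_eq0 negb_or c0 -size_poly_eq0 size_curve_poly.
have h0 : h != 0 by apply: contraNneq ch0 => h0; rewrite eh h0 mul0r.
have sgq : (size g <= q)%N by apply: leq_trans sP; rewrite dvdp_leq ?dvdp_gcdl.
have shq : (size h <= q)%N.
  have : size (c *: curve_poly) = size (h * g) by rewrite eh.
  by rewrite size_scale // size_curve_poly size_mul // //; lia.
have : phi (h * g) = 0 by rewrite -eh -mul_polyC ev2M phi_curve_poly mulr0.
by apply/eqP; rewrite ev2M mulf_neq0 ?phi_neq0.
Qed.

Definition on_curve (x0 y0 : K) := A.[y0] = x0 ^+ m.

Definition at_point (x0 y0 : K) (v : F -> int) :=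
  [/\ valuation iota v, vge v 1 (x - iota x0) & vge v 1 (y - iota y0)].

Definition ev (x0 y0 : K) : {poly {poly K}} -> K := ev2 idfun x0 y0.

(** Two polynomials with the same image in F differ by a multiple of the curve, which vanishes at
    the point. *)
Lemma ev_phi x0 y0 P Q : on_curve x0 y0 -> phi P = phi Q -> ev x0 y0 P = ev x0 y0 Q.
Proof.
move=> xy0 ePQ; apply/eqP; rewrite -subr_eq0 -ev2B; apply/eqP.
have [D wD] := wt_le_exists q m (P - Q).
have [T [C [eT sT _ _ _]]] := reduction wD.
have T0 : T = 0.
  apply: reduced_inj => //; have : phi (P - Q) = 0 by rewrite ev2B ePQ subrr.
  by rewrite eT ev2D ev2M phi_curve_poly mul0r addr0.
rewrite eT T0 add0r /ev ev2M ev2_sep_poly map_poly_id //= xy0.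
by rewrite subrr mul0r.
Qed.

Lemma ev_decomp x0 y0 P : exists P1 P2,
  P = (ev x0 y0 P)%:P%:P + ('X - x0%:P)%:P * P1 + ('X - y0%:P%:P) * P2.
Proof.
have /factor_theorem[P2 eP2] : root (P - (P.[y0%:P])%:P) y0%:P.
  by rewrite /root hornerD hornerN hornerC subrr.
have /factor_theorem[P1 eP1] : root (P.[y0%:P] - (P.[y0%:P].[x0])%:P) x0.
  by rewrite /root hornerD hornerN hornerC subrr.
exists P1%:P, P2; rewrite -polyCM mulrC -[in RHS]eP1 [_ * P2]mulrC -eP2.
have -> : ev x0 y0 P = P.[y0%:P].[x0].
  rewrite /ev /ev2 -[in RHS]/(horner_eval x0 _) -horner_map /=; congr (_.[_]).
    by apply: eq_map_poly => c; rewrite map_poly_id.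
  by rewrite /horner_eval hornerC.
by rewrite polyCB [X in _ = X + _]addrC subrK addrC subrK.
Qed.

Section Point.
Variables (x0 y0 : K).
Hypothesis xy0 : on_curve x0 y0.
Notation t := (x - iota x0).
Notation ev := (ev x0 y0).

Lemma phi_t : phi ('X - x0%:P)%:P = t.
Proof. by rewrite phiC map_polyXsubC hornerXsubC. Qed.

(* Smoothness: A' = a 0 <> 0, so y - y0 is a local multiple of x - x0. *)
Lemma ord_step P : ev P = 0 -> exists P1 d, ev d != 0 /\ phi P * phi d = t * phi P1.
Proof.
move=> P0; have [P1 [P2 eP]] := ev_decomp x0 y0 P.
have /factor_theorem[B eB] : root (A - (x0 ^+ m)%:P) y0.
  by rewrite /root !hornerE xy0 subrr.
have dB : B.[y0] = a 0%N.
  have := deriv_linpoly n a pcharK; rewrite -[A](subrK (x0 ^+ m)%:P) eB.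
  rewrite derivD derivC addr0 derivM derivXsubC mulr1 => /(congr1 (fun r => r.[y0])).
  by rewrite hornerD hornerM hornerXsubC subrr mulr0 add0r hornerC.
have /factor_theorem[S eS] : root ('X^m - (x0 ^+ m)%:P) x0.
  by rewrite /root !hornerE subrr.
have eBS : phi ('X - y0%:P%:P) * phi B^:P = t * phi S%:P.
  rewrite ev2_lift phiC.
  have <- : (map_poly iota (A - (x0 ^+ m)%:P)).[y] = phi ('X - y0%:P%:P) * (map_poly iota B).[y].
    rewrite eB rmorphM /= hornerM mulrC; congr (_ * _).
    by rewrite ev2B ev2Y ev2CC map_polyXsubC hornerXsubC.
  have -> : t * (map_poly iota S).[x] = (map_poly iota ('X^m - (x0 ^+ m)%:P)).[x].
    by rewrite eS rmorphM /= hornerM mulrC map_polyXsubC hornerXsubC.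
  by rewrite !rmorphB /= (map_polyC iota (x0 ^+ m)) map_polyXn !hornerE /= curve_eq.
exists (P1 * B^:P + S%:P * P2), B^:P; split.
  by rewrite /ev ev2_lift map_poly_id // dB a0_neq0.
rewrite [in LHS]eP P0 !polyC0 add0r ev2D !ev2M phi_t [in RHS]ev2D !ev2M mulrDl mulrDr.
by rewrite !mulrA [_ * phi P2 * _]mulrAC eBS.
Qed.

(** [ord_step] is repeated as long as the numerator vanishes at the point. This stops because the
    image of P divides some nonzero r(x), and r bounds the number of factors t by the multiplicity
    of x0 in it. *)
Lemma ord_exists P : phi P != 0 -> exists k e d,
  [/\ ev e != 0, ev d != 0 & phi P * phi d = t ^+ k * phi e].
Proof.
move=> P0; have [G [r [r0 er]]] := norm_exists P0.
have [l [s es s0]] : exists l, exists2 s, r = ('X - x0%:P) ^+ l * s & s.[x0] != 0.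
  have [l [s nrs es]] := multiplicity_XsubC r x0.
  by exists l, s; [rewrite mulrC -es | move: nrs; rewrite r0].
have iter k : (exists i e d, (i < k)%N /\
    [/\ ev e != 0, ev d != 0 & phi P * phi d = t ^+ i * phi e]) \/
    (exists e d, ev d != 0 /\ phi P * phi d = t ^+ k * phi e).
  elim: k => [|k [[i [e [d [ik h]]]]|[e [d [d0 ed]]]]].
  - by right; exists P, 1; rewrite /ev ev21 oner_neq0 ev21 mulr1 mul1r.
  - by left; exists i, e, d; split=> //; apply: ltnW.
  - have [e0|e0] := eqVneq (ev e) 0; last by left; exists k, e, d; rewrite ltnSn.
    have [e1 [d1 [d10 ed1]]] := ord_step e0; right; exists e1, (d * d1).
    rewrite /ev ev2M mulf_neq0 //; split=> //.
    by rewrite ev2M mulrA ed -mulrA ed1 exprSr mulrA.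
have [[i [e [d [_ h]]]]|[e [d [d0 ed]]]] := iter l.+1; first by exists i, e, d.
have t0 : t != 0.
  rewrite -phi_t phi_neq0 ?polyC_eq0 ?polyXsubC_eq0 //.
  exact: leq_trans (size_polyC_leq1 _) q_gt0.
have : phi (s%:P * d) = phi (('X - x0%:P)%:P * (e * G)).
  have tl0 : t ^+ l != 0 by rewrite expf_neq0.
  apply: (mulfI tl0).
  have et : t ^+ l * phi s%:P = phi P * phi G.
    by rewrite -ev2M er es -phiC polyCM ev2M rmorphXn ev2Xn phi_t.
  rewrite !ev2M phi_t [LHS]mulrA et mulrAC ed exprSr.
  by rewrite -![in LHS]mulrA.
move/(ev_phi xy0)/eqP; rewrite /ev !ev2M !ev2C !map_poly_id // hornerXsubC subrr mul0r.
by rewrite mulf_eq0 (negPf s0) (negPf d0).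
Qed.

Lemma t_neq0 : t != 0.
Proof.
rewrite -phi_t phi_neq0 ?polyC_eq0 ?polyXsubC_eq0 //.
exact: leq_trans (size_polyC_leq1 _) q_gt0.
Qed.

(** If i < k, cancelling t^i would write e as a positive power of t times U, which vanishes at the
    point. *)
Lemma ord_le i k e U : ev e != 0 -> t ^+ i * phi e = t ^+ k * phi U -> (k <= i)%N.
Proof.
move=> e0 etU; rewrite leqNgt; apply/negP => ik.
have : phi e = phi ((('X - x0%:P)%:P) ^+ (k - i) * U).
  apply: (mulfI (expf_neq0 i t_neq0)).
  by rewrite etU ev2M ev2Xn phi_t mulrA -exprD subnKC // ltnW.
move/(ev_phi xy0)/eqP; rewrite /ev ev2M ev2Xn ev2C map_poly_id // hornerXsubC subrr.
by rewrite expr0n subn_eq0 leqNgt ik mul0r; exact/negP.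
Qed.

(** The valuation is the exponent i in P d = t^i e with d and e nonzero at the point; [ord_le] makes
    it well defined and ultrametric. *)
Lemma point_exists : exists v, at_point x0 y0 v.
Proof.
pose rel P (k : int) := exists (i : nat) (e d : {poly {poly K}}),
  [/\ ev e != 0, ev d != 0, phi P * phi d = t ^+ i * phi e & k = i%:Z].
have evM P Q : ev P != 0 -> ev Q != 0 -> ev (P * Q) != 0.
  by move=> P0 Q0; rewrite /ev ev2M mulf_neq0.
have ev1 : ev 1 != 0 by rewrite /ev ev21 oner_neq0.
have [||||||v [val_v vrel]] := @valuation_extension _ _ iota _ (ev2 iota x y) rel frac.
- move=> /= P P0; have [i [e [d [e0 d0 ed]]]] := ord_exists P0.
  by exists i%:Z, i, e, d.
- move=> /= P Q k l _ _ [i [e [d [e0 d0 ed ->]]]] [j [e' [d' [e'0 d'0 ed' ->]]]].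
  exists (i + j)%N, (e * e'), (d * d'); split; rewrite ?evM //.
  by rewrite !ev2M mulrACA ed ed' mulrACA exprD.
- move=> /= P Q k l P0 ePQ [i [e [d [e0 d0 ed ->]]]] [j [e' [d' [e'0 d'0 ed' ->]]]].
  have eq2 : t ^+ i * phi (e * d') = t ^+ j * phi (e' * d).
    by rewrite !ev2M !mulrA -ed -ed' ePQ mulrAC.
  have := ord_le (evM _ _ e0 d'0) eq2; have := ord_le (evM _ _ e'0 d0) (esym eq2).
  by move=> ij ji; congr Posz; apply/eqP; rewrite eqn_leq ij.
- move=> /= P Q k l r _ _ _ [i [e [d [e0 d0 ed ->]]]] [j [e' [d' [e'0 d'0 ed' ->]]]].
  move=> [s [e'' [d'' [e''0 d''0 ed'' ->]]]]; set h := minn i j.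
  have : t ^+ s * phi (e'' * (d * d')) = t ^+ h *
      phi (d'' * (('X - x0%:P)%:P ^+ (i - h) * e * d' + ('X - x0%:P)%:P ^+ (j - h) * e' * d)).
    rewrite [in LHS]ev2M mulrA -ed'' !(ev2M, ev2D, ev2Xn) phi_t.
    have ti : t ^+ h * t ^+ (i - h) = t ^+ i by rewrite -exprD subnKC ?geq_minl.
    have tj : t ^+ h * t ^+ (j - h) = t ^+ j by rewrite -exprD subnKC ?geq_minr.
    transitivity (phi d'' * (t ^+ i * phi e * phi d' + t ^+ j * phi e' * phi d)).
      by rewrite -ed -ed'; ring.
    by rewrite -ti -tj; ring.
  move/ord_le => /(_ (evM _ _ e''0 (evM _ _ d0 d'0))); rewrite /h; clear; lia.
- move=> /= c c0; exists c%:P%:P; first exact: ev2CC.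
  exists 0%N, c%:P%:P, 1; split; [by rewrite /ev ev2CC | exact: ev1 | | by []].
  by rewrite ev21 mulr1 expr0 mul1r.
- exists 1, ('X - x0%:P)%:P, 0; rewrite /= ev21 oner_neq0 phi_t t_neq0; split=> //.
    by exists 0%N, 1, 1; rewrite ev21 expr0.
  by exists 1%N, 1, 1; rewrite phi_t ev21 expr1.
have vt : v t = 1.
  rewrite -phi_t; apply: vrel; first by rewrite /= phi_t t_neq0.
  by exists 1%N, 1, 1; rewrite /= phi_t ev21 expr1.
exists v; split=> //; first by rewrite vgeE ?t_neq0 // vt.
have ey : phi ('X - y0%:P%:P) = y - iota y0 by rewrite ev2B ev2Y ev2CC.
have [->|yy0] := eqVneq (y - iota y0) 0; first exact: vge0.
have yy0' : phi ('X - y0%:P%:P) != 0 by rewrite ey.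
have [i [e [d [e0 d0 ed]]]] := ord_exists yy0'.
rewrite vgeE // -ey (vrel _ i%:Z) //; last by exists i, e, d.
case: i ed => // ed; move: e0; rewrite -(@ev_phi _ _ (('X - y0%:P%:P) * d) e) //.
  by rewrite /ev ev2M ev2B ev2Y ev2CC /= subrr mul0r eqxx.
by rewrite ev2M ed expr0 mul1r.
Qed.

Variable v : F -> int.
Hypothesis v_at : at_point x0 y0 v.

Let val_v : valuation iota v. Proof. by case: v_at. Qed.

Lemma vge0_at_x : vge v 0 x.
Proof.
have [_ xx _] := v_at; rewrite -(subrK (iota x0) x) (vgeD val_v) ?(vge_iota val_v) //.
exact: vgeW xx.
Qed.

Lemma vge0_phi P : vge v 0 (phi P).
Proof.
have yx := vge0_y val_v vge0_at_x.
by apply: (val_phi_ge val_v vge0_at_x yx) => i j _; rewrite !mul0rn.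
Qed.

Lemma vge1_phi P : ev P = 0 -> vge v 1 (phi P).
Proof.
have [_ xx yy] := v_at; have [P1 [P2 eP]] := ev_decomp x0 y0 P => eP0.
rewrite eP eP0 !polyC0 add0r ev2D !ev2M phi_t ev2B ev2Y ev2CC.
by rewrite (vgeD val_v) // -[1]addr0 (vgeM val_v) ?vge0_phi.
Qed.

Lemma vge1_phiE P : vge v 1 (phi P) -> ev P = 0.
Proof.
move=> vP; apply: (vge_iota_gt0 val_v).
have -> : iota (ev P) = phi P - phi (P - (ev P)%:P%:P).
  by rewrite [in RHS]ev2B ev2CC opprB addrC subrK.
by rewrite (vgeB val_v) // vge1_phi // /ev ev2B ev2CC subrr.
Qed.

Lemma val_phi0 P : ev P != 0 -> phi P != 0 /\ v (phi P) = 0.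
Proof.
move=> eP; have P0 : phi P != 0.
  by apply: contraNneq eP => P0; apply/eqP/vge1_phiE; rewrite P0 vge0.
split=> //; have := vge0_phi P; rewrite vgeE // => v0.
apply/eqP; rewrite eq_le v0 andbT -ltzD1 add0r ltNge.
by apply: contra eP => v1; apply/eqP/vge1_phiE; rewrite vgeE.
Qed.

(** Every value on K[x, y] is a multiple of v(t) > 0, and the value 1 is a difference of two of
    them. *)
Lemma val_at_t : v t = 1.
Proof.
have vP P : phi P != 0 -> exists i : nat, v (phi P) = v t *+ i.
  move=> P0; have [i [e [d [e0 d0 ed]]]] := ord_exists P0; exists i.
  have [pe0 ve] := val_phi0 e0; have [pd0 vd] := val_phi0 d0.
  have : v (phi P * phi d) = v (t ^+ i * phi e) by rewrite ed.
  by rewrite !(valM val_v) ?expf_neq0 ?t_neq0 // (valX val_v) ?t_neq0 // ve vd !addr0.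
have [_ _ _ [z z0 vz]] := val_v; have [P [Q [Q0 ez]]] := frac z.
have P0 : phi P != 0 by apply: contraNneq z0 => P0; rewrite ez P0 mul0r.
have [[i vPi] [j vQj]] := (vP P P0, vP Q Q0).
have [_ xx _] := v_at; move: xx vz; rewrite vgeE ?t_neq0 // ez (val_div val_v) // vPi vQj.
move: (v t) => w w1 e; have {}e : w * (i%:Z - j%:Z) = 1 by rewrite -e; lia.
have h : 0 < i%:Z - j%:Z by rewrite ltNge; apply/negP => h; move: e; nia.
by apply/eqP; rewrite eq_le w1 andbT leNgt; apply/negP => w2; move: e; nia.
Qed.

End Point.

(** * Fibres over the x-line and functions regular on the affine curve *)

Lemma separable_sub_linpoly c : separable_poly (A - c%:P).
Proof.
rewrite unlock derivD derivN derivC subr0 (deriv_linpoly n a pcharK) coprimep_sym.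
by rewrite -[(a 0%N)%:P]mulr1 mul_polyC coprimepZl ?a0_neq0 // coprime1p.
Qed.

(** The derivative of A - c is a nonzero constant, so the projection to the x-line is unramified
    over every affine x_0. *)
Lemma fiber_roots c : exists rs : seq K,
  [/\ uniq rs, size rs = q & forall z, (z \in rs) = (A.[z] == c)].
Proof.
have [rs [u_rs s_rs rsP]] := closed_separable_roots (separable_sub_linpoly c).
have sA : size A = q.+1 by exact: size_linpoly pcharK an_neq0.
exists rs; split=> // [|z]; last by rewrite rsP /root !hornerE subr_eq0.
rewrite s_rs size_polyDl sA // size_polyN (leq_ltn_trans (size_polyC_leq1 _)) //.
Qed.

Lemma poly2_dvd_XsubC x0 P : map_poly (horner_eval x0) P = 0 ->
  exists2 P1 : {poly {poly K}}, P = ('X - x0%:P)%:P * P1 & (size P1 <= size P)%N.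
Proof.
move=> P0; exists (\poly_(j < size P) (P`_j %/ ('X - x0%:P))); last exact: size_poly.
apply/polyP => j; rewrite coefCM coef_poly.
have [_|jP] := ltnP; last by rewrite mulr0 nth_default.
rewrite mulrC divpK // dvdp_XsubCl /root.
by have := congr1 (fun r : {poly K} => r`_j) P0; rewrite coef_map coef0 => /eqP.
Qed.

(** The affine curve is normal. Clear denominators to z r(x) = T with T reduced. At a root x0 of r,
    T vanishes at all q points over x0, so T(x0, Y), of degree below q, is zero and the factor X -
    x0 cancels on both sides; induct on the degree of r. *)
Lemma regular_reduced z :
  (forall x0 y0 v, on_curve x0 y0 -> at_point x0 y0 v -> vge v 0 z) ->
  exists2 P : {poly {poly K}}, (size P <= q)%N & z = phi P.
Proof.
move=> z_reg; have [P [Q [Q0 ez]]] := frac z.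
have [G [r [r0 er]]] := norm_exists Q0.
have : exists2 T : {poly {poly K}}, (size T <= q)%N & z * (map_poly iota r).[x] = phi T.
  have [T sT eT] := reduced_exists (P * G); exists T => //.
  by rewrite -er eT !ev2M ez mulrA divfK.
move=> [T]; have [s] := ubnP (size r); elim: s r {er} r0 T => // s IH r r0 T sr sT eT.
have [sr1|sr1] := eqVneq (size r) 1%N.
  have /size_poly1P[c c0 rc] : size r == 1%N by apply/eqP.
  exists (c^-1%:P *: T); first exact: leq_trans (size_scale_leq _ _) sT.
  rewrite -mul_polyC ev2M ev2CC -eT rc map_polyC hornerC mulrCA fmorphV mulVf ?mulr1 //.
  by rewrite fmorph_eq0.
have /closed_rootP[x0 /factor_theorem[r' er']] := sr1.
have r'0 : r' != 0 by apply: contraNneq r0 => r'0; rewrite er' r'0 mul0r.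
have rx : (map_poly iota r).[x] = (map_poly iota r').[x] * (x - iota x0).
  by rewrite er' rmorphM /= hornerM map_polyXsubC hornerXsubC.
have T0 : map_poly (horner_eval x0) T = 0.
  have [rs [u_rs s_rs rsP]] := fiber_roots (x0 ^+ m).
  apply/eqP; apply: contraTT (leqnn q) => T0; rewrite -ltnNge -{1}s_rs.
  apply: leq_trans (leq_trans (size_poly _ _) sT).
  apply: max_poly_roots T0 _ u_rs; apply/allP => y0; rewrite rsP => /eqP xy0.
  have [v v_at] := point_exists xy0; have val_v : valuation iota v by case: v_at.
  have : ev x0 y0 T = 0.
    apply: (vge1_phiE v_at); rewrite -eT rx mulrA -[1]add0r (vgeM val_v) //.
      rewrite -[0]addr0 (vgeM val_v) ?(z_reg x0 y0) // -phiC.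
      exact: (vge0_phi v_at).
    by case: v_at.
  move=> e0; apply/eqP; rewrite -{}e0 /ev /ev2; congr (_.[_]).
  by apply: eq_map_poly => c; rewrite map_poly_id.
have [T1 eT1 sT1] := poly2_dvd_XsubC T0.
apply: (IH r' r'0 T1); last 2 first.
- exact: leq_trans sT1 sT.
- apply: (mulIf (t_neq0 x0)); rewrite -mulrA -rx eT eT1 ev2M phi_t mulrC //.
by move: sr; rewrite er' size_Mmonic ?monicXsubC // size_XsubC; lia.
Qed.

(** * Local expansions of y at affine points *)

(** This is x^m - x0^m in terms of t = x - x0. By additivity the expansion eta of y - y0 solves
    A(eta) = [shifted_pow x0], which does not involve y0: one eta serves all q points over x0. *)
Definition shifted_pow (x0 : K) : {poly K} := ('X + x0%:P) ^+ m - (x0 ^+ m)%:P.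

Lemma dvdX_coef0 (r : {poly K}) : ('X %| r) = (r`_0 == 0).
Proof. by rewrite -['X]subr0 dvdp_XsubCl /root horner_coef0. Qed.

Lemma dvdXn_coef k (r : {poly K}) : 'X^k %| r -> forall i, (i < k)%N -> r`_i = 0.
Proof. by move=> /dvdpP[s ->] i ik; rewrite coefMXn ik. Qed.

(* The expansion y = y0 + eta(x - x0) at a point of the curve over x0. *)
Lemma expansion_exists (x0 : K) N : exists eta : {poly K},
  eta`_0 = 0 /\ 'X^N %| A^:P.[eta] - shifted_pow x0.
Proof.
suff [eta [eta0 eN]] : exists eta : {poly K},
    eta`_0 = 0 /\ 'X^(N.+1) %| A^:P.[eta] - shifted_pow x0.
  by exists eta; split=> //; apply: dvdp_trans eN; rewrite dvdp_exp2l.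
elim: N => [|N [eta [eta0 eN]]].
  exists 0; rewrite coef0 expr1 (linpoly0 n a pcharK) sub0r dvdpNr dvdX_coef0.
  by rewrite -horner_coef0 /shifted_pow !hornerE subrr.
(* A Newton step with the constant derivative a_0: the linear term of A(delta) cancels eps, and the
   others have order at least 2(N + 1). *)
set eps := _ - _ in eN; pose delta := (a 0%N)^-1 *: eps.
have dN : 'X^(N.+1) %| delta by rewrite dvdpZr ?invr_neq0 ?a0_neq0.
exists (eta - delta); split.
  by rewrite coefB eta0 (dvdXn_coef dN) // subr0.
rewrite (linpolyB n a pcharK) addrAC -/eps [in X in _ - X]horner_linpoly big_ord_recl /=.
rewrite expn0 expr1 mul_polyC scalerA divff ?a0_neq0 // scale1r opprD addrA subrr sub0r.
rewrite dvdpNr; apply: (big_ind (fun r => 'X^(N.+2) %| r)) => [|r s|j _].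
- exact: dvdp0.
- exact: dvdp_add.
rewrite dvdp_mull //; apply: dvdp_trans (dvdp_exp2r (p ^ bump 0 j) dN).
rewrite -exprM dvdp_exp2l //.
have p2 : (2 <= p ^ bump 0 j)%N.
  by rewrite (leq_trans p_gt1) // -{1}(expn1 p) leq_exp2l ?p_gt1.
by rewrite (leq_trans _ (leq_mul (leqnn N.+1) p2)) // muln2 -addnn; lia.
Qed.

Lemma horner_linpoly_comp (t : F) (r : {poly K}) :
  (map_poly iota A^:P.[r]).[t] = (map_poly iota A).[(map_poly iota r).[t]].
Proof.
rewrite !horner_linpoly rmorph_sum horner_sum; apply: eq_bigr => j _ /=.
by rewrite rmorphM /= map_polyC rmorphXn /= hornerM hornerC horner_exp.
Qed.

Lemma horner_shifted_powE (x0 : K) (z : F) :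
  (map_poly iota (shifted_pow x0)).[z] = (z + iota x0) ^+ m - iota x0 ^+ m.
Proof.
rewrite /shifted_pow rmorphB /= hornerD hornerN (map_polyC iota (x0 ^+ m)) hornerC.
rewrite (rmorphXn (map_poly iota)) /= map_polyXaddC horner_exp hornerD hornerX hornerC.
by rewrite rmorphXn.
Qed.

Lemma horner_shifted_pow (x0 : K) :
  (map_poly iota (shifted_pow x0)).[x - iota x0] = x ^+ m - iota x0 ^+ m.
Proof. by rewrite horner_shifted_powE subrK. Qed.

Section LocalExpansion.
Variables (x0 y0 : K) (v : F -> int) (eta : {poly K}) (N : nat).
Hypotheses (xy0 : on_curve x0 y0) (v_at : at_point x0 y0 v).
Hypotheses (eta0 : eta`_0 = 0) (etaN : 'X^N %| A^:P.[eta] - shifted_pow x0).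
Notation t := (x - iota x0).

Let val_v : valuation iota v. Proof. by case: v_at. Qed.

Let vge_t (r : {poly K}) k : 'X^k %| r -> vge v k%:Z (map_poly iota r).[t].
Proof.
move=> /dvdpP[s ->]; rewrite rmorphM /= hornerM map_polyXn hornerXn -[k%:Z]add0r.
have t1 : vge v 1 t by case: v_at.
rewrite (vgeM val_v) //; last by rewrite -natz (vgeX val_v).
by rewrite (vge0_horner val_v) // (vgeW _ t1).
Qed.

(** By additivity A maps the error zeta to minus the truncation error, of order at least N; since A
    has a nonzero linear term, zeta and A(zeta) have the same valuation. *)
Lemma vge_expansion : vge v N%:Z (y - iota y0 - (map_poly iota eta).[t]).
Proof.
set zeta := _ - _; have [->|z0] := eqVneq zeta 0; first exact: vge0.
have z1 : vge v 1 zeta.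
  apply: (vgeB val_v); first by case: v_at.
  by apply: (@vge_t eta 1); rewrite expr1 dvdX_coef0 eta0.
have Az : (map_poly iota A).[zeta] = - (map_poly iota (A^:P.[eta] - shifted_pow x0)).[t].
  rewrite /zeta !(linpolyB n a pcharK) curve_eq -horner_linpoly_comp.
  rewrite (horner_map iota) /= xy0 rmorphB hornerD hornerN horner_shifted_pow rmorphXn /=.
  by ring.
have vz : 0 < v zeta by move: z1; rewrite vgeE //; lia.
have A_low i : (i < 1)%N -> A`_i = 0.
  by rewrite ltnS leqn0 => /eqP->; exact: coef_linpoly0 pcharK.
have A1 : A`_1 != 0 by rewrite coef_linpoly1 ?pcharK ?a0_neq0.
have [Az0 vA] := val_horner_pos val_v z0 vz A_low A1.
rewrite vgeE // -[v zeta]mulr1n -vA -vgeE // Az (vgeN val_v) // vge_t //.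
Qed.

(** Replacing y by its truncated expansion changes the value of P by terms of order at least N >=
    k. *)
Lemma jet k P : (k <= N)%N -> vge v k%:Z (phi P) ->
  'X^k %| ev2 polyC ('X + x0%:P) (eta + y0%:P) P.
Proof.
move=> kN vP; set r := ev2 _ _ _ P.
have t0 : t != 0 by exact: t_neq0.
apply: (vge_horner_dvd val_v t0 (val_at_t xy0 v_at)).
have er : (map_poly iota r).[t] = ev2 iota x ((map_poly iota eta).[t] + iota y0) P.
  rewrite /r -[LHS]/((horner_eval t \o map_poly iota) _) ev2_comp.
  rewrite (@eq_ev2 _ _ _ iota) => [|c] /=; last by rewrite map_polyC /horner_eval hornerC.
  rewrite /horner_eval map_polyXaddC hornerD hornerX hornerC subrK.
  by rewrite rmorphD /= (map_polyC iota y0) hornerD hornerC.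
have -> : (map_poly iota r).[t] = phi P - (phi P - (map_poly iota r).[t]).
  by rewrite subKr.
rewrite (vgeB val_v) // er; apply: (vge_horner_diff val_v).
- move=> i; rewrite coef_map_id0 ?rmorph0 ?horner0 // -phiC; exact: (vge0_phi v_at).
- by rewrite -(ev2Y iota x y) (vge0_phi v_at).
- rewrite (vgeD val_v) ?(vge_iota val_v) // (vge0_horner val_v) //.
  by case: v_at => _ /(vgeW _)->.
- apply: (@vgeW _ _ N%:Z); first by rewrite lez_nat.
  by rewrite opprD addrA addrAC vge_expansion.
Qed.

End LocalExpansion.

(** Modulo X the series eta disappears and P(0, Y) has more roots than its degree allows, so X
    divides P; induct on k. *)
Lemma dvdXn_vanishing (rs : seq K) (eta : {poly K}) k P :
  uniq rs -> (size P <= size rs)%N -> eta`_0 = 0 ->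
  (forall b, b \in rs -> 'X^k %| P.[eta + b%:P]) -> forall j, 'X^k %| P`_j.
Proof.
move=> u_rs sP eta0; elim: k P sP => [|k IH] P sP rootP j; first exact: dvd1p.
have [P1 eP1 sP1] : exists2 P1 : {poly {poly K}},
    P = ('X - 0%:P)%:P * P1 & (size P1 <= size P)%N.
  apply: poly2_dvd_XsubC; apply/eqP; apply: contraTT (leqnn (size rs)) => P0.
  rewrite -ltnNge; apply: leq_trans (leq_trans (size_poly _ _) sP).
  apply: max_poly_roots P0 _ u_rs; apply/allP => b /rootP/dvdXn_coef/(_ 0%N isT) e.
  have : horner_eval 0 P.[eta + b%:P] = 0 by rewrite /horner_eval horner_coef0.
  rewrite -horner_map /= [horner_eval 0 (eta + _)]/horner_eval hornerD hornerC horner_coef0.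
  by rewrite eta0 add0r /root => ->.
rewrite eP1 coefCM subr0 exprS dvdp_mul ?IH ?(leq_trans sP1) // => b /rootP.
by rewrite eP1 hornerM hornerC subr0 exprS dvdp_mul2l // polyX_eq0.
Qed.

(** * Functions whose only pole is one affine point *)

(** The shape of s x and s y when the automorphism s moves infinity to (x0, y0). *)
Definition pole_at (x0 y0 : K) (k : nat) (z : F) := [/\ z != 0,
  forall x1 y1 v, on_curve x1 y1 -> at_point x1 y1 v -> (x1, y1) <> (x0, y0) -> vge v 0 z,
  forall v, at_point x0 y0 v -> v z = - k%:Z & vge vinf 0 z].

Lemma horner_linpolyD u w : A.[u + w] = A.[u] + A.[w].
Proof. by have := linpolyD n a pcharK idfun u w; rewrite !map_poly_id. Qed.

Section PoleExpansion.
Variables (x0 y0 : K) (k N : nat) (z : F) (eta : {poly K}).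
Hypotheses (xy0 : on_curve x0 y0) (k_gt0 : (0 < k)%N) (kN : (k <= N)%N).
Hypotheses (z_pole : pole_at x0 y0 k z).
Hypotheses (eta0 : eta`_0 = 0) (etaN : 'X^N %| A^:P.[eta] - shifted_pow x0).
Notation t := (x - iota x0).

Lemma pole_cleared : exists2 P : {poly {poly K}}, (size P <= q)%N & t ^+ k * z = phi P.
Proof.
have [z0 zreg zpole _] := z_pole; apply: regular_reduced => x1 y1 v xy1 v_at.
have val_v : valuation iota v by case: v_at.
have t0 := t_neq0 x0.
have [e|ne] := EM ((x1, y1) = (x0, y0)).
  move: xy1 v_at; case: e => -> -> xy1 v_at.
  rewrite vgeE ?mulf_neq0 ?expf_neq0 // (valM val_v) ?expf_neq0 // (valX val_v) //.
  by rewrite (val_at_t xy1 v_at) (zpole v v_at) natz subrr.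
rewrite -[0]addr0 (vgeM val_v) ?(zreg _ _ _ xy1 v_at ne) // -(mul0rn _ k) (vgeX val_v) //.
by rewrite -phi_t (vge0_phi v_at).
Qed.

(* Clearing the pole with (x - x0)^k gives a polynomial which vanishes to
   order k at the q - 1 other points over x0; so, modulo T^k, it is c(T) times
   (A(Y) - A(eta)) / (Y - eta). *)
Lemma pole_expansion : exists (P : {poly {poly K}}) (c : {poly K}),
  [/\ wt_le q m (k * q) P, t ^+ k * z = ev2 iota t (y - iota y0) P, c`_0 != 0,
      P`_q.-1 = a n *: c &
      forall j, (0 < j)%N -> 'X^k %| P`_j.-1 - eta * P`_j - A`_j *: c].
Proof.
have [z0 zreg zpole zinf] := z_pole; have [P0 sP0 eP0] := pole_cleared.
have t0 := t_neq0 x0.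
have P00 : P0 != 0.
  by apply: contraNneq z0 => P00; move/eqP: eP0; rewrite P00 ev20 mulf_eq0 expf_eq0 (negPf t0) andbF.
have wP0 : wt_le q m (k * q) P0.
  apply: (@wt_leW _ _ _ (rdeg P0)) (wt_rdeg sP0).
  have : vge vinf (- q%:Z *+ k + 0) (t ^+ k * z).
    apply: (vgeM vinf_valuation) zinf; apply: (vgeX vinf_valuation).
    apply: (vgeB vinf_valuation); first by rewrite vgeE ?x_neq0 // vinf_x.
    by apply: vgeW (vge_iota vinf_valuation x0); rewrite oppr_le0.
  by rewrite eP0 vgeE ?phi_neq0 // vinf_phi //; lia.
pose P := ev2 (polyCC K) ('X + x0%:P)%:P ('X + y0%:P%:P) P0.
have wP : wt_le q m (k * q) P by exact: wt_le_shift.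
have sP : (size P <= q)%N.
  (* With weights 0 and 1 the weighted degree is the Y-degree, so [wt_le_shift] also bounds the
     Y-degree of P. *)
  have w1 : wt_le 0 1 q.-1 P0.
    move=> i j Pij; rewrite muln0 add0n muln1.
    have : (j < size P0)%N by apply: coef_neq0_ltn; apply: contraNneq Pij => ->; rewrite coef0.
    by move=> h; have := leq_trans h sP0; lia.
  apply/leq_sizeP => j qj; apply/polyP => i; rewrite coef0; apply: contraTeq qj.
  by move=> /(wt_le_shift w1); rewrite muln0 muln1 -ltnNge; have := q_gt0; lia.
have PE : ev2 iota t (y - iota y0) P = phi P0.
  rewrite /P ev2_subst.
  by rewrite ev2C map_polyXaddC hornerD hornerX hornerC subrK ev2D ev2Y ev2CC subrK.
have Pb b : P.[eta + b%:P] = ev2 polyC ('X + x0%:P) (eta + (y0 + b)%:P) P0.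
  rewrite -[LHS]/(horner_eval (eta + b%:P) P) /P ev2_comp.
  rewrite (@eq_ev2 _ _ _ polyC) => [|c] /=; last by rewrite /horner_eval hornerC.
  by rewrite /horner_eval hornerC hornerD hornerX hornerC -addrA -polyCD [b + y0]addrC.
(* This c cancels the terms in Y^q of M below. At Y = eta + b with A(b) = 0, M takes the value b
   P(eta + b), which is 0 for b = 0 and divisible by T^k otherwise, because z is regular at (x0, y0
   + b). These q roots b make T^k divide M. *)
pose c := (a n)^-1 *: P`_q.-1.
have cE : P`_q.-1 = a n *: c by rewrite scalerA divff ?scale1r ?an_neq0.
pose M := ('X - eta%:P) * P - c%:P * (A^:P - (A^:P.[eta])%:P).
have coef_M j : (0 < j)%N -> M`_j = P`_j.-1 - eta * P`_j - A`_j *: c.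
  case: j => // j _; rewrite coefB mulrBl coefB coefXM coefCM coefCM coefB coefC subr0.
  by rewrite coef_map /= [c * _]mulrC mul_polyC.
have sM : (size M <= q)%N.
  apply/leq_sizeP => j qj; rewrite coef_M ?(leq_trans q_gt0) //.
  rewrite [in eta * _]nth_default ?(leq_trans sP) // mulr0 subr0.
  move: qj; rewrite leq_eqVlt => /orP[/eqP<-|qj].
    by rewrite cE (coef_linpoly_pow a pcharK) // subrr.
  rewrite !nth_default ?scale0r ?subrr ?(size_linpoly pcharK an_neq0) //.
  by rewrite (leq_trans sP) //; lia.
have [rs [u_rs s_rs rsP]] := fiber_roots 0.
have dvdM : forall j, 'X^k %| M`_j.
  apply: (dvdXn_vanishing u_rs _ eta0); first by rewrite s_rs.
  move=> b; rewrite rsP => /eqP Ab.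
  have -> : M.[eta + b%:P] = b%:P * P.[eta + b%:P].
    rewrite hornerD hornerN !hornerM hornerXsubC hornerC addrAC subrr add0r.
    rewrite hornerD hornerN hornerC (linpolyD n a pcharK) addrAC subrr add0r.
    by rewrite (horner_map polyC) /= Ab mulr0 subr0.
  have [->|b0] := eqVneq b 0; first by rewrite mul0r dvdp0.
  rewrite dvdp_mull // Pb.
  have xyb : on_curve x0 (y0 + b) by rewrite /on_curve horner_linpolyD Ab addr0.
  have [v v_at] := point_exists xyb; have val_v : valuation iota v by case: v_at.
  apply: (jet xyb v_at eta0 etaN kN); rewrite -eP0 -[k%:Z]addr0 (vgeM val_v) //.
    by rewrite -natz (vgeX val_v) // vgeE // (val_at_t xyb v_at).
  apply: (zreg _ _ _ xyb v_at) => -[/eqP]; rewrite -subr_eq0 addrAC subrr add0r.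
  by rewrite (negPf b0).
have recP j : (0 < j)%N -> 'X^k %| P`_j.-1 - eta * P`_j - A`_j *: c.
  by move=> j0; rewrite -coef_M.
exists P, c; split=> //; first by rewrite PE.
(* If c(0) were 0, the case j = 1 of the recurrence would make P0 vanish at (x0, y0), and the pole
   of z would have order less than k. *)
have P000 : P`_0`_0 = ev x0 y0 P0.
  rewrite -!horner_coef0 -[LHS]/((horner_eval 0 \o horner_eval 0) P) /P ev2_comp.
  rewrite (@eq_ev2 _ _ _ idfun) => [|d] /=; last by rewrite /horner_eval !hornerC.
  by rewrite /horner_eval !hornerE.
have [v v_at] := point_exists xy0; have val_v : valuation iota v by case: v_at.
have := dvdXn_coef (recP 1%N isT) k_gt0.
rewrite !coefB coefM coefZ big_ord_recl big_ord0 /= eta0 mul0r addr0 subr0 P000.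
rewrite (coef_linpoly1 n a pcharK) => /eqP; apply: contraTneq => ->.
rewrite mulr0 subr0; apply/negP => /eqP e0.
have := vge1_phi v_at e0; rewrite -eP0 vgeE ?mulf_neq0 ?expf_neq0 //.
by rewrite (valM val_v) ?expf_neq0 // (valX val_v) // (val_at_t xy0 v_at) (zpole v v_at) natz subrr.
Qed.

End PoleExpansion.

Lemma shifted_pow_coef0 x0 : (shifted_pow x0)`_0 = 0.
Proof. by rewrite -horner_coef0 /shifted_pow !hornerE subrr. Qed.

Lemma shifted_pow_coef1 x0 : (shifted_pow x0)`_1 = m%:R * x0 ^+ m.-1.
Proof.
have -> : (shifted_pow x0)`_1 = (shifted_pow x0)^`()`_0 by rewrite coef_deriv mulr1n.
rewrite -horner_coef0 /shifted_pow derivB derivC subr0 deriv_exp derivD derivX derivC.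
by rewrite addr0 mul1r hornerMn horner_exp !hornerE mulr_natl.
Qed.

Lemma shifted_pow_coefm x0 : (shifted_pow x0)`_m = 1.
Proof.
rewrite /shifted_pow -[in 'X + _](opprK x0) polyCN coefB coefC gtn_eqF ?subr0; last first.
  exact: ltnW m_gt1.
have /monicP : ('X - (- x0)%:P) ^+ m \is monic by rewrite monic_exp ?monicXsubC.
by rewrite lead_coefE size_exp_XsubC.
Qed.

Lemma natm_neq0 : m%:R != 0 :> K.
Proof. by rewrite -(dvdn_pcharf pcharK) p_ndvd_m. Qed.

Lemma dvdp_linpoly (d r : {poly K}) : d %| r -> d %| A^:P.[r].
Proof.
move=> dr; rewrite horner_linpoly.
apply: (big_ind (fun r => d %| r)) => [|u w|j _]; [exact: dvdp0 | exact: dvdp_add |].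
by rewrite dvdp_mull // dvdp_exp // expn_gt0 (ltnW p_gt1).
Qed.

(** * Consequences of moving infinity to an affine point; u and w stand for s x and s y *)

Section AffinePole.
Variables (x0 y0 : K) (u w : F).
Hypotheses (xy0 : on_curve x0 y0) (deg4 : (3 < maxn q m)%N) (m_mod : m != 1 %[mod q]).
Hypotheses (u_pole : pole_at x0 y0 q u) (w_pole : pole_at x0 y0 m w).
Notation t := (x - iota x0).

(** The nonzero constant term of P_(q-1) gives (q - 1)m <= q^2. If m > q, the congruence condition
    and coprimality give m >= q + 2 and q > 2, but then (q - 1)(q + 2) > q^2. *)
Lemma affine_pole_ltn : (m < q)%N.
Proof.
have [eta [eta0 etaN]] := expansion_exists x0 q.
have [P [c [wP _ c0 cE _]]] := pole_expansion xy0 q_gt0 (leqnn q) u_pole eta0 etaN.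
have Pq : P`_q.-1`_0 != 0 by rewrite cE coefZ mulf_neq0 ?an_neq0.
have := wP _ _ Pq; rewrite mul0n add0n => wq.
rewrite ltnNge leq_eqVlt; apply/negP => /orP[/eqP qm|qm].
  by have := coprime_qm; rewrite -qm /coprime gcdnn => /eqP q1; have := q_gt1; rewrite q1.
have m_q1 : m != q.+1.
  by apply: contraNneq m_mod => ->; rewrite -addn1 -[q in (q + 1)%N]mul1n modnMDl.
have q2 : (2 < q)%N.
  rewrite ltn_neqAle q_gt1 andbT; apply: contraNneq m_mod => q2.
  have : coprime q m := coprime_qm; rewrite -q2 coprime2n => om.
  by rewrite modn2 om.
have : (q.-1 * q.+2 <= q.-1 * m)%N by rewrite leq_mul2l; lia.
by move: wq q2; clear; move: (q) => Q; nia.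
Qed.

(** For (x - x0)^m w the weight is at most mq, so P_(q-1) is constant and P_(q-2) has degree at most
    1 in T, while the recurrence makes P_(q-2) congruent to eta P_(q-1) modulo T^m. So eta is eta_1
    T modulo T^m; then eta_1 = 0 is forced, whence x0 = 0 and P is c_0 A(Y)/Y plus a multiple of
    X^m. *)
Lemma affine_pole_form : x0 = 0 /\ exists c0 c1 : K, c0 != 0 /\
  (y - iota y0) * w = iota c0 + iota c1 * (y - iota y0).
Proof.
have mq := affine_pole_ltn; have [eta [eta0 etaN]] := expansion_exists x0 q.
have [P [c [wP eP c0 cE recP]]] :=
  pole_expansion xy0 (ltnW m_gt1) (ltnW mq) w_pole eta0 etaN.
have q2 : (2 < q)%N by have := m_gt1; lia.
have q1 : (0 < q.-1)%N by lia.
have qS : q.-1.+1 = q by lia.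
have m1 := m_gt1.
have cC i : (0 < i)%N -> c`_i = 0.
  move=> i0; apply/eqP; apply: contraTT i0 => ci.
  have : P`_q.-1`_i != 0 by rewrite cE coefZ mulf_neq0 ?an_neq0.
  by move=> /wP /(weight_le0 mq) ->.
have Aq1 : A`_q.-1 = 0 by exact: (coef_linpoly_pred a pcharK q2).
have cCE : c = (c`_0)%:P.
  by apply/polyP => -[|i]; rewrite coefC // cC.
have eta_mid i : (1 < i < m)%N -> eta`_i = 0.
  move=> /andP[i1 im]; apply/eqP; apply: contraTT i1 => ei.
  have := dvdXn_coef (recP _ q1) im; rewrite Aq1 scale0r subr0 coefB cE cCE -mul_polyC.
  rewrite -polyCM coefMC => /eqP; rewrite subr_eq0 => /eqP Pi.
  have : P`_q.-1.-1`_i != 0 by rewrite Pi !mulf_neq0 ?an_neq0.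
  by move=> /wP /(weight_le1 mq); rewrite -leqNgt.
(* Descending the recurrence produces the monomials T^r Y^(q-1-r); the one with r = m - 1 tests the
   weight bound. *)
have Pr r : (r < m)%N -> P`_(q.-1 - r)`_r = a n * c`_0 * eta`_1 ^+ r.
  elim: r => [|r IH] rm; first by rewrite subn0 cE coefZ expr0 mulr1.
  have jr : (0 < q.-1 - r)%N by lia.
  have := dvdXn_coef (recP _ jr) rm; rewrite !coefB coefZ (cC r.+1 isT) mulr0 subr0 -subnS => /eqP.
  rewrite subr_eq0 => /eqP->; rewrite coefM big_ord_recl eta0 mul0r add0r.
  rewrite big_ord_recl /= subn1 /= IH ?(ltnW rm) // exprS mulrCA big1 ?addr0 // => i _.
  by rewrite eta_mid ?mul0r //= /bump /=; have := ltn_ord i; lia.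
have eta1 : eta`_1 = 0.
  apply/eqP; apply: contraT => e1.
  have mm : (m.-1 < m)%N by lia.
  have : P`_(q.-1 - m.-1)`_m.-1 != 0.
    by rewrite Pr // !mulf_neq0 ?an_neq0 ?expf_neq0.
  move=> /wP wm.
  (* The surviving case q = m + 1, where degree at least 4 gives m >= 3, is excluded by the pole of
     order q of u: its recurrence yields eta_m = 0, so eta is eta_1 T modulo T^q. Then A(eta) has no
     term in T^m, as p does not divide m, whereas [shifted_pow x0] has coefficient 1 there. *)
  have qm1 : q = m.+1. by apply: weight_coprime wm; rewrite ?coprime_qm ?m_gt1.
  have m3 : (2 < m)%N by move: deg4; rewrite qm1; lia.
  have [P' [c' [wP' _ c'0 cE' recP']]] :=
    pole_expansion xy0 q_gt0 (leqnn q) u_pole eta0 etaN.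
  have c'C i : (1 < i)%N -> c'`_i = 0.
    move=> i1; apply/eqP; apply: contraTT i1 => ci.
    have : P'`_q.-1`_i != 0 by rewrite cE' coefZ mulf_neq0 ?an_neq0.
    by move=> /wP'; rewrite qm1 /= -leqNgt; clear; nia.
  have P'm : P'`_q.-1.-1`_m = 0.
    apply/eqP; apply: contraT => /wP'; rewrite qm1 /=; move: m3; clear; nia.
  have eta_m : eta`_m = 0.
    have := dvdXn_coef (recP' _ q1) mq; rewrite Aq1 scale0r subr0 coefB P'm cE' -scalerAr coefZ sub0r.
    move/eqP; rewrite oppr_eq0 mulf_eq0 (negPf an_neq0) /= coefM big_ord_recr /= subnn.
    rewrite big1 ?add0r => [|i _]; first by rewrite mulf_eq0 (negPf c'0) orbF => /eqP.
    have [->|i0] := posnP i; first by rewrite eta0 mul0r.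
    have im := ltn_ord i.
    have [i1|i1] := ltnP 1 i; first by rewrite eta_mid ?mul0r // i1.
    by rewrite c'C ?mulr0 //; lia.
  have := dvdXn_coef etaN mq; rewrite coefB shifted_pow_coefm => /eqP.
  have [r er] : exists r, eta = eta`_1 *: 'X + 'X^q * r.
    exists (drop_poly q eta); rewrite -[LHS](poly_take_drop q) mulrC; congr (_ + _).
    apply/polyP => i; rewrite coef_take_poly coefZ coefX.
    have [iq|qi] := ltnP i q; last by rewrite (_ : (i == 1)%N = false) ?mulr0 //; lia.
    case: i iq => [|[|i]] iq; rewrite ?mulr0 ?mulr1 //.
    have [<-//|im] := eqVneq m i.+2; rewrite eta_mid //.
    by move: iq; rewrite qm1; lia.
  rewrite [in A^:P.[_]]er (linpolyD n a pcharK) coefD.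
  have -> : (A^:P.['X^q * r])`_m = 0.
    by apply: (@dvdXn_coef q) mq; rewrite dvdp_linpoly ?dvdp_mulr.
  rewrite addr0 horner_linpoly coef_sum big1 ?sub0r ?oppr_eq0 ?oner_eq0 // => j _.
  rewrite mul_polyC coefZ exprZn coefZ coefXn (_ : m == _ = false) ?mulr0 //.
  apply/negbTE; case: (nat_of_ord j) => [|l]; first by rewrite expn0; lia.
  by apply: contraNneq p_ndvd_m => ->; rewrite expnS dvdn_mulr.
have eta_low i : (i < m)%N -> eta`_i = 0.
  by case: i => [|[|i]] im //; apply: eta_mid; rewrite im.
(* The series eta has order at least 2, hence so has A(eta), but the linear coefficient of
   [shifted_pow x0] is m x0^(m-1). *)
have x00 : x0 = 0.
  have d2 : 'X^2 %| eta.
    apply/dvdpP; exists (drop_poly 2 eta); rewrite -[LHS](poly_take_drop 2).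
    rewrite [take_poly 2 eta](_ : _ = 0) ?add0r //; apply/polyP => i.
    by rewrite coef_take_poly coef0; case: i => [|[|i]].
  have := dvdXn_coef etaN (ltn_trans m1 mq).
  rewrite coefB (dvdXn_coef (dvdp_linpoly d2)) // sub0r shifted_pow_coef1.
  move/eqP; rewrite oppr_eq0 mulf_eq0 (negPf natm_neq0) expf_eq0 /=.
  by case/andP => _ /eqP.
split=> //.
have etaM (Q : {poly K}) i : (i < m)%N -> (eta * Q)`_i = 0.
  move=> im; rewrite coefM big1 // => l _; rewrite eta_low ?mul0r //.
  by have := ltn_ord l; lia.
(* Below T^m the recurrence reads P_j = c_0 A_(j+1), because eta vanishes there; from T^m on, weight
   at most mq leaves only the monomial X^m. *)
have [kap PE] : exists kap, P = (c`_0)%:P *: (\poly_(j < q) A`_j.+1)^:P + (kap *: 'X^m)%:P.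
  exists P`_0`_m.
  apply/polyP => j; apply/polyP => i; rewrite coefD coefZ coef_map coefD -polyCM coefC coefC.
  rewrite coef_poly; have [im|mi] := ltnP i m.
    have := dvdXn_coef (recP _ (ltn0Sn j)) im; rewrite !coefB etaM // coefZ subr0.
    move/eqP; rewrite subr_eq0 => /eqP->; rewrite [in c`_i]cCE coefC.
    have -> : (if j == 0%N then P`_0`_m *: 'X^m else 0)`_i = 0.
      case: ifP; rewrite ?coef0 // coefZ coefXn (_ : i == m = false) ?mulr0 //; lia.
    rewrite addr0; have [jq|qj] := ltnP j q.
      by case: ifP; rewrite ?mulr0 // mulrC.
    rewrite nth_default ?mul0r ?mulr0 ?if_same // (size_linpoly pcharK an_neq0).
    by rewrite ltnS.
  have -> : (i == 0%N) = false by lia.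
  rewrite add0r; have [Pij|Pij] := eqVneq P`_j`_i 0.
    rewrite Pij; case: eqP Pij => [->|] Pij; last by rewrite coef0.
    by rewrite coefZ coefXn; case: eqP Pij => [->->|]; rewrite ?mul0r ?mulr0.
  have ij := wP _ _ Pij; have j0 : j = 0 by move: ij mi m1; clear; move: (q) => Q; nia.
  have im : i = m by move: ij mi mq; rewrite j0; clear; move: (q) => Q; nia.
  by rewrite j0 im coefZ coefXn eqxx mulr1.
have Yw : (y - iota y0) * ev2 iota t (y - iota y0) P =
    iota c`_0 * x ^+ m + iota kap * x ^+ m * (y - iota y0).
  rewrite PE ev2D -(mul_polyC (c`_0)%:P) ev2M ev2CC ev2_lift ev2C linearZ /= map_polyXn hornerZ hornerXn.
  rewrite x00 rmorph0 subr0 mulrDr; congr (_ + _); last by rewrite mulrC.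
  rewrite mulrCA; congr (_ * _).
  have AX : \poly_(j < q) A`_j.+1 * 'X = A.
    apply/polyP => -[|j]; rewrite coefMX ?(coef_linpoly0 n a pcharK) //=.
    rewrite coef_poly; case: ltnP => // qj.
    by rewrite nth_default // (size_linpoly pcharK an_neq0) ltnS.
  transitivity (map_poly iota A).[y - iota y0].
    by rewrite -[in RHS]AX rmorphM /= map_polyX hornerMX mulrC.
  rewrite (linpolyB n a pcharK) curve_eq (horner_map iota) /= xy0 x00.
  by rewrite expr0n gtn_eqF ?rmorph0 ?subr0 // ltnW.
exists c`_0, kap; split=> //.
have xm : x ^+ m != 0 by rewrite expf_neq0 ?x_neq0.
have eP' : x ^+ m * w = ev2 iota t (y - iota y0) P.
  by rewrite -eP x00 rmorph0 subr0.
by apply: (mulfI xm); rewrite mulrCA eP' Yw; ring.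
Qed.

End AffinePole.

(** * The exceptional case: s y is a fractional linear function of y *)

Lemma mulrn_neq1 (e : int) (k : nat) : (1 < k)%N -> e *+ k != 1.
Proof.
move=> k1; apply/eqP; case: e => e h; last first.
  by have : Negz e *+ k <= 0; [rewrite mulrn_wle0 | rewrite h].
by move: h; rewrite -mulr_natr natz -PoszM => -[] /eqP; rewrite muln_eq1; lia.
Qed.

(** For x1 nonzero, A(y - y1) = x^m - x1^m has a simple zero at the point, and the linear term of A
    is nonzero. *)
Lemma val_sub_y x1 y1 v : on_curve x1 y1 -> at_point x1 y1 v -> x1 != 0 ->
  y - iota y1 != 0 /\ v (y - iota y1) = 1.
Proof.
move=> xy1 v_at x10; have val_v : valuation iota v by case: v_at.
have t0 := t_neq0 x1; have vt := val_at_t xy1 v_at.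
have S_low i : (i < 1)%N -> (shifted_pow x1)`_i = 0.
  by rewrite ltnS leqn0 => /eqP->; exact: shifted_pow_coef0.
have S1 : (shifted_pow x1)`_1 != 0.
  by rewrite shifted_pow_coef1 mulf_neq0 ?natm_neq0 ?expf_neq0.
have vt0 : 0 < v (x - iota x1) by rewrite vt.
have [] := val_horner_pos val_v t0 vt0 S_low S1.
rewrite horner_shifted_pow -curve_eq -rmorphXn -xy1 -(horner_map iota) /=.
rewrite -(linpolyB n a pcharK) vt mulr1n => A0 vA.
have y0 : y - iota y1 != 0.
  by apply: contraNneq A0 => ->; rewrite (linpoly0 n a pcharK).
have A_low i : (i < 1)%N -> A`_i = 0.
  by rewrite ltnS leqn0 => /eqP->; exact: coef_linpoly0 pcharK.
have A1 : A`_1 != 0 by rewrite (coef_linpoly1 n a pcharK) a0_neq0.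
have vy0 : 0 < v (y - iota y1) by have [_ _] := v_at; rewrite vgeE //; lia.
by split=> //; rewrite -vA (val_horner_pos val_v y0 vy0 A_low A1).2 mulr1n.
Qed.

Section InversePole.
Variables (y0 c0 c1 : K) (u w : F).
Hypotheses (Ay0 : A.[y0] = 0) (c0_neq0 : c0 != 0) (u_neq0 : u != 0).
Hypothesis w_form : (y - iota y0) * w = iota c0 + iota c1 * (y - iota y0).
Hypothesis uw_eq : (map_poly iota A).[w] = u ^+ m.
Notation yy := (y - iota y0).

Lemma horner_linpolyB b d : A.[b - d] = A.[b] - A.[d].
Proof. by have := linpolyB n a pcharK idfun b d; rewrite !map_poly_id. Qed.

Lemma A_horner0 : A.[0] = 0.
Proof. by have := linpoly0 n a pcharK idfun; rewrite !map_poly_id. Qed.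

Lemma sub_y0_neq0 : yy != 0.
Proof.
apply: contraNneq c0_neq0 => e; move/eqP: w_form.
by rewrite e mul0r mulr0 addr0 eq_sym fmorph_eq0.
Qed.

Lemma wE : w = iota c0 / yy + iota c1.
Proof.
by apply: (mulfI sub_y0_neq0); rewrite w_form; field; exact: sub_y0_neq0.
Qed.

(** Let b = c0/(r - c1). Were A(b) nonzero, a point of the curve with y = y0 + b would have x
    nonzero, so y - y0 - b and hence w - r would have a simple zero there. Then A(w) = A(w - r)
    would have valuation 1, but A(w) = u^m has valuation divisible by m > 1. *)
Lemma root_inverse r : A.[r] = 0 -> r != c1 -> A.[c0 / (r - c1)] = 0.
Proof.
rewrite -subr_eq0 => Ar rc; set b := c0 / _; apply/eqP; apply: contraT => Ab.
have b0 : b != 0 by rewrite mulf_neq0 ?invr_neq0.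
have /closed_rootP[x1] : size ('X^m - (A.[b])%:P) != 1%N.
  by rewrite size_XnsubC ?(ltnW m_gt1) // eqSS -lt0n ltnW ?m_gt1.
rewrite /root !hornerE subr_eq0 => /eqP x1m.
have xy1 : on_curve x1 (y0 + b) by rewrite /on_curve horner_linpolyD Ay0 add0r x1m.
have x10 : x1 != 0.
  by apply: contraNneq Ab => x10; rewrite -x1m x10 expr0n gtn_eqF // ltnW ?m_gt1.
have [v v_at] := point_exists xy1; have val_v : valuation iota v by case: v_at.
have [yb0 vyb] := val_sub_y xy1 v_at x10.
have ib0 : iota b != 0 by rewrite fmorph_eq0.
have yyE : yy = iota b + (y - iota (y0 + b)) by rewrite rmorphD /=; ring.
have vyy : v yy = 0.
  have vb : vge v (v (iota b) + 1) (y - iota (y0 + b)).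
    by rewrite (val_iota val_v) // vgeE // vyb.
  by have [_] := val_dom val_v ib0 vb; rewrite -yyE (val_iota val_v).
have wr : w - iota r = iota (c1 - r) / yy * (y - iota (y0 + b)).
  have irc : iota (r - c1) != 0 by rewrite fmorph_eq0.
  have -> : y - iota (y0 + b) = yy - iota c0 / iota (r - c1).
    by rewrite -fmorph_div rmorphD opprD addrA.
  have -> : w - iota r = iota c0 / yy - iota (r - c1) by rewrite wE rmorphB; ring.
  rewrite -(opprB r c1) rmorphN /=; move: (iota (r - c1)) irc => R R0.
  by field; rewrite sub_y0_neq0 R0.
have icr : iota (c1 - r) != 0 by rewrite fmorph_eq0 -(opprB r c1) oppr_eq0.
have s0 : iota (c1 - r) / yy != 0 by rewrite mulf_neq0 ?invr_neq0 ?sub_y0_neq0.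
have wr0 : w - iota r != 0 by rewrite wr mulf_neq0.
have vwr : v (w - iota r) = 1.
  rewrite wr (valM val_v) // vyb (val_div val_v) ?sub_y0_neq0 // vyy subr0.
  by rewrite (val_iota val_v) // -(opprB r c1) oppr_eq0.
have A_low i : (i < 1)%N -> A`_i = 0.
  by rewrite ltnS leqn0 => /eqP->; exact: coef_linpoly0 pcharK.
have A1 : A`_1 != 0 by rewrite (coef_linpoly1 n a pcharK) a0_neq0.
have vwr0 : 0 < v (w - iota r) by rewrite vwr.
have [_] := val_horner_pos val_v wr0 vwr0 A_low A1.
rewrite (linpolyB n a pcharK) uw_eq (horner_map iota) /= Ar rmorph0 subr0 vwr mulr1n.
by rewrite (valX val_v) // => /eqP; rewrite (negPf (mulrn_neq1 _ m_gt1)).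
Qed.

(** Otherwise r -> c0/(r - c1) would inject the q roots of A into its q - 1 nonzero roots. *)
Lemma A_c1 : A.[c1] = 0.
Proof.
apply/eqP; apply: contraT => Ac1; have [rs [u_rs s_rs rsP]] := fiber_roots 0.
pose f r := c0 / (r - c1).
have f_inj : {in rs &, injective f}.
  move=> r s _ _ /(mulfI c0_neq0)/invr_inj/eqP; rewrite -subr_eq0 opprB addrA subrK.
  by rewrite subr_eq0 => /eqP.
have f_rs : {subset map f rs <= rem 0 rs}.
  move=> b /mapP[r]; rewrite rsP => /eqP Ar ->.
  have rc : r != c1 by apply: contraNneq Ac1 => <-; rewrite Ar.
  rewrite mem_rem_uniq // inE mulf_neq0 ?invr_neq0 ?subr_eq0 //= rsP.
  by apply/eqP; exact: root_inverse.
have uf : uniq (map f rs) by rewrite map_inj_in_uniq.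
have := uniq_leq_size uf f_rs; rewrite size_map size_rem ?rsP ?A_horner0 // s_rs.
by have := q_gt0; lia.
Qed.

(** As c1 is a root and the roots form a group, r -> c0/r preserves the nonzero roots of A. So D =
    A/Y and its reversal Dr = Y^(q-1) D(c0/Y) share q - 1 distinct roots and are proportional, with
    ratio read off from the leading coefficients. *)
Lemma coef_symmetric i : (i < q)%N ->
  a n * (A`_i.+1 * c0 ^+ i) = a 0 * A`_(q - i).
Proof.
have [rs [u_rs s_rs rsP]] := fiber_roots 0.
pose D : {poly K} := \poly_(i < q) A`_i.+1.
pose Dr : {poly K} := \poly_(i < q) (D`_(q.-1 - i) * c0 ^+ (q.-1 - i)).
have DX : D * 'X = A.
  apply/polyP => -[|j]; rewrite coefMX ?(coef_linpoly0 n a pcharK) //=.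
  rewrite coef_poly; case: ltnP => // qj.
  by rewrite nth_default // (size_linpoly pcharK an_neq0) ltnS.
have D_root r : A.[r] = 0 -> r != 0 -> D.[r] = 0.
  rewrite -DX hornerMX => /eqP; rewrite mulf_eq0 => /orP[/eqP//|/eqP->].
  by rewrite eqxx.
have Dr_root r : A.[r] = 0 -> r != 0 -> Dr.[r] = 0.
  move=> Ar r0; have : D.[c0 / r] = 0.
    apply: D_root; last by rewrite mulf_neq0 ?invr_neq0.
    have := @root_inverse (r + c1); rewrite addrK; apply.
      by rewrite horner_linpolyD Ar A_c1 addr0.
    by rewrite -subr_eq0 addrK.
  move=> D0; have -> : Dr.[r] = r ^+ q.-1 * D.[c0 / r]; last by rewrite D0 mulr0.
  rewrite (horner_coef_wide _ (size_poly _ _)) [D.[_]](horner_coef_wide _ (size_poly _ _)).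
  rewrite mulr_sumr (reindex_inj rev_ord_inj) /=; apply: eq_bigr => j _.
  have jq := ltn_ord j; rewrite coef_poly (_ : (q - j.+1 < q)%N); last by have := q_gt0; lia.
  have -> : (q.-1 - (q - j.+1) = j)%N by lia.
  rewrite expr_div_n mulrCA -mulrA; congr (_ * _); rewrite mulrCA; congr (_ * _).
  have -> : (q.-1 = (q - j.+1) + j)%N by lia.
  by rewrite exprD mulfK // expf_neq0.
have Deg : a n *: Dr - a 0 *: D = 0.
  apply: (@roots_geq_poly_eq0 _ _ (rem 0 rs)).
  - apply/allP => r; rewrite mem_rem_uniq // inE rsP => /andP[r0 /eqP Ar].
    by rewrite /root !hornerE Dr_root // D_root // !mulr0 subrr.
  - exact: rem_uniq.
  - rewrite size_rem ?rsP ?A_horner0 // s_rs.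
    apply/leq_sizeP => j; rewrite leq_eqVlt => /orP[/eqP<-|qj].
      rewrite coefB !coefZ !coef_poly (_ : (q.-1 < q)%N); last by have := q_gt0; lia.
      rewrite subnn q_gt0 expr0 mulr1 prednK ?q_gt0 // (coef_linpoly_pow a pcharK) //.
      by rewrite (coef_linpoly1 n a pcharK) mulrC subrr.
    by rewrite coefB !coefZ !coef_poly ltnNge (_ : (q <= j)%N) ?mulr0 ?subrr //; lia.
move=> iq; have := congr1 (fun r : {poly K} => r`_(q.-1 - i)) Deg.
rewrite coefB !coefZ !coef_poly coef0.
have -> : (q.-1 - i < q)%N by have := q_gt0; lia.
have -> : (q.-1 - (q.-1 - i) = i)%N by lia.
rewrite iq (_ : (q.-1 - i).+1 = q - i)%N; last by lia.
by move/eqP; rewrite subr_eq0 => /eqP.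
Qed.

(** The symmetry pairs the exponent p^j with q - p^j + 1, which is congruent to 1 modulo p and
    larger than 1, hence no power of p. *)
Lemma inverse_pole_two_terms j : (0 < j < n)%N -> a j = 0.
Proof.
move=> /andP[j0 jn]; have pj : (0 < p ^ j)%N by rewrite expn_gt0 ltnW ?p_gt1.
have pjq : (p ^ j < q)%N by rewrite ltn_exp2l ?p_gt1.
have := @coef_symmetric (p ^ j).-1; rewrite prednK // (coef_linpoly_pow a pcharK) ?(ltnW jn) //.
have -> : A`_(q - (p ^ j).-1) = 0.
  apply: coef_linpoly_npow => -[|l] _; first by rewrite expn0; lia.
  have -> : (q - (p ^ j).-1 = (q - p ^ j).+1)%N by lia.
  apply/eqP => e; have : (p %| (q - p ^ j).+1)%N by rewrite e expnS dvdn_mulr.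
  have pd : (p %| q - p ^ j)%N by rewrite dvdn_sub // dvdn_exp // n_gt0.
  by rewrite -addn1 dvdn_addr // dvdn1; have := p_gt1; lia.
move=> /(_ _)/eqP; rewrite mulr0 !mulf_eq0 (negPf an_neq0) expf_eq0 (negPf c0_neq0) andbF orbF.
by move=> h; apply/eqP/h; lia.
Qed.

(** With A = a_n Y^q + a_0 Y and s y explicit, (x/u)^m is a constant times (y - y0)^(q+1). Hence x/u
    is regular on the affine curve and has pole order exactly q + 1 at infinity, so q + 1 is the
    weight of some monomial. *)
Lemma inverse_pole_dvd : (m %| q + 1)%N.
Proof.
have aF j : (0 < j < n)%N -> a j = 0 by exact: inverse_pole_two_terms.
have AE (z : F) : (map_poly iota A).[z] = iota (a n) * z ^+ q + iota (a 0) * z.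
  rewrite horner_linpoly big_ord_recr /= addrC; congr (_ + _).
  have := n_gt0; case: (n) aF => // n' aF _; rewrite big_ord_recl /= expr1 big1 ?addr0 //.
  by move=> i _; rewrite aF ?rmorph0 ?mul0r //=; have := ltn_ord i; rewrite /bump /=; lia.
have e0 : a n * (a n * c0 ^+ q.-1) = a 0 * a 0.
  have := @coef_symmetric q.-1; rewrite prednK ?q_gt0 // (coef_linpoly_pow a pcharK) //.
  have -> : (q - q.-1 = 1)%N by have := q_gt0; lia.
  by rewrite (coef_linpoly1 n a pcharK); apply.
have y00 := sub_y0_neq0.
have e1 : iota (a n) * u ^+ m * yy ^+ q.+1 = iota (c0 * a 0) * x ^+ m.
  have -> : x ^+ m = (map_poly iota A).[yy].
    by rewrite (linpolyB n a pcharK) curve_eq (horner_map iota) /= Ay0 rmorph0 subr0.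
  rewrite -uw_eq wE (linpolyD n a pcharK) (horner_map iota _ c1) /= A_c1 rmorph0 addr0 !AE.
  move: (congr1 iota e0); rewrite !rmorphM rmorphXn /= => {}e0.
  transitivity (iota c0 * ((iota (a n) * (iota (a n) * iota c0 ^+ q.-1)) * yy +
    iota (a 0) * iota (a n) * yy ^+ q)); last by rewrite e0; ring.
  have qS : q = q.-1.+1 by rewrite prednK ?q_gt0.
  have cq : iota c0 ^+ q = iota c0 * iota c0 ^+ q.-1 by rewrite -exprS -qS.
  rewrite expr_div_n cq [yy ^+ q.+1]exprS; move: (yy ^+ q) (expf_neq0 q y00) => Y Y0.
  by field; rewrite y00 Y0.
have ca0 : iota (c0 * a 0) != 0 by rewrite fmorph_eq0 mulf_neq0 ?a0_neq0.
have ian : iota (a n) != 0 by rewrite fmorph_eq0 an_neq0.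
have g0 : x / u != 0 by rewrite mulf_neq0 ?invr_neq0 ?x_neq0.
have gm : iota (c0 * a 0) * (x / u) ^+ m = iota (a n) * yy ^+ q.+1.
  rewrite expr_div_n mulrA -e1 mulrAC mulfK ?expf_neq0 //.
have vg v : valuation iota v -> v (x / u) *+ m = v yy *+ q.+1.
  move=> val_v; have : v (iota (c0 * a 0) * (x / u) ^+ m) = v (iota (a n) * yy ^+ q.+1).
    by rewrite gm.
  rewrite (valM val_v ca0 (expf_neq0 m g0)) (valM val_v ian (expf_neq0 _ y00)).
  rewrite (valX val_v _ g0) (valX val_v _ y00) (val_iota val_v an_neq0).
  by rewrite (val_iota val_v (mulf_neq0 c0_neq0 a0_neq0)) !add0r.
have [P sP eP] : exists2 P : {poly {poly K}}, (size P <= q)%N & x / u = phi P.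
  apply: regular_reduced => x1 y1 v xy1 v_at; have val_v : valuation iota v by case: v_at.
  have : vge v 0 yy.
    by rewrite -(ev2CC iota x y y0) -[y in y - _](ev2Y iota x y) -ev2B (vge0_phi v_at).
  by rewrite !vgeE // => yy0; rewrite -(pmulrn_lge0 _ (ltnW m_gt1)) vg // mulrn_wge0.
have P0 : P != 0 by apply: contraNneq g0 => P0; rewrite eP P0 ev20.
have vyy : vinf yy = - m%:Z.
  have vy : vge vinf (vinf y + 1) (- iota y0).
    rewrite -rmorphN; apply: vgeW (vge_iota vinf_valuation _); rewrite vinf_y.
    by have := m_gt1; lia.
  by have [_ ->] := val_dom vinf_valuation y_neq0 vy; rewrite vinf_y.
have := vg _ vinf_valuation; rewrite vyy eP vinf_phi // => rP.
have {}rP : rdeg P = q.+1.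
  have m0 : (0 < m)%N := ltnW m_gt1.
  by apply/eqP; rewrite -(eqn_pmul2r m0); apply/eqP; lia.
(* In q + 1 = iq + jm the case i = 1 would give jm = 1, and i >= 2 is too large; so i = 0. *)
have [i [j [_]]] := rdeg_attained sP P0; rewrite rP addn1; case: i => [|[|i]] e.
- by rewrite -e mul0n dvdn_mull.
- have : (j * m = 1)%N by lia.
  by move/eqP; rewrite muln_eq1 => /andP[_ /eqP m1]; have := m_gt1; rewrite m1.
- by have := q_gt1; lia.
Qed.

End InversePole.

(** * Automorphisms fix the place at infinity *)

Lemma point_unique x0 y0 v v' : on_curve x0 y0 -> at_point x0 y0 v ->
  at_point x0 y0 v' -> forall z, z != 0 -> v z = v' z.
Proof.
move=> xy0 v_at v'_at.
have val_v : valuation iota v by case: v_at.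
have val_v' : valuation iota v' by case: v'_at.
have vP P : phi P != 0 -> v (phi P) = v' (phi P).
  move=> P0; have [i [e [d [e0 d0 ed]]]] := ord_exists xy0 P0.
  have t0 := t_neq0 x0.
  suff ord w : at_point x0 y0 w -> w (phi P) = i%:Z by rewrite !ord.
  move=> w_at; have val_w : valuation iota w by case: w_at.
  have [pe0 we] := val_phi0 w_at e0; have [pd0 wd] := val_phi0 w_at d0.
  have : w (phi P * phi d) = w ((x - iota x0) ^+ i * phi e) by rewrite ed.
  rewrite !(valM val_w) ?expf_neq0 // (valX val_w) // we wd !addr0.
  by rewrite (val_at_t xy0 w_at) natz.
move=> z z0; have [P [Q [Q0 ez]]] := frac z.
have P0 : phi P != 0 by apply: contraNneq z0 => P0; rewrite ez P0 mul0r.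
by rewrite ez (val_div val_v) // (val_div val_v') // !vP.
Qed.

Section FixInfinity.
Hypotheses (deg4 : (3 < maxn q m)%N) (m_mod : m != 1 %[mod q]).
Hypothesis not_exc : ~ ((m %| q + 1)%N /\ forall j, (0 < j < n)%N -> a j = 0).
Variable s : kaut iota.
Local Notation si := (kaut_inv s).
Local Notation vp := (vinf \o si).

Let val_vp : valuation iota vp. Proof. exact: valuation_kaut vinf_valuation. Qed.

Let siK z : s (si z) = z. Proof. exact: kaut_invfunK. Qed.
Let sK z : si (s z) = z. Proof. exact: kaut_funK. Qed.

(** The image [vp] of the place at infinity has residue field K by [vinf_residue]; the residues of x
    and y are its coordinates, and they satisfy the equation. *)
Lemma kaut_center : vge vp 0 x -> exists x0 y0, on_curve x0 y0 /\ at_point x0 y0 vp.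
Proof.
move=> vx; have vy := vge0_y val_vp vx.
have center z : vge vp 0 z -> exists c, vge vp 1 (z - iota c).
  rewrite vge_kaut => /vinf_residue[c vc]; exists c.
  by rewrite vge_kaut kautB kaut_iota.
have [x0 vx0] := center _ vx; have [y0 vy0] := center _ vy; exists x0, y0.
split; last by split=> //; exact: val_vp.
have vge1_horner (P : {poly K}) z : P`_0 = 0 -> vge vp 1 z -> vge vp 1 (map_poly iota P).[z].
  move=> P0 vz; have /dvdpP[P1 ->] : 'X %| P by rewrite dvdX_coef0 P0.
  rewrite rmorphM /= map_polyX hornerMX -[1]add0r (vgeM val_vp) //.
  by rewrite (vge0_horner val_vp) // (vgeW _ vz).
apply/eqP; rewrite -subr_eq0; apply/eqP/(vge_iota_gt0 val_vp).
have -> : iota (A.[y0] - x0 ^+ m) = (map_poly iota (shifted_pow x0)).[x - iota x0]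
    - (map_poly iota A).[y - iota y0].
  rewrite horner_shifted_pow (linpolyB n a pcharK) curve_eq (horner_map iota) /=.
  by rewrite rmorphB /= rmorphXn /=; ring.
apply: (vgeB val_vp); apply: vge1_horner => //; first exact: shifted_pow_coef0.
exact: coef_linpoly0 pcharK.
Qed.

(** If s z has a pole at v, then z, and therefore x, has one at v \o s, which is thus [vinf]; so v
    is [vp]. *)
Lemma kaut_pole x0 y0 (z : F) k : on_curve x0 y0 -> at_point x0 y0 vp -> z != 0 ->
  (forall v, valuation iota v -> vge v 0 x -> vge v 0 z) -> vinf z = - k%:Z ->
  pole_at x0 y0 k (s z).
Proof.
move=> xy0 vp_at z0 zx vz.
have fin v : valuation iota v -> ~~ vge v 0 (s z) -> forall z, z != 0 -> v z = vp z.
  move=> val_v nvx z' z'0; have val_vs := valuation_kaut s val_v.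
  rewrite -[in LHS](siK z') -[LHS]/((v \o s) (si z')).
  rewrite (vinf_unique val_vs) ?kaut_neq0 //; apply: contra nvx => vx.
  by rewrite -vge_kaut zx.
split; first exact: kaut_neq0.
- move=> x1 y1 v xy1 v_at ne; have val_v : valuation iota v by case: v_at.
  apply: contraT => /(fin v val_v) vvp; case: ne.
  have [_ vx0 vy0] := vp_at; have [_ vx1 vy1] := v_at.
  have eqv w : vge v 1 w -> vge vp 1 w by have [->|w0] := eqVneq w 0; rewrite ?vge0 // !vgeE // vvp.
  have eqc (c c' : K) w : vge vp 1 (w - iota c) -> vge vp 1 (w - iota c') -> c' = c.
    move=> h h'; apply/eqP; rewrite -subr_eq0; apply/eqP/(vge_iota_gt0 val_vp).
    have -> : iota (c' - c) = (w - iota c) - (w - iota c') by rewrite rmorphB; ring.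
    exact: (vgeB val_vp).
  congr (_, _).
    by apply: (eqc x0 x1 x) => //; apply: eqv; case: v_at.
  by apply: (eqc y0 y1 y) => //; apply: eqv; case: v_at.
- move=> v v_at; rewrite (point_unique xy0 v_at vp_at) ?kaut_neq0 //.
  by rewrite -[LHS]/(vinf (si (s z))) sK.
- apply: contraT => /(fin _ vinf_valuation) e.
  have := vge0_at_x vp_at; rewrite vgeE ?x_neq0 // -e ?x_neq0 // vinf_x.
  by have := q_gt0; lia.
Qed.

(** If x is regular at the image of infinity, the results on affine poles apply to s x and s y and
    put the curve in the excluded case. So x has a pole there, and [vinf_unique] identifies the
    image with infinity. *)
Lemma kaut_fixes_infinity z : z != 0 -> vinf (s z) = vinf z.
Proof.
have nvx : ~~ vge vp 0 x.
  apply/negP => vx; have [x0 [y0 [xy0 vp_at]]] := kaut_center vx.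
  have u_pole : pole_at x0 y0 q (s x).
    by apply: (kaut_pole xy0 vp_at x_neq0) => //; exact: vinf_x.
  have w_pole : pole_at x0 y0 m (s y).
    apply: (kaut_pole xy0 vp_at y_neq0); last exact: vinf_y.
    by move=> v val_v; exact: vge0_y.
  have [x00 [c0 [c1 [c00 wf]]]] := affine_pole_form xy0 deg4 m_mod u_pole w_pole.
  have Ay0 : A.[y0] = 0 by rewrite xy0 x00 expr0n gtn_eqF // ltnW ?m_gt1.
  have uw : (map_poly iota A).[s y] = s x ^+ m.
    by rewrite -kaut_horner curve_eq rmorphXn.
  have u0 := kaut_neq0 s x_neq0.
  apply: not_exc; split; first exact: (inverse_pole_dvd Ay0 c00 u0 wf uw).
  exact: (inverse_pole_two_terms Ay0 c00 u0 wf uw).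
move=> z0; rewrite -(vinf_unique val_vp nvx (kaut_neq0 s z0)).
by rewrite -[LHS]/(vinf (si (s z))) sK.
Qed.

End FixInfinity.

(** * The form of an automorphism fixing infinity *)

Lemma degree_arith (k l d r : nat) : (l * d < k)%N ->
  - (l * r)%:Z - (- k%:Z) * l%:Z = (k - l * d)%N%:Z -> k = (l * (d + k - r))%N.
Proof.
move=> ldk e; have e' : (k + l * r = l * (d + k))%N by lia.
by rewrite mulnBr -e' addnK.
Qed.

Lemma horner_y_eq0 (r : {poly K}) : (map_poly iota r).[y] = 0 -> r = 0.
Proof.
have y_neg : vinf y < 0 by rewrite vinf_y oppr_lt0 ltz_nat ltnW ?m_gt1.
move=> ry; apply/eqP; apply: contraT => r0.
by have [] := val_horner_neg vinf_valuation y_neq0 y_neg r0; rewrite ry eqxx.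
Qed.

Lemma vinf_horner_y (r : {poly K}) : r != 0 ->
  vinf (map_poly iota r).[y] = - (m * (size r).-1)%:Z.
Proof.
move=> r0; have y_neg : vinf y < 0 by rewrite vinf_y oppr_lt0 ltz_nat ltnW ?m_gt1.
by have [_ ->] := val_horner_neg vinf_valuation y_neq0 y_neg r0; rewrite vinf_y -mulr_natr natz mulNr -PoszM.
Qed.

Lemma vinf_horner_x (r : {poly K}) : r != 0 ->
  vinf (map_poly iota r).[x] = - (q * (size r).-1)%:Z.
Proof.
move=> r0; have x_neg : vinf x < 0 by rewrite vinf_x oppr_lt0 ltz_nat q_gt0.
by have [_ ->] := val_horner_neg vinf_valuation x_neq0 x_neg r0; rewrite vinf_x -mulr_natr natz mulNr -PoszM.
Qed.

Lemma coprime_dvdm : ~~ (m %| q)%N.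
Proof.
apply/negP => mq; have := coprime_qm; rewrite coprime_sym /coprime.
by move/gcdn_idPl: mq => ->; have := m_gt1; lia.
Qed.

Lemma coprime_dvdq : ~~ (q %| m)%N.
Proof.
apply/negP => mq; have := coprime_qm; rewrite /coprime.
by move/gcdn_idPl: mq => ->; have := q_gt1; lia.
Qed.

(** Coefficients of the additive polynomial A(gamma Y) - alpha^m A(Y); they vanish when (alpha x,
    gamma y) satisfies the equation again. *)
Definition lin_defect (al ga : K) (j : nat) : K := a j * ga ^+ (p ^ j) - al ^+ m * a j.

Lemma horner_lin_defect al ga (z : F) :
  (map_poly iota (linpoly p n (lin_defect al ga))).[z] =
  (map_poly iota A).[iota ga * z] - iota al ^+ m * (map_poly iota A).[z].
Proof.
rewrite !horner_linpoly mulr_sumr -sumrB; apply: eq_bigr => j _.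
by rewrite rmorphB !rmorphM !rmorphXn /= exprMn; ring.
Qed.

Section InfinityFixed.
Variables (u w : F) (U W : {poly {poly K}}).
Hypotheses (m_mod : m != 1 %[mod q]) (uw_eq : (map_poly iota A).[w] = u ^+ m).
Hypotheses (wU : wt_le q m q U) (wW : wt_le q m m W) (uU : u = phi U) (wWE : w = phi W).
Hypotheses (vu : vinf u = - q%:Z) (vw : vinf w = - m%:Z) (u0 : u != 0) (w0 : w != 0).

(** The weights leave u = al x + g(y) and w = ga y + be. Once g = 0 is known, the equation is an
    identity between polynomials in y, and its coefficients give the claim. *)
Lemma fixed_form_ltn : (m < q)%N -> exists al be ga : K,
  [/\ al != 0, u = iota al * x, w = iota ga * y + iota be, A.[be] = 0 &
      forall j, (j <= n)%N -> lin_defect al ga j = 0].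
Proof.
move=> mq; have m1 := m_gt1.
pose g : {poly K} := \poly_(j < size U) U`_j`_0; pose al := U`_0`_1.
have uE : u = iota al * x + (map_poly iota g).[y].
  have -> : u = phi ((al *: 'X)%:P + g^:P).
    rewrite uU; congr (phi _); apply/polyP => j; apply/polyP => i.
    rewrite coefD coefC coef_map coefD coefC coef_poly.
    have [Uji|Uji] := eqVneq U`_j`_i 0.
      rewrite Uji; case: (j =P 0%N) Uji => [->|_] Uji.
        rewrite coefZ coefX; case: (i =P 1%N) Uji => [-> h|_ h].
          by rewrite /al h mul0r add0r.
        rewrite mulr0 add0r; case: (i =P 0%N) h => [-> ->|//].
        by rewrite if_same.
      rewrite coef0 add0r; case: (i =P 0%N) Uji => [-> ->|//].
      by rewrite if_same.
    have jU : (j < size U)%N.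
      by apply: coef_neq0_ltn; apply: contraNneq Uji => ->; rewrite coef0.
    have := wU Uji; rewrite jU; case: (j =P 0%N) => [->|j0] h.
      rewrite coefZ coefX; case: i Uji h => [|[|i]] Uji h.
      - by rewrite mulr0 add0r.
      - by rewrite mulr1 addr0.
      - by exfalso; move: h q_gt0; clear; move: (q) => Q; nia.
    rewrite coef0 add0r; case: i Uji h => [|i] Uji h //=.
    by exfalso; move: h j0 m1 q_gt0; clear; move: (q) => Q; nia.
  by rewrite ev2D ev2_lift ev2C linearZ /= map_polyX hornerZ hornerX.
pose ga := W`_1`_0; pose be := W`_0`_0.
have wE' : w = iota ga * y + iota be.
  have -> : w = phi (ga%:P *: 'X + be%:P%:P).
    rewrite wWE; congr (phi _); apply/polyP => j; apply/polyP => i.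
    rewrite coefD coefC coefZ coefX coefD.
    have [Wji|Wji] := eqVneq W`_j`_i 0.
      rewrite Wji; case: j Wji => [|[|j]] Wji; rewrite ?mulr0 ?mulr1 ?coef0 ?add0r ?addr0 //.
        by rewrite coefC; case: i Wji => // h; rewrite /be h.
      by rewrite coefC; case: i Wji => // h; rewrite /ga h.
    have h := wW Wji; have i0 : i = 0 by move: h mq; clear; move: (q) => Q; nia.
    move: Wji h; rewrite i0; case: j => [|[|j]] Wji h.
    - by rewrite mulr0 coef0 add0r coefC.
    - by rewrite mulr1 coefC coef0 addr0.
    - by exfalso; move: h m1; clear; move: (q) => Q; nia.
  by rewrite ev2D -mul_polyC ev2M !ev2CC ev2Y.
(* With X = al x and G = g(y), u^m - X^m has the same pole order as X^(m-1) G, namely mq - q + m deg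
   g. It is also a polynomial R in y, of pole order m deg R. So m would divide q. *)
have g0 : g = 0.
  apply/eqP; apply: contraT => g0; pose G := (map_poly iota g).[y].
  have G0 : G != 0 by apply: contraNneq g0 => /horner_y_eq0->.
  have sg : (m * (size g).-1 < q)%N.
    have : g`_(size g).-1 != 0 by rewrite -lead_coefE lead_coef_eq0.
    rewrite coef_poly; case: ifP => [_ /wU|]; last by rewrite eqxx.
    rewrite mul0n add0n mulnC leq_eqVlt => /orP[/eqP e|//].
    by have := coprime_dvdm; rewrite -e dvdn_mulr.
  have vG : vinf G = - (m * (size g).-1)%:Z by exact: vinf_horner_y.
  have al0 : al != 0.
    apply/eqP => al0; move: vu; rewrite uE al0 rmorph0 mul0r add0r -/G vG => e.
    by move: sg; lia.
  pose X := iota al * x; have X0 : X != 0 by rewrite mulf_neq0 ?x_neq0 ?fmorph_eq0.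
  have vX : vinf X = - q%:Z.
    by rewrite (valM vinf_valuation) ?x_neq0 ?fmorph_eq0 // (val_iota vinf_valuation) // add0r vinf_x.
  have h0 : G / X != 0 by rewrite mulf_neq0 ?invr_neq0.
  have vh : vinf (G / X) = (q - m * (size g).-1)%N%:Z.
    by rewrite (val_div vinf_valuation) // vG vX; lia.
  have vh0 : 0 < vinf (G / X) by rewrite vh; lia.
  have S_low i : (i < 1)%N -> (shifted_pow 1)`_i = 0.
    by rewrite ltnS leqn0 => /eqP->; exact: shifted_pow_coef0.
  have S1 : (shifted_pow 1)`_1 != 0.
    by rewrite shifted_pow_coef1 expr1n mulr1 natm_neq0.
  have [S0 vS] := val_horner_pos vinf_valuation h0 vh0 S_low S1.
  have SE : (map_poly iota (shifted_pow 1)).[G / X] = (u ^+ m - X ^+ m) / X ^+ m.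
    rewrite horner_shifted_powE rmorph1 expr1n mulrBl divff ?expf_neq0 //.
    have uX : u / X = G / X + 1 by rewrite uE mulrDl divff // addrC.
    by rewrite -expr_div_n uX.
  pose R := A \Po (ga *: 'X + be%:P) - al ^+ m *: A.
  have RE : (map_poly iota R).[y] = u ^+ m - X ^+ m.
    rewrite rmorphB /= hornerD hornerN map_comp_poly horner_comp linearZ /= hornerZ.
    rewrite rmorphD /= linearZ /= map_polyX (map_polyC iota be) hornerD hornerZ hornerX hornerC.
    by rewrite -wE' uw_eq curve_eq rmorphXn /= -exprMn.
  have R0 : R != 0.
    apply: contraNneq S0 => R0; move: RE; rewrite SE R0 rmorph0 horner0 => <-.
    by rewrite mul0r.
  have RX0 : u ^+ m - X ^+ m != 0 by rewrite -RE; apply: contraNneq R0 => /horner_y_eq0->.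
  have := vinf_horner_y R0; rewrite RE => vR.
  move: vS; rewrite SE (val_div vinf_valuation) ?expf_neq0 // vR (valX vinf_valuation) // vX vh mulr1n.
  move=> e; have := coprime_dvdm; case/negP; apply/dvdnP.
  exists ((size g).-1 + q - (size R).-1)%N.
  by rewrite mulnC; apply: degree_arith sg _; rewrite -e -mulr_natr natz.
have {}uE : u = iota al * x by rewrite uE g0 rmorph0 horner0 addr0.
have al0 : al != 0 by apply: contraNneq u0 => al0; rewrite uE al0 rmorph0 mul0r.
pose b := lin_defect al ga; pose R := linpoly p n b + (A.[be])%:P.
have R0 : R = 0.
  apply: horner_y_eq0; rewrite rmorphD /= hornerD horner_lin_defect map_polyC hornerC.
  rewrite addrAC /= -(horner_map iota) /= -(linpolyD n a pcharK) -wE' uw_eq curve_eq uE.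
  by rewrite exprMn subrr.
have Rj j : (j <= n)%N -> b j = 0.
  move=> jn; rewrite -(coef_linpoly_pow b pcharK jn).
  have := congr1 (fun r : {poly K} => r`_(p ^ j)) R0; rewrite coefD coefC coef0.
  by rewrite expn_eq0 gtn_eqF ?(ltnW p_gt1) // addr0.
exists al, be, ga; split=> //.
have := congr1 (fun r : {poly K} => r`_0) R0; rewrite coefD coefC coef0 /=.
by rewrite (coef_linpoly0 n b pcharK) add0r.
Qed.

(** The weights leave u = al x + b0 and w = ga y + g(x). The equation separates into a part in y and
    a part in x, which vanish separately, so A(g) = (al X + b0)^m - al^m X^m. For b0 nonzero the
    right side has degree m - 1 and the left q deg g, against m not congruent to 1 modulo q. *)
Lemma fixed_form_gtn : (q < m)%N -> exists al be ga : K,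
  [/\ al != 0, u = iota al * x, w = iota ga * y + iota be, A.[be] = 0 &
      forall j, (j <= n)%N -> lin_defect al ga j = 0].
Proof.
move=> qm; have q1 := q_gt1.
pose al := U`_0`_1; pose b0 := U`_0`_0; pose ga := W`_1`_0; pose g := W`_0.
have uE : u = iota al * x + iota b0.
  have -> : u = phi (al *: 'X + b0%:P)%:P.
    rewrite uU; congr (phi _); apply/polyP => j; apply/polyP => i.
    rewrite coefC; have [Uji|Uji] := eqVneq U`_j`_i 0.
      rewrite Uji; case: (j =P 0%N) Uji => [->|_] Uji; last by rewrite coef0.
      rewrite coefD coefZ coefX coefC; case: i Uji => [|[|i]] Uji.
      - by rewrite mulr0 add0r.
      - by rewrite mulr1 addr0.
      - by rewrite mulr0 addr0.
    have h := wU Uji; have j0 : j = 0 by move: h qm; clear; move: (q) => Q; nia.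
    rewrite j0 coefD coefZ coefX coefC; move: h Uji; rewrite j0.
    case: i => [|[|i]] h Uji; rewrite ?mulr0 ?add0r ?mulr1 ?addr0 //=.
    by exfalso; move: h q1; clear; move: (q) => Q; nia.
  by rewrite ev2C rmorphD /= linearZ /= map_polyX (map_polyC iota b0) !hornerE.
have wE' : w = iota ga * y + (map_poly iota g).[x].
  have -> : w = phi (ga%:P *: 'X + g%:P).
    rewrite wWE; congr (phi _); apply/polyP => j; apply/polyP => i.
    rewrite coefD coefC coefZ coefX coefD.
    have [Wji|Wji] := eqVneq W`_j`_i 0.
      rewrite Wji; case: j Wji => [|[|j]] Wji; rewrite ?mulr0 ?mulr1 ?coef0 ?add0r ?addr0 //.
      by rewrite coefC; case: i Wji => // h; rewrite /ga h.
    have h := wW Wji; case: j Wji h => [|[|j]] Wji h.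
    - by rewrite mulr0 coef0 add0r.
    - rewrite mulr1 coefC coef0 addr0; case: i Wji h => // i Wji h.
      by exfalso; move: h q1; clear; move: (q) => Q; nia.
    - by exfalso; move: h qm q1; clear; move: (q) => Q; nia.
  by rewrite ev2D -mul_polyC ev2M ev2CC ev2Y phiC.
have sg : ((size g).-1 * q < m)%N.
  have [->|g0] := eqVneq g 0; first by rewrite size_poly0 ltnW ?m_gt1.
  have : W`_0`_(size g).-1 != 0 by rewrite -lead_coefE lead_coef_eq0.
  move=> /wW; rewrite mul0n addn0 leq_eqVlt => /orP[/eqP e|//].
  by have := coprime_dvdq; rewrite -e dvdn_mull.
pose b := lin_defect al ga.
pose T := (al *: 'X + b0%:P) ^+ m - al ^+ m *: 'X^m.
pose R := T - A^:P.[g].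
have TE (z : F) : (map_poly iota T).[z] = (iota al * z + iota b0) ^+ m - iota al ^+ m * z ^+ m.
  rewrite rmorphB /= rmorphXn /= rmorphD /= !linearZ /= map_polyX map_polyXn (map_polyC iota b0).
  rewrite hornerD horner_exp hornerD !hornerZ hornerN hornerX hornerXn hornerC.
  by rewrite (rmorphXn iota) mulrN.
have bR : (map_poly iota (linpoly p n b)).[y] = (map_poly iota R).[x].
  rewrite horner_lin_defect rmorphB hornerD hornerN TE.
  have -> : (map_poly iota A^:P.[g]).[x] = (map_poly iota A).[(map_poly iota g).[x]].
    exact: horner_linpoly_comp.
  rewrite -uE -uw_eq wE' (linpolyD n a pcharK) curve_eq /=; ring.
have sA : size A^:P = q.+1 by rewrite size_map_polyC (size_linpoly pcharK an_neq0).
have sAg : (size A^:P.[g]).-1 = (q * (size g).-1)%N.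
  have := size_comp_poly A g; rewrite /comp_poly => ->.
  by rewrite (size_linpoly pcharK an_neq0).
have al0 : al != 0.
  apply/eqP => al0; move: vu u0; rewrite uE al0 rmorph0 mul0r add0r fmorph_eq0 => h b00.
  by move: h; rewrite (val_iota vinf_valuation) //; have := q_gt0; lia.
pose c := b0 / al.
pose Sg : {poly K} := \sum_(i < m) ('X + c%:P) ^+ (m.-1 - i) * 'X ^+ i.
have TS : T = (al ^+ m * c) *: Sg.
  have -> : T = al ^+ m *: (('X + c%:P) ^+ m - 'X^m).
    rewrite scalerBr -exprZn scalerDr -[al *: c%:P]mul_polyC -polyCM.
    by rewrite mulrC divfK.
  by rewrite subrXX addrAC subrr add0r mul_polyC scalerA.
have mon i : (i < m)%N -> (('X + c%:P) ^+ (m.-1 - i) * 'X ^+ i) \is monic /\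
    size (('X + c%:P) ^+ (m.-1 - i) * 'X ^+ i : {poly K}) = m.
  move=> im; rewrite -[c]opprK polyCN.
  have m1 : ('X - (- c)%:P) ^+ (m.-1 - i) \is monic by rewrite monic_exp ?monicXsubC.
  split; first by rewrite monicMl // monicXn.
  by rewrite size_Mmonic ?monicXn ?monic_neq0 // size_polyXn size_exp_XsubC; lia.
have sS : (size Sg <= m)%N.
  rewrite (leq_trans (size_sum _ _ _)) //; apply/bigmax_leqP => i _.
  by have [_ ->] := mon i (ltn_ord i).
have Sm : Sg`_m.-1 = m%:R.
  rewrite coef_sum (eq_bigr (fun=> 1)) ?sumr_const ?card_ord // => i _.
  by have [/monicP + si] := mon i (ltn_ord i); rewrite lead_coefE si.
have sT : (size T <= m)%N by rewrite TS (leq_trans (size_scale_leq _ _)).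
have sR : (size R <= m)%N.
  rewrite (leq_trans (size_polyD _ _)) // geq_max sT size_polyN.
  by move: sg; rewrite mulnC -sAg; case: (size A^:P.[g]).
(* A nonzero b_n would give equal pole orders mq = q deg R, but R has degree below m. *)
have bn : b n = 0.
  apply/eqP; apply: contraT => bn.
  have b0' : linpoly p n b != 0 by rewrite -size_poly_eq0 (size_linpoly pcharK bn).
  have R0 : R != 0.
    apply: contraNneq b0' => R0; apply/eqP/horner_y_eq0.
    by rewrite bR R0 rmorph0 horner0.
  have := vinf_horner_y b0'; rewrite bR vinf_horner_x // (size_linpoly pcharK bn) /=.
  have sR0 : (0 < size R)%N by rewrite size_poly_gt0.
  move/eqP; rewrite eqr_opp eqz_nat [(m * _)%N]mulnC eqn_pmul2l ?q_gt0 // => /eqP mR.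
  by move: sR; rewrite -mR leqNgt ltn_predL sR0.
have sb : (size (linpoly p n b) <= q)%N.
  apply/leq_sizeP => i; rewrite leq_eqVlt => /orP[/eqP<-|qi].
    by rewrite (coef_linpoly_pow b pcharK).
  apply: coef_linpoly_npow => j jn; rewrite gtn_eqF // (leq_ltn_trans _ qi) //.
  by rewrite leq_pexp2l // ltnW ?p_gt1.
(* Now the Y-degree is below q, so the identity in F holds between polynomials. *)
have bRP : (linpoly p n b)^:P - R%:P = 0.
  apply: reduced_inj; last by rewrite ev2B ev2_lift phiC bR subrr.
  rewrite (leq_trans (size_polyD _ _)) // geq_max size_map_polyC sb size_polyN.
  exact: leq_trans (size_polyC_leq1 _) q_gt0.
have Rj j : (j <= n)%N -> b j = 0.
  move=> jn; have := congr1 (fun r : {poly {poly K}} => r`_(p ^ j)) bRP.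
  rewrite coefB coef_map coefC coef0 expn_eq0 gtn_eqF ?(ltnW p_gt1) // subr0.
  by rewrite /= (coef_linpoly_pow b pcharK) // => /eqP; rewrite polyC_eq0 => /eqP.
have R0 : R = 0.
  have := congr1 (fun r : {poly {poly K}} => r`_0) bRP.
  rewrite coefB coef_map coefC coef0 /= (coef_linpoly0 n b pcharK) polyC0 sub0r.
  by move/eqP; rewrite oppr_eq0 => /eqP.
have TA : T = A^:P.[g] by apply/eqP; rewrite -subr_eq0 -/R R0.
have b00 : b0 = 0.
  apply/eqP; apply: contraT => b00; have c0 : c != 0 by rewrite mulf_neq0 ?invr_neq0.
  have sSE : size Sg = m.
    apply/eqP; rewrite eqn_leq sS /= -[m in (m <= _)%N]prednK ?(ltnW m_gt1) //.
    by apply: coef_neq0_ltn; rewrite Sm natm_neq0.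
  have : (size T).-1 = (q * (size g).-1)%N by rewrite TA sAg.
  have alc : al ^+ m * c != 0 by rewrite mulf_neq0 // expf_neq0.
  rewrite TS (size_scale _ alc) sSE => e.
  case/negP: m_mod; apply/eqP; have -> : m = ((size g).-1 * q + 1)%N by move: m_gt1; lia.
  by rewrite modnMDl.
have sg1 : (size g <= 1)%N.
  have : (size A^:P.[g]).-1 = 0 by rewrite -TA TS /c b00 mul0r mulr0 scale0r size_poly0.
  by rewrite sAg => /eqP; rewrite muln_eq0 eqn0Ngt q_gt0 /=; lia.
exists al, g`_0, ga; split=> //.
- by rewrite uE b00 rmorph0 addr0.
- by rewrite wE' [in LHS](size1_polyC sg1) map_polyC hornerC.
- have : A^:P.[g] = 0 by rewrite -TA TS /c b00 mul0r mulr0 scale0r.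
  rewrite (size1_polyC sg1) (horner_map polyC) /= => /eqP.
  by rewrite polyC_eq0 coefC => /eqP.
Qed.
End InfinityFixed.

(** The last condition says that [lin_defect al (al ^+ m)] vanishes. *)
Definition aut_params (al be : K) := [/\ al != 0, A.[be] = 0 &
  forall j, (j <= n)%N -> a j != 0 -> (al ^+ m) ^+ (p ^ j) = al ^+ m].

Definition acts_by (al be : K) (s : kaut iota) :=
  sends x y (iota al * x) (iota (al ^+ m) * y + iota be) s.

Section KautForm.
Hypotheses (deg4 : (3 < maxn q m)%N) (m_mod : m != 1 %[mod q]).
Hypothesis not_exc : ~ ((m %| q + 1)%N /\ forall j, (0 < j < n)%N -> a j = 0).
Variable s : kaut iota.

Let kaut_reduced z : z != 0 -> (forall v, valuation iota v -> vge v 0 x -> vge v 0 z) ->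
  exists P, [/\ (size P <= q)%N, P != 0, s z = phi P & vinf z = - (rdeg P)%:Z].
Proof.
move=> z0 zx; have [P sP eP] : exists2 P : {poly {poly K}}, (size P <= q)%N & s z = phi P.
  apply: regular_reduced => x1 y1 v xy1 v_at; have val_v : valuation iota v by case: v_at.
  rewrite -vge_kaut zx //; first exact: valuation_kaut.
  apply: contraT => /(vinf_unique (valuation_kaut s val_v)) vs.
  have := vge0_at_x v_at; rewrite vgeE ?x_neq0 // -(kaut_invfunK s x).
  rewrite -[v _]/((v \o s) (kaut_inv s x)) vs ?kaut_neq0 ?x_neq0 //.
  rewrite (kaut_fixes_infinity deg4 m_mod not_exc) ?x_neq0 // vinf_x.
  by have := q_gt0; lia.
have P0 : P != 0 by apply: contraNneq (kaut_neq0 s z0) => P0; rewrite eP P0 ev20.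
exists P; split=> //; rewrite -vinf_phi // -eP.
by rewrite (kaut_fixes_infinity deg4 m_mod not_exc).
Qed.

Lemma kaut_form : exists al be, aut_params al be /\ acts_by al be s.
Proof.
have [|U [sU U0 eU vU]] := kaut_reduced x_neq0; first by [].
have [|W [sW W0 eW vW]] := kaut_reduced y_neq0; first by move=> v val_v; exact: vge0_y.
have uw : (map_poly iota A).[s y] = s x ^+ m by rewrite -kaut_horner curve_eq rmorphXn.
have wU : wt_le q m q U.
  have rU : rdeg U = q by move: vU; rewrite vinf_x; lia.
  by have := wt_rdeg sU; rewrite rU.
have wW : wt_le q m m W.
  have rW : rdeg W = m by move: vW; rewrite vinf_y; lia.
  by have := wt_rdeg sW; rewrite rW.
have vu : vinf (s x) = - q%:Z.
  by rewrite (kaut_fixes_infinity deg4 m_mod not_exc) ?x_neq0 // vinf_x.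
have vw : vinf (s y) = - m%:Z.
  by rewrite (kaut_fixes_infinity deg4 m_mod not_exc) ?y_neq0 // vinf_y.
have sx0 := kaut_neq0 s x_neq0; have sy0 := kaut_neq0 s y_neq0.
have [al [be [ga [al0 sx sy Abe ld]]]] : exists al be ga : K,
    [/\ al != 0, s x = iota al * x, s y = iota ga * y + iota be, A.[be] = 0 &
      forall j, (j <= n)%N -> lin_defect al ga j = 0].
  have [mq|qm|e] := ltngtP m q.
  - exact: (fixed_form_ltn m_mod uw wU wW eU eW vu vw sx0 sy0 mq).
  - exact: (fixed_form_gtn m_mod uw wU wW eU eW vu vw sx0 sy0 qm).
  - by have := coprime_dvdm; rewrite e dvdnn.
(* The term j = 0 of the defect reads a_0 (ga - al^m) = 0. *)
have gaE : ga = al ^+ m.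
  apply: (mulfI a0_neq0); have := ld 0%N (leq0n n).
  by rewrite /lin_defect expn0 expr1 => /eqP; rewrite subr_eq0 => /eqP->; rewrite mulrC.
exists al, be; split; last by split; rewrite ?sx // sy gaE.
split=> // j jn aj; apply: (mulfI aj); have := ld j jn.
by rewrite /lin_defect gaE => /eqP; rewrite subr_eq0 => /eqP->; rewrite mulrC.
Qed.

End KautForm.

Lemma kaut_ext (s s' : kaut iota) : s x = s' x -> s y = s' y -> s = s'.
Proof.
move=> sx sy; apply/val_inj/funext => z; rewrite -[LHS]/(s z) -[RHS]/(s' z).
by have [P [Q [Q0 ->]]] := frac z; rewrite !fmorph_div /= !kaut_ev2 sx sy.
Qed.

(** * Existence of the automorphisms *)

Section KautExists.
Variables (al be : K).
Hypothesis params : aut_params al be.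
Notation x' := (iota al * x).
Notation y' := (iota (al ^+ m) * y + iota be).
Notation phi' := (ev2 iota x' y').

Let al_neq0 : al != 0. Proof. by case: params. Qed.

Let curve_eq' : (map_poly iota A).[y'] = x' ^+ m.
Proof.
have [_ Abe aj] := params.
have ld0 : linpoly p n (lin_defect al (al ^+ m)) = 0.
  rewrite /linpoly big1 // => j _; rewrite /lin_defect.
  have [->|ajn] := eqVneq (a j) 0; first by rewrite mul0r mulr0 subr0 scale0r.
  by rewrite aj // ?[a j * _]mulrC ?subrr ?scale0r // -ltnS.
have := horner_lin_defect al (al ^+ m) y; rewrite ld0 rmorph0 horner0 => /esym/eqP.
rewrite subr_eq0 => /eqP e; rewrite (linpolyD n a pcharK) (horner_map iota) /= Abe rmorph0 addr0.
by rewrite e exprMn curve_eq.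
Qed.

Let phi'_eq P Q : phi P = phi Q -> phi' P = phi' Q.
Proof.
move=> ePQ; apply/eqP; rewrite -subr_eq0 -ev2B; apply/eqP.
have [D wD] := wt_le_exists q m (P - Q); have [T [C [eT sT _ _ _]]] := reduction wD.
have T0 : T = 0.
  apply: reduced_inj => //; have : phi (P - Q) = 0 by rewrite ev2B ePQ subrr.
  by rewrite eT ev2D ev2M phi_curve_poly mul0r addr0.
by rewrite eT T0 add0r ev2M ev2_sep_poly curve_eq' subrr mul0r.
Qed.

(** The image of P divides a nonzero r(x), and r(x') is nonzero because x' has a pole at
    infinity. *)
Let phi'_neq0 P : phi P != 0 -> phi' P != 0.
Proof.
move=> P0; have [G [r [r0 er]]] := norm_exists P0.
have x'0 : x' != 0 by rewrite mulf_neq0 ?x_neq0 ?fmorph_eq0 ?al_neq0.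
have vx' : vinf x' < 0.
  rewrite (valM vinf_valuation) ?x_neq0 ?fmorph_eq0 ?al_neq0 // (val_iota vinf_valuation) ?al_neq0 // add0r.
  by rewrite vinf_x oppr_lt0 ltz_nat q_gt0.
have [rx' _] := val_horner_neg vinf_valuation x'0 vx' r0.
apply: contraNneq rx' => P'0; rewrite -(ev2C iota x' y' r) -(@phi'_eq (P * G)).
  by rewrite ev2M P'0 mul0r.
by rewrite er phiC.
Qed.

Let frac_eq P Q P1 Q1 : phi Q != 0 -> phi Q1 != 0 ->
  phi P / phi Q = phi P1 / phi Q1 -> phi' P / phi' Q = phi' P1 / phi' Q1.
Proof.
move=> Q0 Q10 /eqP; rewrite eqr_div // -!ev2M => /eqP/phi'_eq; rewrite !ev2M => e.
by apply/eqP; rewrite eqr_div ?phi'_neq0 // e.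
Qed.

(** The pair (x', y') satisfies the equation, so evaluation there factors through K[x, y] and
    extends to fractions by [phi'_neq0]. The inverse affine substitution [bk] gives surjectivity. *)
Lemma kaut_exists : exists s, acts_by al be s.
Proof.
pose num z := sval (cid (frac z)); pose den z := sval (cid (svalP (cid (frac z)))).
have fracP z : phi (den z) != 0 /\ z = phi (num z) / phi (den z).
  exact: svalP (cid (svalP (cid (frac z)))).
pose s z := phi' (num z) / phi' (den z).
have sE P Q : phi Q != 0 -> s (phi P / phi Q) = phi' P / phi' Q.
  move=> Q0; have [D0 e] := fracP (phi P / phi Q).
  by apply: frac_eq => //; rewrite -e.
have sP P : s (phi P) = phi' P.
  by have := @sE P 1; rewrite !ev21 !divr1; apply; exact: oner_neq0.
have s_zmod : zmod_morphism s.
  move=> z w; have [Dz {1}->] := fracP z; have [Dw {1}->] := fracP w.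
  have -> : phi (num z) / phi (den z) - phi (num w) / phi (den w) =
      phi (num z * den w - num w * den z) / phi (den z * den w).
    by rewrite ev2B !ev2M; field; rewrite Dz Dw.
  rewrite sE ?ev2M ?mulf_neq0 // ev2B !ev2M /s.
  by field; rewrite !phi'_neq0.
have s_mon : monoid_morphism s.
  split=> [|z w]; first by rewrite -[1](ev21 iota x y) sP !ev21.
  have [Dz {1}->] := fracP z; have [Dw {1}->] := fracP w.
  rewrite mulf_div -!ev2M sE ?ev2M ?mulf_neq0 // /s.
  by rewrite mulf_div.
have siota c : s (iota c) = iota c by rewrite -[in LHS](ev2CC iota x y) sP ev2CC.
have s_inj : injective s.
  move=> z w e; apply/eqP; rewrite -subr_eq0; apply: contraT => zw.
  have : s (z - w) * s (z - w)^-1 = 1.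
    by have [s1 sM] := s_mon; rewrite -sM mulfV // s1.
  by rewrite s_zmod e subrr mul0r => /eqP; rewrite eq_sym oner_eq0.
pose bk := ev2 (polyCC K) (al^-1 *: 'X)%:P
  ((al ^+ m)^-1%:P *: 'X - ((al ^+ m)^-1 * be)%:P%:P).
have bkE P : phi' (bk P) = phi P.
  have al1 : iota al != 0 by rewrite fmorph_eq0 al_neq0.
  rewrite /bk ev2_subst.
  congr (ev2 _ _ _ P).
    by rewrite ev2C linearZ /= map_polyX hornerZ hornerX fmorphV mulrA mulVf // mul1r.
  rewrite ev2B -mul_polyC ev2M !ev2CC ev2Y rmorphM fmorphV rmorphXn /=.
  by field; rewrite expf_neq0.
have s_bij : bijective s.
  have s_surj w : exists z, s z = w.
    have [P [Q [Q0 ->]]] := frac w; exists (phi (bk P) / phi (bk Q)).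
    rewrite sE ?bkE //; apply: contraNneq Q0 => Q0; rewrite -bkE.
    by rewrite -(@phi'_eq 0) ?ev20 // Q0.
  exists (fun w => sval (cid (s_surj w))) => z; last exact: svalP (cid (s_surj z)).
  by apply: s_inj; rewrite (svalP (cid (s_surj (s z)))).
have s_kaut : is_kaut iota s by split.
exists (KAut (introT (asboolP _) s_kaut)); split => /=.
  by rewrite -[X in s X](ev2X iota x y) sP ev2X.
by rewrite -[X in s X](ev2Y iota x y) sP ev2Y.
Qed.

End KautExists.

Local Open Scope classical_set_scope.
Local Open Scope card_scope.

(** * Order and semidirect decomposition of the automorphism group *)

Section AutGroup.
Hypotheses (deg4 : (3 < maxn q m)%N) (m_mod : m != 1 %[mod q]).
Hypothesis not_exc : ~ ((m %| q + 1)%N /\ forall j, (0 < j < n)%N -> a j = 0).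
Notation d := (exponent_gcd n a).
Notation M := (m * (p ^ d - 1))%N.

Let M_gt0 : (0 < M)%N.
Proof.
have d0 := exponent_gcd_gt0 n_gt0 an_neq0.
have : (p ^ 0 < p ^ d)%N by rewrite ltn_exp2l ?p_gt1.
by rewrite expn0 muln_gt0 subn_gt0 => ->; rewrite (ltnW m_gt1).
Qed.

Lemma aut_paramsP al be : aut_params al be <-> al ^+ M = 1 /\ A.[be] = 0.
Proof.
have alP : al != 0 -> (forall j, (j <= n)%N -> a j != 0 -> (al ^+ m) ^+ (p ^ j) = al ^+ m) <->
    al ^+ M = 1.
  by move=> al0; rewrite exprM; apply: exponent_gcd_fixed; rewrite ?expf_neq0 // ltnW ?p_gt1.
split=> [[al0 Abe aj]|[alM Abe]]; first by split=> //; apply/alP.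
have al0 : al != 0.
  apply: contraPneq alM => ->; rewrite expr0n gtn_eqF ?M_gt0 //.
  by move/eqP; rewrite eq_sym oner_eq0.
by split=> //; apply/alP.
Qed.

(** Since d > 0, p divides neither m nor p^d - 1, so X^M - 1 is separable. *)
Lemma unity_roots : exists rs : seq K,
  [/\ uniq rs, size rs = M & forall z, (z \in rs) = (z ^+ M == 1)].
Proof.
have sep : separable_poly ('X^M - 1 : {poly K}).
  apply: separable_Xn_sub_1; rewrite natrM mulf_neq0 ?natm_neq0 //.
  rewrite -(dvdn_pcharf pcharK) dvdn_subr ?expn_gt0 ?(ltnW p_gt1) //.
    by rewrite dvdn1; have := p_gt1; lia.
  by rewrite dvdn_exp // exponent_gcd_gt0 ?n_gt0 ?an_neq0.
have [rs [u_rs s_rs rsP]] := closed_separable_roots sep; exists rs; split=> //.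
  by rewrite s_rs size_XnsubC ?M_gt0.
by move=> z; rewrite rsP /root !hornerE subr_eq0.
Qed.

(** The product is composition with t applied first; s then acts on the expression for t y, which
    scales y by al'^m and so twists be. *)
Lemma acts_byM al be al' be' (s t : kaut iota) : acts_by al be s -> acts_by al' be' t ->
  acts_by (al * al') (al' ^+ m * be + be') (s * t)%g.
Proof.
move=> [sx sy] [tx ty]; split; rewrite -[LHS]/(s (t _)) ?tx ?ty.
  by rewrite kautM kaut_iota sx !rmorphM /=; ring.
by rewrite kautD kautM !kaut_iota sy exprMn !rmorphD !rmorphM /=; ring.
Qed.

Lemma acts_byV al be (s : kaut iota) : al != 0 -> acts_by al be s ->
  acts_by al^-1 (- (al ^- m * be)) (s^-1)%g.
Proof.
move=> al0 [sx sy]; have al1 : iota al != 0 by rewrite fmorph_eq0.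
have sE (z w : F) : s z = w -> (s^-1)%g w = z by move=> <-; exact: kaut_funK.
split; apply: sE.
  by rewrite kautM kaut_iota sx fmorphV mulrA mulVf // mul1r.
rewrite kautD kautM !kaut_iota sy exprVn rmorphN rmorphM !fmorphV rmorphXn /=.
by field; rewrite expf_neq0.
Qed.

Lemma acts_by_inj al be al' be' (s : kaut iota) :
  acts_by al be s -> acts_by al' be' s -> al = al' /\ be = be'.
Proof.
move=> [sx sy] [sx' sy'].
have e : al = al' by apply: (fmorph_inj iota); apply: (mulIf x_neq0); rewrite -sx -sx'.
split=> //; apply: (fmorph_inj iota); apply: (addrI (iota (al ^+ m) * y)).
by rewrite -sy sy' e.
Qed.

Lemma acts_by_params al be (s : kaut iota) : acts_by al be s -> al ^+ M = 1 /\ A.[be] = 0.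
Proof.
move=> s_acts; have [al' [be' [params s_acts']]] := kaut_form deg4 m_mod not_exc s.
have [-> ->] := acts_by_inj s_acts s_acts'; exact/aut_paramsP.
Qed.

Lemma acts_by_neq0 al be (s : kaut iota) : acts_by al be s -> al != 0.
Proof. by move/acts_by_params/aut_paramsP => -[]. Qed.

Lemma acts_by1 : acts_by 1 0 (1%g : kaut iota).
Proof. by split; rewrite ?expr1n !rmorph1 mul1r ?rmorph0 ?addr0. Qed.

(** Automorphisms correspond to pairs of an M-th root of unity and a root of A; the bijection sends
    s to the position of its pair in the list of all pairs. *)
Lemma aut_card : [set: kaut iota] #= `I_(q * m * (p ^ d - 1)).
Proof.
have [rs1 [u_rs1 s_rs1 rs1P]] := unity_roots.
have [rs2 [u_rs2 s_rs2 rs2P]] := fiber_roots 0.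
pose L := [seq (al, be) | al <- rs1, be <- rs2].
have u_L : uniq L by apply: allpairs_uniq => // -[? ?] [? ?].
have s_L : size L = (q * m * (p ^ d - 1))%N.
  by rewrite size_allpairs s_rs1 s_rs2 mulnC mulnA.
have acts s : {ab : K * K | acts_by ab.1 ab.2 s}.
  by apply: cid; have [al [be [_ h]]] := kaut_form deg4 m_mod not_exc s; exists (al, be).
have L_acts s : sval (acts s) \in L.
  have [alM Abe] := acts_by_params (svalP (acts s)).
  rewrite [sval _]surjective_pairing; apply: allpairs_f; first by rewrite rs1P alM.
  by rewrite rs2P Abe.
apply/card_set_bijP; exists (fun s => index (sval (acts s)) L); split.
- by move=> s _ /=; rewrite -s_L index_mem.
- move=> s t _ _ /(congr1 (nth (0, 0) L)); rewrite !nth_index ?L_acts // => e.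
  have [[sx sy] [tx ty]] := (svalP (acts s), svalP (acts t)).
  by apply: kaut_ext; rewrite ?sx ?sy e ?tx ?ty.
- move=> k /=; rewrite -s_L => kL; have := mem_nth (0, 0) kL.
  case/allpairsP => -[al be] /= [+ + e]; rewrite rs1P rs2P => /eqP alM /eqP Abe.
  have params : aut_params al be by apply/aut_paramsP.
  have [s s_acts] := kaut_exists params; exists s => //.
  have [] := acts_by_inj s_acts (svalP (acts s)).
  case: (sval (acts s)) => al' be' /= <- <-.
  by rewrite -e index_uniq.
Qed.

Definition aut_translations : set (kaut iota) :=
  [set s | exists be : K, A.[be] = 0 /\ sends x y x (y + iota be) s].

Definition aut_homotheties : set (kaut iota) :=
  [set s | exists al : K, al ^+ M = 1 /\ sends x y (iota al * x) (iota (al ^+ m) * y) s].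

Lemma translationP s : aut_translations s <-> exists be, acts_by 1 be s.
Proof.
have tE be : sends x y x (y + iota be) s <-> acts_by 1 be s.
  by rewrite /acts_by expr1n !rmorph1 !mul1r.
split=> [[be [_ /tE h]]|[be h]]; first by exists be.
by exists be; split; [have [] := acts_by_params h | apply/tE].
Qed.

Lemma homothetyP s : aut_homotheties s <-> exists al, acts_by al 0 s.
Proof.
have tE al : sends x y (iota al * x) (iota (al ^+ m) * y) s <-> acts_by al 0 s.
  by rewrite /acts_by rmorph0 !addr0.
split=> [[al [_ /tE h]]|[al h]]; first by exists al.
by exists al; split; [have [] := acts_by_params h | apply/tE].
Qed.

Lemma aut_sdprod : is_sdprod [set: kaut iota] aut_translations aut_homotheties.
Proof.
split.
- split; first by apply/mem_set/translationP; exists 0; exact: acts_by1.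
  move=> s t /set_mem/translationP[be sb] /set_mem/translationP[be' tb].
  apply/mem_set/translationP; have tV := acts_byV (acts_by_neq0 tb) tb.
  by have := acts_byM sb tV; rewrite invr1 mulr1 => h; exists (1 ^+ m * be - 1 ^- m * be').
- split; first by apply/mem_set/homothetyP; exists 1; exact: acts_by1.
  move=> s t /set_mem/homothetyP[al sb] /set_mem/homothetyP[al' tb].
  apply/mem_set/homothetyP; have tV := acts_byV (acts_by_neq0 tb) tb.
  have := acts_byM sb tV; rewrite !mulr0 oppr0 addr0 => h.
  by exists (al * al'^-1).
- move=> g s /translationP[be gb] _; apply/translationP.
  have [al [be' [_ sb]]] := kaut_form deg4 m_mod not_exc s.
  have := acts_byM (acts_byV (acts_by_neq0 sb) sb) (acts_byM gb sb).
  by rewrite mul1r mulVf ?(acts_by_neq0 sb) // => h; eexists; exact: h.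
- apply/seteqP; split=> s /=; last first.
    move=> ->; split; first by apply/translationP; exists 0; exact: acts_by1.
    by apply/homothetyP; exists 1; exact: acts_by1.
  case=> /translationP[be sb] /homothetyP[al sa].
  have [_ be0] := acts_by_inj sb sa; move: sb; rewrite be0 => -[sx sy].
  have [x1 y1] := acts_by1.
  by apply: kaut_ext; rewrite ?sx ?sy ?x1 ?y1.
(* Dividing s by the homothety with the same al leaves a translation. *)
- apply/seteqP; split=> // s _.
  have [al [be [[al0 Abe aj] sb]]] := kaut_form deg4 m_mod not_exc s.
  have params : aut_params al 0 by split=> //; exact: A_horner0.
  have [h hb] := kaut_exists params.
  exists (s * h^-1)%g.
    apply/translationP; have := acts_byM sb (acts_byV al0 hb).
    by rewrite mulfV // => h'; eexists; exact: h'.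
  exists h; last by rewrite mulgVK.
  by apply/homothetyP; exists al.
Qed.

End AutGroup.

End SeparatedCurveField.

(** * Plane curves as multivariate polynomials: degree and homogenization *)

Lemma rmorph_mmap (n : nat) (R S T : comNzRingType) (f : {rmorphism R -> S})
    (g : {rmorphism S -> T}) (h : 'I_n -> S) (P : {mpoly R[n]}) :
  g (mmap f h P) = mmap (g \o f) (g \o h) P.
Proof.
rewrite /mmap rmorph_sum; apply: eq_bigr => u _ /=; rewrite rmorphM; congr (_ * _).
by rewrite /mmap1 rmorph_prod; apply: eq_bigr => i _; rewrite rmorphXn.
Qed.

Lemma eq_mmap (n : nat) (R S : comNzRingType) (f g : R -> S) (h k : 'I_n -> S)
    (P : {mpoly R[n]}) : f =1 g -> h =1 k -> mmap f h P = mmap g k P.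
Proof.
move=> fg hk; apply: eq_bigr => u _; rewrite fg; congr (_ * _).
by apply: eq_bigr => i _; rewrite hk.
Qed.

Section SeparatedCurve.
Variable K : fieldType.
Implicit Types (A B : {poly K}).

Lemma mmap_poly_in (n : nat) (S : comNzRingType) (f : {rmorphism K -> S}) (h : 'I_n -> S)
    (i : 'I_n) A : mmap f h (poly_in i A) = (map_poly f A).[h i].
Proof.
rewrite /poly_in -horner_map /= mmapX mmap1U -map_poly_comp; congr (_.[_]).
by apply: eq_map_poly => c /=; rewrite mmapC.
Qed.

Lemma mmap_separated (S : comNzRingType) (f : {rmorphism K -> S}) (h : 'I_2 -> S) A B :
  mmap f h (separated_curve A B) = (map_poly f A).[h 1] - (map_poly f B).[h 0].
Proof. by rewrite /separated_curve rmorphB /= !mmap_poly_in. Qed.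

Lemma poly_inE (n : nat) (i : 'I_n) A :
  poly_in i A = \sum_(j < size A) A`_j *: 'X_[U_(i) *+ j].
Proof.
rewrite /poly_in horner_coef size_map_inj_poly ?rmorph0 //; last exact: (can_inj (@mpolyCK n K)).
by apply: eq_bigr => j _; rewrite coef_map /= mul_mpolyC mpolyXn.
Qed.

Lemma msize_poly_in (n : nat) (i : 'I_n) A : (msize (poly_in i A) <= size A)%N.
Proof.
rewrite poly_inE (leq_trans (mmeasure_sum _ _ _ _)) //; apply/bigmax_leqP => j _.
by rewrite (leq_trans (msizeZ_le _ _)) // msizeX mdegMn mdeg1 mul1n.
Qed.

Lemma curve_degree_le A B :
  (curve_degree (separated_curve A B) <= (maxn (size A) (size B)).-1)%N.
Proof.
rewrite /curve_degree -!subn1 leq_sub2r // (leq_trans (mmeasureD_le _ _ _)) //.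
by rewrite mmeasureN geq_max !leq_max !msize_poly_in orbT.
Qed.

(** The monomial Y^(deg A) with deg A > 0 cannot be cancelled by a polynomial in X, and no other
    monomial has larger degree. *)
Lemma curve_degreeE A B : (1 < size A)%N -> (size B <= size A)%N ->
  curve_degree (separated_curve A B) = (size A).-1.
Proof.
move=> sA sBA; apply/eqP; rewrite eqn_leq.
have := curve_degree_le A B; rewrite (maxn_idPl sBA) => -> /=.
set u : 'X_{1..2} := (U_(1) *+ (size A).-1)%MM.
have uE (i : 'I_2) (k : nat) : (U_(i) *+ k == u)%MM = (i == 1) && (k == (size A).-1).
  apply/eqP/andP => [e|[/eqP-> /eqP->] //]; move: e => /[dup] /(congr1 (fun w : 'X_{1..2} => w 1)).
  rewrite !mulmnE !mnm1E eqxx mul1n => e1 _; move: e1; case: (i == 1) => /=.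
    by rewrite mul1n => ->.
  by rewrite mul0n => h; case: (size A) sA h => [|[]] //.
have cP (i : 'I_2) (P : {poly K}) : (poly_in i P)@_u = if i == 1 then P`_(size A).-1 else 0.
  rewrite poly_inE raddf_sum /=.
  rewrite (eq_bigr (fun j : 'I_(size P) => (P`_j * ((i == 1) && (j == (size A).-1 :> nat))%:R))) => [|j _].
    case: (i == 1) => /=; last by rewrite big1 // => j _; rewrite mulr0.
    have [jP|Pj] := ltnP (size A).-1 (size P).
      rewrite (bigD1 (Ordinal jP)) //= eqxx mulr1 big1 ?addr0 // => j.
      by rewrite -val_eqE /= => /negPf->; rewrite mulr0.
    rewrite nth_default // big1 // => j _; rewrite (_ : _ == _ = false) ?mulr0 //.
    by rewrite ltn_eqF // (leq_trans (ltn_ord j)).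
  by rewrite mcoeffZ mcoeffX uE.
have : u \in msupp (separated_curve A B).
  rewrite mcoeff_msupp /separated_curve raddfB /= !cP eqxx /= subr0.
  by rewrite -lead_coefE lead_coef_eq0 -size_poly_gt0 ltnW.
by move/msize_mdeg_lt; rewrite mdegMn mdeg1 mul1n /curve_degree; case: (msize _).
Qed.

(* Homogenization is evaluation at the point (X : Y : 1) = (X_0/X_2, X_1/X_2). *)
Lemma rmorph_homogenize (L : fieldType) (g : {rmorphism {mpoly K[3]} -> L}) (f : {mpoly K[2]}) :
  g 'X_2 != 0 ->
  g (homogenize f) = g 'X_2 ^+ curve_degree f *
    mmap (g \o @mpolyC 3 K) (fun i : 'I_2 => if i == 0 then g 'X_0 / g 'X_2 else g 'X_1 / g 'X_2) f.
Proof.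
move=> g2; rewrite /homogenize rmorph_sum /mmap mulr_sumr; apply: eq_big_seq => u uf /=.
rewrite -mul_mpolyC rmorphM /= mulrCA; congr (_ * _).
rewrite !rmorphM !rmorphXn /= /mmap1 big_ord_recl big_ord1 /= mulrA.
have du : mdeg u = (u 0%R + u 1%R)%N by rewrite mdegE big_ord_recl big_ord1; congr (_ + u _)%N; apply: val_inj.
have ud : (mdeg u <= curve_degree f)%N by move: (msize_mdeg_lt uf); rewrite /curve_degree; case: (msize f).
have -> : lift ord0 (ord0 : 'I_1) = 1 :> 'I_2 by apply: val_inj.
rewrite -[in RHS](subnK ud) du !expr_div_n exprD [g 'X_2 ^+ (_ + _)]exprD.
move: (g 'X_0) (g 'X_1) (g 'X_2) g2 (u 0) (u 1) (_ - _)%N => s t w w0 i j k.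
by field; rewrite !expf_neq0.
Qed.

End SeparatedCurve.

(** * Powers of a linear form and the projective normal form *)

Lemma ord_le3 (i : 'I_3) : [\/ i = 0, i = 1 | i = 2%:R].
Proof.
by case: i => [[|[|[|]]]] // i3; [constructor 1|constructor 2|constructor 3]; apply: val_inj.
Qed.
Lemma closed_field_nth_root (K : closedFieldType) (c : K) (k : nat) : (0 < k)%N ->
  exists z, z ^+ k = c.
Proof.
move=> k0; have /closed_rootP[z] : size ('X^k - c%:P) != 1%N.
  by rewrite size_XnsubC // eqSS -lt0n.
by rewrite rootE !hornerE subr_eq0 => /eqP; exists z.
Qed.

Lemma unique_root_power (K : closedFieldType) (B : {poly K}) (r : K) :
  (forall z, root B z -> z = r) -> B = lead_coef B *: ('X - r%:P) ^+ (size B).-1.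
Proof.
move=> Br; have [->|B0] := eqVneq B 0; first by rewrite lead_coef0 scale0r.
have [rs] := closed_field_poly_normal B.
have [->|N0 e] := eqVneq (lead_coef B) 0 => //; first by rewrite scale0r => e; rewrite e eqxx in B0.
have rsE : rs = nseq (size rs) r.
  apply/all_pred1P/allP => z zrs; apply/eqP/Br; rewrite e rootZ //.
  by rewrite root_prod_XsubC.
have sB : (size B).-1 = size rs by rewrite e size_scale // size_prod_XsubC.
rewrite sB [LHS]e; congr (_ *: _); rewrite rsE size_nseq big_nseq.
by rewrite -Monoid.iteropE.
Qed.

(** The coefficient just below the top one, from which [unique_root_form] reads the root of B. *)
Lemma coef_XaddC_exp (R : comNzRingType) (c : R) (k : nat) :
  (('X + c%:P) ^+ k.+1)`_k = k.+1%:R * c.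
Proof.
have sz j : size (('X + c%:P) ^+ j) = j.+1.
  by rewrite -[c]opprK polyCN size_exp_XsubC.
have top j : (('X + c%:P) ^+ j)`_j = 1.
  have := monic_exp j (monicXsubC (- c)); rewrite polyCN opprK => /monicP.
  by rewrite lead_coefE sz.
elim: k => [|k IH]; first by rewrite expr1 coefD coefX coefC add0r mul1r.
by rewrite exprS mulrDl coefD coefXM mul_polyC coefZ /= IH top -[k.+2]addn1 natrD; ring.
Qed.

Lemma scale_fermat (L : fieldType) (q m : nat) (aq a0 bm al ga c x y z : L) :
  aq * ga ^+ q = a0 * ga -> bm * al ^+ m = a0 * ga -> z != 0 ->
  aq * (ga * y / z) ^+ q + a0 * (ga * y / z) - bm * ((al * x - c * z) / z + c) ^+ m =
  a0 * ga * ((y / z) ^+ q + y / z - (x / z) ^+ m).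
Proof.
move=> gaq alm z0; have -> : (al * x - c * z) / z + c = al * (x / z) by field.
rewrite -mulrA [(ga * _) ^+ q]exprMn [(al * _) ^+ m]exprMn.
by rewrite ![_ * (_ ^+ _ * _)]mulrA gaq alm [a0 * (ga * (y / z))]mulrA -mulrDr -mulrBr.
Qed.

(** Take X -> al X - c Z and Y -> ga Y with ga^(q-1) = a_0/a_q and b_m al^m = a_0 ga; every term
    then acquires the factor a_0 ga. Since m <= q both curves have degree q, so the same power of Z
    homogenizes both. *)
Lemma projectively_equivalent_fermat (K : closedFieldType) (q m : nat) (aq a0 bm c : K) :
  (1 < q)%N -> (0 < m <= q)%N -> aq != 0 -> a0 != 0 -> bm != 0 ->
  projectively_equivalent
    (separated_curve (aq *: 'X^q + a0 *: 'X) (bm *: ('X + c%:P) ^+ m))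
    (separated_curve ('X^q + 'X) 'X^m).
Proof.
move=> q1 /andP[m0 mq] aq0 a00 bm0.
have [ga gaE] : exists ga : K, ga ^+ q.-1 = a0 / aq by apply: closed_field_nth_root; lia.
have root_neq0 k (z w : K) : (0 < k)%N -> w != 0 -> z ^+ k = w -> z != 0.
  by move=> k0 w0 e; apply: contraNneq w0 => z0; rewrite -e z0 expr0n -[k]prednK.
have ga0 : ga != 0 by apply: root_neq0 gaE; rewrite ?mulf_neq0 ?invr_neq0 //; lia.
have [al alE] := closed_field_nth_root (a0 * ga / bm) m0.
have al0 : al != 0 by apply: root_neq0 alE; rewrite ?mulf_neq0 ?invr_neq0.
have gaq : aq * ga ^+ q = a0 * ga.
  by rewrite -(prednK (ltnW q1)) exprSr gaE mulrCA mulrA mulfVK // mulrC.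
have alm : bm * al ^+ m = a0 * ga by rewrite alE mulrCA mulfV ?mulr1.
have sizes a1 a2 (P : {poly K}) : a1 != 0 -> (size P <= m.+1)%N ->
    curve_degree (separated_curve (a1 *: 'X^q + a2 *: 'X) P) = q.
  move=> a10 sP; have sA : size (a1 *: 'X^q + a2 *: 'X : {poly K}) = q.+1.
    have sX : (size (a2 *: 'X : {poly K})%R < size (a1 *: 'X^q : {poly K})%R)%N.
      by rewrite [leqRHS]size_scale // size_polyXn (leq_ltn_trans (size_scale_leq _ _)) // size_polyX.
    by rewrite size_polyDl // size_scale // size_polyXn.
  by rewrite curve_degreeE sA ?(leq_trans sP) // ltnS ltnW.
set f := separated_curve _ _; set g := separated_curve _ _.
have df : curve_degree f = q.
  apply: sizes => //; rewrite (leq_trans (size_scale_leq _ _)) //.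
  by rewrite -[c]opprK polyCN size_exp_XsubC.
have dg : curve_degree g = q.
  have -> : g = separated_curve (1 *: 'X^q + 1 *: 'X) 'X^m by rewrite !scale1r.
  by apply: sizes; rewrite ?oner_eq0 ?size_polyXn.
pose M : 'M[K]_3 := \matrix_(i, j)
  if i == 0 then (if j == 0 then al else if j == 1 then 0 else - c) else
  if i == 1 then (if j == 1 then ga else 0) else (if i == j then 1 else 0).
have MU : M \in unitmx.
  rewrite unitmxE -det_tr det_trig; last first.
    apply/is_trig_mxP => i j; rewrite !mxE.
    by case: (ord_le3 i) => ->; case: (ord_le3 j) => ->.
  rewrite !big_ord_recl big_ord0 !mxE /= mulr1 !unitfE !mulf_neq0 ?oner_eq0 //.
exists M, (a0 * ga); split; rewrite ?mulf_neq0 //.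
pose lq := [tuple \sum_(j < 3) M i j *: 'X_j | i < 3].
have lqE (i : 'I_3) : 'X_i \mPo lq = \sum_(j < 3) M i j *: 'X_j.
  by rewrite comp_mpolyXU (nth_map i) ?size_enum_ord // nth_ord_enum.
have lX0 : 'X_0 \mPo lq = al *: 'X_0 - c *: 'X_2.
  rewrite lqE !big_ord_recl big_ord0 !mxE /= scale0r add0r addr0 scaleNr.
  by congr (_ *: 'X_ _ - _ *: 'X_ _); apply: val_inj.
have lX1 : 'X_1 \mPo lq = ga *: 'X_1.
  rewrite lqE !big_ord_recl big_ord0 !mxE /= !scale0r add0r !addr0.
  by congr (_ *: 'X_ _); apply: val_inj.
have lX2 : 'X_2 \mPo lq = 'X_2.
  rewrite lqE !big_ord_recl big_ord0 !mxE /= !scale0r !add0r addr0 scale1r.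
  by congr 'X_ _; apply: val_inj.
(* The identity is checked in the fraction field, where [rmorph_homogenize] reduces it to the affine
   computation [scale_fermat]. *)
pose L := {fraction {mpoly K[3]}}; pose em : {rmorphism {mpoly K[3]} -> L} := @tofrac _.
pose es : {rmorphism {mpoly K[3]} -> L} := em \o comp_mpoly lq.
have em_inj : injective em by move=> P Q /eqP; rewrite tofrac_eq => /eqP.
apply: em_inj; rewrite -[LHS]/(es (homogenize f)) -mul_mpolyC [RHS]rmorphM.
have X2 : em 'X_2 != 0 by rewrite tofrac_eq0 -msize_poly_eq0 msizeX.
have esX2 : es 'X_2 = em 'X_2 by rewrite -[LHS]/(em ('X_2 \mPo lq)) lX2.
rewrite !rmorph_homogenize ?esX2 // df dg mulrCA; congr (_ * _).
rewrite !mmap_separated.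
have evf (h : {rmorphism K -> L}) s t :
    (map_poly h (aq *: 'X^q + a0 *: 'X)).[t] - (map_poly h (bm *: ('X + c%:P) ^+ m)).[s] =
    h aq * t ^+ q + h a0 * t - h bm * (s + h c) ^+ m.
  rewrite rmorphD /= !map_polyZ /= map_polyXn rmorphXn rmorphD /= map_polyX map_polyC.
  by rewrite !hornerE.
have evg (h : {rmorphism K -> L}) s t :
    (map_poly h ('X^q + 'X)).[t] - (map_poly h 'X^m).[s] = t ^+ q + t - s ^+ m.
  by rewrite rmorphD /= !map_polyXn map_polyX !hornerE.
rewrite evf evg /= !comp_mpolyC lX1 lX0 -!mul_mpolyC -!/(em _) rmorphB !rmorphM.
pose k : {rmorphism K -> L} := em \o @mpolyC 3 K; rewrite -!/(k _).
have gaq' : k aq * k ga ^+ q = k a0 * k ga by rewrite -rmorphXn -!rmorphM gaq.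
have alm' : k bm * k al ^+ m = k a0 * k ga by rewrite -rmorphXn -!rmorphM alm.
exact: scale_fermat gaq' alm' X2.
Qed.

(** * From the given curve to the normalised equation *)

Section CurveFunctionField.
Variables (K F : fieldType) (iota : {rmorphism K -> F}) (p n m : nat) (a : nat -> K) (bm c : K).
Variables x y : F.
Hypotheses (p_gt0 : (0 < p)%N) (bm_neq0 : bm != 0).
Notation A := (linpoly p n a).
Notation B := (bm *: ('X + c%:P) ^+ m).
Notation A' := (linpoly p n (fun j => a j / bm)).
Notation x1 := (x + iota c).
Hypothesis xy_field : is_function_field iota (separated_curve A B) x y.
Implicit Type P : {poly {poly K}}.

Lemma linpoly_div : A = bm *: A'.
Proof.
by rewrite /linpoly scaler_sumr; apply: eq_bigr => j _; rewrite scalerA mulrCA mulfV ?mulr1.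
Qed.

(** The inner variable of [{poly {poly K}}] stands for x + c, in which the equation becomes A'(y) =
    (x + c)^m with A' = A/b_m. *)
Definition shifted_mpoly : {poly {poly K}} -> {mpoly K[2]} :=
  ev2 (@mpolyC 2 K) ('X_0 + c%:MP) 'X_1.

Definition unshifted_poly : {mpoly K[2]} -> {poly {poly K}} :=
  mmap (polyC \o polyC) (fun i : 'I_2 => if i == 0 then ('X - c%:P)%:P else 'X).

Lemma ev2_unshifted_poly (P : {mpoly K[2]}) : ev2 iota x1 y (unshifted_poly P) = eval_at iota x y P.
Proof.
pose e : {rmorphism {poly {poly K}} -> F} := ev2 iota x1 y.
rewrite -[LHS]/(e (mmap _ _ _)) rmorph_mmap; apply: eq_mmap => [z|i] /=; first exact: ev2CC.
by case: eqP => _; rewrite ?ev2Y // ev2C rmorphB /= map_polyX map_polyC /= !hornerE addrK.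
Qed.

Lemma eval_shifted_mpoly P : eval_at iota x y (shifted_mpoly P) = ev2 iota x1 y P.
Proof.
pose e : {rmorphism {mpoly K[2]} -> F} := mmap iota (fun i : 'I_2 => if i == 0 then x else y).
rewrite -[LHS]/(e _) ev2_comp rmorphD /= !mmapX !mmap1U mmapC.
by apply: eq_ev2 => z /=; rewrite mmapC.
Qed.

Lemma shifted_mpolyK : cancel shifted_mpoly unshifted_poly.
Proof.
move=> P; rewrite -[RHS]ev2_id.
pose e : {rmorphism {mpoly K[2]} -> {poly {poly K}}} := mmap (polyC \o polyC) (fun i : 'I_2 => if i == 0 then ('X - c%:P)%:P else 'X).
rewrite -[LHS]/(e _) ev2_comp rmorphD /= !mmapX !mmap1U mmapC /= -polyCD subrK.
by apply: eq_ev2 => z /=; rewrite mmapC.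
Qed.

Lemma unshifted_curve : unshifted_poly (separated_curve A B) = bm%:P%:P * sep_poly A' m.
Proof.
rewrite /unshifted_poly mmap_separated /= mulrBr; congr (_ - _).
  rewrite map_poly_comp -[LHS]/(A^:P \Po 'X) comp_polyXr linpoly_div.
  by rewrite map_polyZ /= mul_polyC.
rewrite map_poly_comp /= horner_map /= -[X in X%:P]/(B \Po ('X - c%:P)).
rewrite comp_polyZ rmorphXn /= comp_polyD comp_polyX comp_polyC subrK.
by rewrite -polyCM mul_polyC.
Qed.

Lemma function_field_eq : (map_poly iota A').[y] = x1 ^+ m.
Proof.
have [/(_ (separated_curve A B))[_ + _]] := xy_field.
move/(_ (ex_intro _ 1 (esym (mul1r _)))); rewrite -ev2_unshifted_poly unshifted_curve.
rewrite ev2M ev2CC ev2_sep_poly => /eqP.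
by rewrite mulf_eq0 fmorph_eq0 (negPf bm_neq0) subr_eq0 => /eqP.
Qed.

Lemma function_field_frac z :
  exists P Q, ev2 iota x1 y Q != 0 /\ z = ev2 iota x1 y P / ev2 iota x1 y Q.
Proof.
have [_ /(_ z)[P [Q [Q0 e]]]] := xy_field.
by exists (unshifted_poly P), (unshifted_poly Q); rewrite !ev2_unshifted_poly.
Qed.

(** A relation between x + c and y is a multiple of the curve, which has Y-degree p^n; one of
    smaller Y-degree is therefore zero. *)
Lemma function_field_reduced P : size A' = (p ^ n).+1 -> (size P <= p ^ n)%N ->
  ev2 iota x1 y P = 0 -> P = 0.
Proof.
move=> sA' sP; rewrite -eval_shifted_mpoly => /(xy_field.1 _).1[Q /(congr1 unshifted_poly)].
rewrite shifted_mpolyK {1}/unshifted_poly rmorphM /= -!/(unshifted_poly _) unshifted_curve => PE.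
have [Q0|Q0] := eqVneq (unshifted_poly Q) 0; first by rewrite PE Q0 mul0r.
have sS : size (sep_poly A' m) = (p ^ n).+1.
  by rewrite size_sep_poly sA' // ltnS expn_gt0 p_gt0.
have S0 : sep_poly A' m != 0 by rewrite -size_poly_gt0 sS.
have b0 : bm%:P%:P != 0 :> {poly {poly K}} by rewrite !polyC_eq0.
exfalso; move: sP; rewrite PE !size_mul ?mulf_neq0 // sS size_polyC polyC_eq0 bm_neq0 /=.
move: Q0; rewrite -size_poly_gt0; case: (size _) => // k _.
by rewrite add0n addSn addnS ltnNge leq_addl.
Qed.

End CurveFunctionField.

(** * Return to the original coordinates and the theorem *)

Local Open Scope classical_set_scope.
Local Open Scope card_scope.

Section ShiftedAutomorphisms.
Variables (K F : fieldType) (iota : {rmorphism K -> F}) (c : K) (x y : F).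
Local Notation x1 := (x + iota c).

(** Source of the constant (b - 1) b_(m-1) / (m b_m) in the group C: it is the effect on x of
    scaling x + c. *)
Lemma sends_shift (al : K) (z : F) (s : kaut iota) :
  sends x1 y (iota al * x1) z s <-> sends x y (iota al * x + iota ((al - 1) * c)) z s.
Proof.
rewrite /sends kautD kaut_iota; split=> -[sx ->]; split=> //; last first.
  by rewrite sx rmorphM rmorphB rmorph1 /=; ring.
by apply: (addIr (iota c)); rewrite sx rmorphM rmorphB rmorph1 /=; ring.
Qed.

Lemma sends_shift1 (z : F) (s : kaut iota) : sends x1 y x1 z s <-> sends x y x z s.
Proof.
by have := sends_shift 1 z s; rewrite subrr mul0r rmorph0 addr0 rmorph1 !mul1r.
Qed.

End ShiftedAutomorphisms.

Lemma exponent_gcd_div (K : fieldType) (n : nat) (a : nat -> K) (bm : K) : bm != 0 ->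
  exponent_gcd n (fun j => a j / bm) = exponent_gcd n a.
Proof.
by move=> b0; apply: eq_bigl => j; rewrite mulf_eq0 invr_eq0 (negPf b0) orbF.
Qed.

(** Over a closed field B is b_m (X - r)^m, and its coefficient of degree m - 1 determines r because
    m is nonzero in K. *)
Lemma unique_root_form (K : closedFieldType) (m : nat) (b : nat -> K) :
  let B := \sum_(j < m.+1) b j *: 'X^j in
  (0 < m)%N -> m%:R != 0 :> K -> b m != 0 -> (exists! r : K, root B r) ->
  B = b m *: ('X + (b m.-1 / (m%:R * b m))%:P) ^+ m.
Proof.
move=> B m0 mK bm0 [r [_ rU]].
have BE : B = \poly_(j < m.+1) b j by rewrite poly_def.
have lB : lead_coef B = b m by rewrite BE lead_coef_poly.
have sB : size B = m.+1 by rewrite BE size_poly_eq.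
have Br : B = b m *: ('X - r%:P) ^+ m.
  by rewrite {1}(@unique_root_power _ B r) ?lB ?sB // => z /rU.
have : B`_m.-1 = b m * (m%:R * - r).
  by rewrite Br coefZ -polyCN -[in X in _ ^+ X](prednK m0) coef_XaddC_exp prednK.
rewrite BE coef_poly ltnS leq_pred -BE => ->.
have -> : b m * (m%:R * - r) / (m%:R * b m) = - r by field; exact/andP.
by rewrite polyCN.
Qed.

Lemma two_term_linpoly (K : fieldType) (p n : nat) (a : nat -> K) : (0 < n)%N ->
  (forall j, (0 < j < n)%N -> a j = 0) ->
  linpoly p n a = a n *: 'X^(p ^ n) + a 0%N *: 'X.
Proof.
case: n => // n _ a0; rewrite /linpoly big_ord_recl big_ord_recr big1 => [|j _] /=.
  by rewrite add0r addrC expn0 expr1.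
by rewrite a0 ?scale0r //= /bump /= add1n ltnS.
Qed.

Theorem theorem3p2
  (p : nat) (p_prime : prime p)
  (K : closedFieldType) (phi : {rmorphism 'F_p -> K})
  (K_algebraic : forall z : K, algebraicOver phi z)
  (n m : nat) (n_ge1 : (1 <= n)%N) (m_ge2 : (2 <= m)%N)
  (p_ndvd_m : ~~ (p %| m)%N)
  (a b : nat -> K)
  (a0_neq0 : a 0%N != 0) (an_neq0 : a n != 0) (bm_neq0 : b m != 0) :
  let A : {poly K} := \sum_(j < n.+1) a j *: 'X^(p ^ j) in
  let B : {poly K} := \sum_(j < m.+1) b j *: 'X^j in
  let C := separated_curve A B in
  (4 <= curve_degree C)%N ->
  m != 1%N %[mod p ^ n] ->
  (exists! r : K, root B r) ->
  B = b m *: ('X + (b m.-1 / (m%:R * b m))%:P) ^+ m /\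
  ([/\ (m %| p ^ n + 1)%N,
       linearized (p ^ n) A,
       A = a n *: 'X^(p ^ n) + a 0%N *: 'X &
       projectively_equivalent C (separated_curve ('X^(p ^ n) + 'X) 'X^m)]
   \/
   ((~ (m %| p ^ n + 1)%N \/ ~ linearized (p ^ n) A) /\
    let d := (\big[gcdn/0]_(1 <= j < n.+1 | a j != 0%R) j)%N in
    (linearized (p ^ d) A /\
     forall e : nat, linearized (p ^ e) A -> (e <= d)%N) /\
    forall (F : fieldType) (iota : {rmorphism K -> F}) (x y : F),
      is_function_field iota C x y ->
      let G : set (kaut iota) :=
        [set s | exists a' : K,
           A.[a'] = 0 /\ sends x y x (y + iota a') s] in
      let H : set (kaut iota) :=
        [set s | exists b' : K,
           b' ^+ (m * (p ^ d - 1)) = 1 /\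
           sends x y
             (iota b' * x + iota ((b' - 1) * b m.-1 / (m%:R * b m)))
             (iota (b' ^+ m) * y) s] in
      [set: kaut iota] #= `I_(p ^ n * m * (p ^ d - 1)) /\
      is_sdprod [set: kaut iota] G H)).
Proof.
move=> A B C C4 m_mod Bu.
have pcharK : p \in [pchar K] by rewrite (rmorph_pchar phi) ?pchar_Fp.
have mK : m%:R != 0 :> K by rewrite -(dvdn_pcharf pcharK).
have BE : B = b m *: ('X + (b m.-1 / (m%:R * b m))%:P) ^+ m :=
  unique_root_form (ltnW m_ge2) mK bm_neq0 Bu.
split=> //.
set c := b m.-1 / _ in BE.
have sA : size A = (p ^ n).+1 := size_linpoly pcharK an_neq0.
have sB : size B = m.+1 by rewrite /B -poly_def size_poly_eq.
have deg4 : (3 < maxn (p ^ n) m)%N.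
  by have := leq_trans C4 (curve_degree_le A B); rewrite sA sB maxnSS.
have p1 := prime_gt1 p_prime.
have q1 : (1 < p ^ n)%N by rewrite -[1%N](expn0 p) ltn_exp2l.
have linP e := linearizedP pcharK n_ge1 an_neq0 e.
have [[mq aj0]|not_exc] := EM ((m %| p ^ n + 1)%N /\ forall j, (0 < j < n)%N -> a j = 0).
  left; have AE : A = a n *: 'X^(p ^ n) + a 0%N *: 'X by exact: two_term_linpoly.
  split=> //.
    apply/linP; split=> //; apply/dvdn_exponent_gcd => j /andP[j0 jn] aj.
    move: jn; rewrite leq_eqVlt => /predU1P[->|jn]; first exact: dvdnn.
    by move: aj; rewrite aj0 ?j0 ?eqxx.
  rewrite /C AE BE; apply: projectively_equivalent_fermat => //; rewrite (ltnW m_ge2) /=.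
  (* Here m <= q + 1, and m = q + 1 is excluded because it is congruent to 1 modulo q; so m <= q. *)
  have := dvdn_leq (ltn_addl _ (ltn0Sn 0)) mq; rewrite addn1 leq_eqVlt ltnS => /predU1P[me|//].
  by move: m_mod; rewrite me -addn1 -modnDml modnn eqxx.
right; split.
  (* If A is p^n-linearized, n divides every j with a_j nonzero, so no such j lies strictly between
     0 and n. *)
  have [mq|] := EM (m %| p ^ n + 1)%N; [right => /linP[_ nd] | by left].
  apply: not_exc; split=> // j /andP[j0 jn]; apply: contrapT => /eqP aj.
  have := (dvdn_exponent_gcd n a n).1 nd j.
  by rewrite j0 (ltnW jn) => /(_ isT aj) /(dvdn_leq j0); rewrite leqNgt jn.
move=> d; have d0 : (0 < d)%N by exact: exponent_gcd_gt0 n_ge1 an_neq0.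
split; first split.
- by apply/linP; rewrite d0.
- by move=> e /linP[_ /(dvdn_leq d0)].
move=> F iota x y xy_field G H; rewrite /C BE in xy_field.
(* Division by b_m gives x^m coefficient 1 and changes neither the roots of A nor the set of
   exponents that occur, hence not d. *)
pose a' j := a j / b m; have dE : exponent_gcd n a' = d by exact: exponent_gcd_div.
have a'0 j : (a' j == 0) = (a j == 0) by rewrite mulf_eq0 invr_eq0 (negPf bm_neq0) orbF.
have a'00 : a' 0%N != 0 by rewrite a'0.
have a'n0 : a' n != 0 by rewrite a'0.
have not_exc' : ~ ((m %| p ^ n + 1)%N /\ forall j, (0 < j < n)%N -> a' j = 0).
  by move=> [mq aj]; apply: not_exc; split=> // j /aj /eqP; rewrite a'0 => /eqP.
have eqn := function_field_eq bm_neq0 xy_field.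
have frac := function_field_frac xy_field.
have red P := @function_field_reduced _ _ _ _ _ _ _ _ _ _ _ (prime_gt0 p_prime) bm_neq0 xy_field P (size_linpoly pcharK a'n0).
have GE : G = aut_translations p n a' (x + iota c) y.
  apply/seteqP; split=> s [z [z0 s_z]]; exists z; move: z0; rewrite /A -/(linpoly p n a) (linpoly_div p n a bm_neq0) hornerZ.
    by move=> /eqP; rewrite mulf_eq0 (negPf bm_neq0) => /eqP z0; split=> //; apply: (sends_shift1 c x y (y + iota z) s).2.
  by move=> ->; rewrite mulr0; split=> //; exact: (sends_shift1 c x y (y + iota z) s).1.
have HE : H = aut_homotheties p n m a' (x + iota c) y.
  apply/seteqP; split=> s [z [z1 s_z]]; exists z; split; rewrite ?dE // in z1 *.
    by apply: (sends_shift c x y z _ s).2; rewrite mulrA.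
  by rewrite -mulrA; exact: (sends_shift c x y z _ s).1.
rewrite GE HE -dE; split.
  exact: (aut_card pcharK n_ge1 m_ge2 p_ndvd_m a'00 a'n0 eqn frac red
    deg4 m_mod not_exc').
exact: (aut_sdprod pcharK n_ge1 m_ge2 p_ndvd_m a'00 a'n0 eqn frac red
  deg4 m_mod not_exc').
Qed.
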